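(* Let $\chi(0)\in\ell^\infty(\mathbf{C}^r)$, $T>0$ and $\gamma\in L^\infty([0,T],\ell^\infty(\mathbf{C}^r))$. Suppose that there exists $C=C(\gamma,\chi(0),T)<\infty$ such that $$\mathsf{E}_{\mathbf k}|R_t|\le C\qquad\text{for all }\mathbf k\in\mathbf{Z}^d\text{ and all }t\in[0,T].$$ Then $\chi$ defined by $\chi_{\mathbf k}(t)=\mathsf{E}_{\mathbf k}[R_t]$, $\mathbf k\in\mathbf{Z}^d$, $t\in[0,T]$, is the unique $L^\infty([0,T],\ell^\infty(\mathbf{C}^r))$ (mild) solution of $$\dot\chi_{\mathbf k}=\lambda_{\mathbf k}\Big[-\chi_{\mathbf k}+C_fp_{\mathbf k}\chi_{\mathbf k}+C_b\sum_{\mathbf l,\mathbf m\in\mathbf{Z}^d}q_{\mathbf k,\mathbf l,\mathbf m}B_{\mathbf k,\mathbf l,\mathbf m}(\chi_{\mathbf l},\chi_{\mathbf m})+d_{\mathbf k}\gamma_{\mathbf k}\Big],\qquad\mathbf k\in\mathbf{Z}^d,$$ for the data $\gamma$, $\chi(0)$.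
   Context: **System.** Fix integers $d,r\ge1$. For $\mathbf k,\mathbf l,\mathbf m\in\mathbf{Z}^d$ fix constants $\lambda_{\mathbf k}>0$ and $p_{\mathbf k},q_{\mathbf k,\mathbf l,\mathbf m},d_{\mathbf k}\in[0,1]$, constants $C_f,C_b\ge0$, and bilinear maps $B_{\mathbf k,\mathbf l,\mathbf m}:\mathbf{C}^r\times\mathbf{C}^r\to\mathbf{C}^r$ with $|B_{\mathbf k,\mathbf l,\mathbf m}(\chi,\chi')|\le|\chi|\,|\chi'|$, where $|\cdot|$ is the Euclidean norm on $\mathbf{C}^r$. Put $q_{\mathbf k}=\sum_{\mathbf l,\mathbf m}q_{\mathbf k,\mathbf l,\mathbf m}$. Standing assumptions: $p_{\mathbf k}+q_{\mathbf k}+d_{\mathbf k}=1$ for all $\mathbf k$, and $p_{\mathbf k}\to0$, $q_{\mathbf k}\to0$ as $|\mathbf k|\to\infty$. $\ell^\infty(\mathbf{C}^r)$ is the space of bounded families $(a_{\mathbf k})_{\mathbf k\in\mathbf{Z}^d}$ in $\mathbf{C}^r$ with the supremum norm. Data: initial condition $\chi(0)$ and forcing $\gamma=(\gamma_{\mathbf k}(t))$. The system is understood in mild form: measurable $t\mapsto\chi_{\mathbf k}(t)\in\mathbf{C}^r$ with, for all $\mathbf k$, $$\chi_{\mathbf k}(t)=e^{-\lambda_{\mathbf k}t}\chi_{\mathbf k}(0)+\int_0^t\lambda_{\mathbf k}e^{-\lambda_{\mathbf k}(t-s)}\Big[C_fp_{\mathbf k}\chi_{\mathbf k}(s)+C_b\sum_{\mathbf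 l,\mathbf m}q_{\mathbf k,\mathbf l,\mathbf m}B_{\mathbf k,\mathbf l,\mathbf m}(\chi_{\mathbf l}(s),\chi_{\mathbf m}(s))+d_{\mathbf k}\gamma_{\mathbf k}(s)\Big]ds.$$ **Branching tree.** Let $\mathscr{I}=\bigcup_{n\ge0}\{0,1,2\}^n$ be the set of labels, $\emptyset$ the label of length $0$; for a label $\alpha=(\alpha_1,\dots,\alpha_n)$ write $|\alpha|=n$, $\alpha|_j=(\alpha_1,\dots,\alpha_j)$, and $(\alpha,i)$, $(i,\alpha)$ for the labels obtained by appending, prepending $i\in\{0,1,2\}$. Take independent families of independent variables: $(E_\alpha)_{\alpha\in\mathscr I}$ exponential of mean one; $(U_\alpha)_{\alpha\in\mathscr I}$ uniform on $[0,1]$; and pairs $(Y^{(1)}_\alpha(\mathbf k),Y^{(2)}_\alpha(\mathbf k))$, $\alpha\in\mathscr I$, $\mathbf k\in\mathbf{Z}^d$, with $P[Y^{(1)}_\alpha(\mathbf k)=\mathbf l,Y^{(2)}_\alpha(\mathbf k)=\mathbf m]=q_{\mathbf k,\mathbf l,\mathbf m}/q_{\mathbf k}$ if $q_{\mathbf k}>0$ (arbitrary law if $q_{\mathbf k}=0$). Fix $\mathbf k\in\mathbf{Z}^d$ and set $\hat{\mathbf K}_\emptyset=\mathbf k$, $\tau^B_\emptyset=0$, $\tau^D_\emptyset=\lambda_{\mathbf k}^{-1}E_\emptyset$, $I_\emptyset=1$. Inductively, for $\beta\in\mathscr I$ and $i\in\{0,1,2\}$: $\hat{\mathbf K}_{(\beta,0)}=\hat{\mathbf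 K}_\beta$, $\hat{\mathbf K}_{(\beta,i)}=Y^{(i)}_\beta(\hat{\mathbf K}_\beta)$ for $i=1,2$; $\tau^B_{(\beta,i)}=\tau^D_\beta$, $\tau^D_{(\beta,i)}=\tau^B_{(\beta,i)}+\lambda^{-1}_{\hat{\mathbf K}_{(\beta,i)}}E_{(\beta,i)}$; $I_{(\beta,0)}=1$ if $U_\beta\in[0,p_{\hat{\mathbf K}_\beta}]$ and $0$ otherwise; for $i=1,2$, $I_{(\beta,i)}=1$ if $U_\beta\in[1-q_{\hat{\mathbf K}_\beta},1]$ and $0$ otherwise. With an isolated cemetery state $\Delta$, set $\mathbf K_\alpha=\hat{\mathbf K}_\alpha$ if $\prod_{j=1}^{|\alpha|}I_{\alpha|_j}=1$ and $\mathbf K_\alpha=\Delta$ otherwise. The branching tree rooted at $\mathbf k$ is $\mathcal T_{\mathbf k}=(\mathbf K_\alpha,\tau^B_\alpha,\tau^D_\alpha)_{\alpha\in\mathscr I}$; $\mathsf P_{\mathbf k}$ denotes its law and $\mathsf E_{\mathbf k}$ the corresponding expectation. For a tree $\mathcal T=(\mathbf k_\alpha,s_\alpha,t_\alpha)_{\alpha\in\mathscr I}$ let $\pi_i(\mathcal T)=(\mathbf k_{(i,\alpha)},s_{(i,\alpha)}-t_\emptyset,t_{(i,\alpha)}-t_\emptyset)_{\alpha\in\mathscr I}$, $i=0,1,2$, and let $N_{[0,t]}(\mathcal T)$ be the number of $\alpha\in\mathscr I$ with $\mathbf k_\alpha\ne\Delta$ and $s_\alpha\le t$; $N_{[0,t]}<\infty$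 holds $\mathsf P_{\mathbf k}$-a.s. for all $t\geq 0$. There is a death at $\emptyset$ if $\mathbf k_{(0)}=\mathbf k_{(1)}=\mathbf k_{(2)}=\Delta$; a flip at $\emptyset$ if $\mathbf k_{(0)}\ne\Delta$, $\mathbf k_{(1)}=\mathbf k_{(2)}=\Delta$; a branch at $\emptyset$ if $\mathbf k_{(0)}=\Delta$ and $\mathbf k_{(1)},\mathbf k_{(2)}\ne\Delta$; $\mathsf P_{\mathbf k}$-a.s. exactly one of these occurs. **Evaluation.** For given $\chi(0)$, $\gamma$, the maps $R_t$, $t\ge0$, from trees to $\mathbf{C}^r$ are determined, on trees with $N_{[0,t]}(\mathcal T)<\infty$, by the (terminating) recursion: $R_t(\mathcal T)=\chi_{\mathbf k_\emptyset}(0)$ if $t_\emptyset\ge t$; and if $t_\emptyset<t$: $R_t(\mathcal T)=\gamma_{\mathbf k_\emptyset}(t-t_\emptyset)$ for a death at $\emptyset$; $R_t(\mathcal T)=C_fR_{t-t_\emptyset}(\pi_0(\mathcal T))$ for a flip at $\emptyset$; $R_t(\mathcal T)=C_bB_{\mathbf k_\emptyset,\mathbf k_{(1)},\mathbf k_{(2)}}(R_{t-t_\emptyset}(\pi_1(\mathcal T)),R_{t-t_\emptyset}(\pi_2(\mathcal T)))$ for a branch at $\emptyset$. *)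

(* Defs.v *)
From HB Require Import structures.
From mathcomp Require Import all_boot all_order all_algebra.
From mathcomp Require Import complex.
From mathcomp Require Import all_classical all_reals all_analysis.

Set Implicit Arguments.
Unset Strict Implicit.
Unset Printing Implicit Defensive.

Import Order.TTheory GRing.Theory Num.Theory.
Import numFieldNormedType.Exports.

Local Open Scope classical_set_scope.
Local Open Scope ring_scope.
Local Open Scope complex_scope.

Definition Zd (d : nat) := 'rV[int]_d.

Definition Cr (R : realType) (r : nat) := 'rV[R[i]]_r.

Definition lattice_norm (R : realType) (d : nat) (k : Zd d) : R :=
  Num.sqrt (\sum_(i < d) ((k 0 i)%:~R : R) ^+ 2).

(* The Euclidean norm; [`|v|] on row vectors would be the maximum norm. *)
Definition enorm (R : realType) (r : nat) (v : Cr R r) : R :=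
  Num.sqrt (\sum_(j < r) ComplexField.Normc.normc (v 0 j) ^+ 2).

Definition tends_to_0 (R : realType) (d : nat) (u : Zd d -> R) :=
  forall e : R, 0 < e ->
  exists M : R, forall k, M <= lattice_norm R k -> `|u k| < e.

(* Integrals and sums of C^r-valued functions are taken coordinatewise, on real
   and imaginary parts.  As for [Rintegral], the value of [vint] or [vsum] is
   meaningful only for absolutely integrable (summable) arguments. *)
Definition vint (R : realType) (r : nat) (disp : measure_display)
    (X : measurableType disp) (mu : {measure set X -> \bar R}) (D : set X)
    (f : X -> Cr R r) : Cr R r :=
  \row_j ((\int[mu]_(x in D) complex.Re (f x 0 j)) +i*
          (\int[mu]_(x in D) complex.Im (f x 0 j))).

Definition rsum (R : realType) (I : choiceType) (a : I -> R) : R :=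
  fine (\esum_(i in [set: I]) (EFin \o a)^\+ i)%E -
  fine (\esum_(i in [set: I]) (EFin \o a)^\- i)%E.

Definition vsum (R : realType) (r : nat) (I : choiceType) (f : I -> Cr R r) :
    Cr R r :=
  \row_j (rsum (fun i => complex.Re (f i 0 j)) +i*
          rsum (fun i => complex.Im (f i 0 j))).

Definition linfty (R : realType) (d r : nat) (a : Zd d -> Cr R r) :=
  exists M : R, forall k, enorm (a k) <= M.

(* L^oo([0, T], l^oo(C^r)), with measurability understood coordinate by
   coordinate. *)
Definition Linfty (R : realType) (d r : nat) (T : R) (f : Zd d -> R -> Cr R r) :=
  (forall k j,
     measurable_fun `[0, T] (fun t => complex.Re (f k t 0 j)) /\
     measurable_fun `[0, T] (fun t => complex.Im (f k t 0 j))) /\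
  exists M : R, {ae lebesgue_measure,
    forall t : R, t \in `[0, T] -> forall k, enorm (f k t) <= M}.

Definition qsum (R : realType) (d : nat) (q : Zd d -> Zd d -> Zd d -> R)
    (k : Zd d) : \bar R :=
  (\esum_(lm in [set: Zd d * Zd d]) (q k lm.1 lm.2)%:E)%E.

Record system (R : realType) (d r : nat) := System {
  lam : Zd d -> R;
  pr : Zd d -> R;
  qr : Zd d -> Zd d -> Zd d -> R;
  dr : Zd d -> R;
  Cf : R;
  Cb : R;
  B : Zd d -> Zd d -> Zd d ->
      {bilinear 'rV[R[i]]_r -> 'rV[R[i]]_r -> 'rV[R[i]]_r};
  lam_gt0 : forall k, 0 < lam k;
  pr_01 : forall k, 0 <= pr k <= 1;
  qr_01 : forall k l m, 0 <= qr k l m <= 1;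
  dr_01 : forall k, 0 <= dr k <= 1;
  Cf_ge0 : 0 <= Cf;
  Cb_ge0 : 0 <= Cb;
  B_le : forall k l m x y, enorm (B k l m x y) <= enorm x * enorm y;
  (* stated in [\bar R], so that it includes the finiteness of the sum *)
  total_mass : forall k,
    ((pr k)%:E + qsum qr k + (dr k)%:E = 1)%E;
  pr_cvg : tends_to_0 pr;
  qr_cvg : tends_to_0 (fun k => fine (qsum qr k))
}.

Definition qtot (R : realType) (d r : nat) (S : system R d r) (k : Zd d) : R :=
  fine (qsum (qr S) k).

Section mild.
Context {R : realType} {d r : nat} (S : system R d r).

Definition nonlinearity (gamma chi : Zd d -> R -> Cr R r) (k : Zd d) (s : R) :
    Cr R r :=
  (Cf S * pr S k)%:C *: chi k s
  + (Cb S)%:C *: vsum (fun lm : Zd d * Zd d =>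
      (qr S k lm.1 lm.2)%:C *: B S k lm.1 lm.2 (chi lm.1 s) (chi lm.2 s))
  + (dr S k)%:C *: gamma k s.

Definition mild_solution (T : R) (chi0 : Zd d -> Cr R r)
    (gamma chi : Zd d -> R -> Cr R r) :=
  Linfty T chi /\
  forall k t, t \in `[0, T] ->
    chi k t = (expR (- lam S k * t))%:C *: chi0 k
      + vint lebesgue_measure `[0, t] (fun s =>
          (lam S k * expR (- lam S k * (t - s)))%:C *:
            nonlinearity gamma chi k s).

End mild.

(* The label (a_1, ..., a_n) is the sequence [:: a_1; ...; a_n]: children are
   obtained with [rcons], and prepending is [cons]. *)
Definition label := seq 'I_3.

Definition o0 : 'I_3 := @Ordinal 3 0 isT.
Definition o1 : 'I_3 := @Ordinal 3 1 isT.
Definition o2 : 'I_3 := @Ordinal 3 2 isT.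

(* The function g on labels with g [::] = x0 and
   g (rcons b i) = step b (g b) i. *)
Fixpoint label_rec_rev (A : Type) (x0 : A) (step : label -> A -> 'I_3 -> A)
    (b : label) : A :=
  if b is i :: b' then step (rev b') (label_rec_rev x0 step b') i else x0.

Definition label_rec (A : Type) (x0 : A) (step : label -> A -> 'I_3 -> A)
    (a : label) : A := label_rec_rev x0 step (rev a).

Lemma label_rec_nil (A : Type) (x0 : A) (step : label -> A -> 'I_3 -> A) :
  label_rec x0 step [::] = x0.
Proof. by []. Qed.

Lemma label_rec_rcons (A : Type) (x0 : A) (step : label -> A -> 'I_3 -> A)
    (b : label) (i : 'I_3) :
  label_rec x0 step (rcons b i) = step b (label_rec x0 step b) i.
Proof. by rewrite /label_rec rev_rcons /= revK. Qed.

(* [site] takes the value [None] at the cemetery state. *)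
Record tree (R : realType) (d : nat) := Tree {
  site : label -> option (Zd d);
  birth : label -> R;
  death : label -> R
}.

Definition subtree (R : realType) (d : nat) (i : 'I_3) (T : tree R d) :
    tree R d :=
  Tree (fun a => site T (i :: a))
       (fun a => birth T (i :: a) - death T [::])
       (fun a => death T (i :: a) - death T [::]).

Section tree_process.
Context {R : realType} {d r : nat} (S : system R d r).
Context {disp : measure_display} {Omega : measurableType disp}.
Variables (E U : label -> Omega -> R) (Y : label -> Zd d -> Omega -> Zd d * Zd d).
Variables (k : Zd d) (w : Omega).

Definition hatK : label -> Zd d :=
  label_rec k (fun b x i =>
    if i == o0 then x else if i == o1 then (Y b x w).1 else (Y b x w).2).

Definition tauB : label -> R :=
  label_rec 0 (fun b s _ => s + (lam S (hatK b))^-1 * E b w).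

Definition tauD (a : label) : R := tauB a + (lam S (hatK a))^-1 * E a w.

Lemma tauB_rcons b i : tauB (rcons b i) = tauD b.
Proof. by rewrite /tauB label_rec_rcons. Qed.

Definition indic_I : label -> bool :=
  label_rec true (fun b _ i =>
    if i == o0 then 0 <= U b w <= pr S (hatK b)
    else 1 - qtot S (hatK b) <= U b w <= 1).

Definition alive (a : label) : bool :=
  \big[andb/true]_(1 <= j < (size a).+1) indic_I (take j a).

Definition branching_tree : tree R d :=
  Tree (fun a => if alive a then Some (hatK a) else None) tauB tauD.

End tree_process.

Section independence.
Context {R : realType} {disp : measure_display} {Omega : measurableType disp}.
Variable P : probability Omega R.

(* Mutual independence of the classes of events F i; when each F i is a
   sigma-algebra generated by a random variable X_i, this is mutual
   independence of the X_i. *)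
Definition independent_events (I : eqType) (F : I -> set (set Omega)) :=
  forall (J : seq I) (A : I -> set Omega), uniq J ->
    (forall i, i \in J -> F i (A i)) ->
    P (\bigcap_(i in [set` J]) A i) = (\prod_(i <- J) P (A i))%E.

Definition generated_events {d : nat} (E U : label -> Omega -> R)
    (Y : label -> Zd d -> Omega -> Zd d * Zd d)
    (i : label + label + label * Zd d) : set (set Omega) :=
  match i with
  | inl (inl a) => [set E a @^-1` A | A in [set A | measurable A]]
  | inl (inr a) => [set U a @^-1` A | A in [set A | measurable A]]
  | inr (a, k) => [set Y a k @^-1` A | A in [set: set (Zd d * Zd d)]]
  end.

Record branching_variables {d r : nat} (S : system R d r)
    (E U : label -> {RV P >-> R})
    (Y : label -> Zd d -> Omega -> Zd d * Zd d) : Prop := {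
  law_E : forall a A, measurable A ->
    distribution P (E a) A = exponential_prob 1 A;
  law_U : forall a A, measurable A ->
    distribution P (U a) A = uniform_prob (@ltr01 R) A;
  measurable_Y : forall a k z, measurable (Y a k @^-1` [set z]);
  law_Y : forall a k l m, 0 < qtot S k ->
    P (Y a k @^-1` [set (l, m)]) = (qr S k l m / qtot S k)%:E;
  independence_EUY : independent_events (generated_events E U Y)
}.

End independence.

Section evaluation.
Context {R : realType} {d r : nat} (S : system R d r).
Variables (chi0 : Zd d -> Cr R r) (gamma : Zd d -> R -> Cr R r).

(* [evaluates t T v]: the recursion for R_t terminates on T with value v. *)
Inductive evaluates : R -> tree R d -> Cr R r -> Prop :=
| evaluates_initial t T k :
    site T [::] = Some k -> t <= death T [::] ->
    evaluates t T (chi0 k)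
| evaluates_death t T k :
    site T [::] = Some k -> death T [::] < t ->
    site T [:: o0] = None -> site T [:: o1] = None -> site T [:: o2] = None ->
    evaluates t T (gamma k (t - death T [::]))
| evaluates_flip t T k k0 v :
    site T [::] = Some k -> death T [::] < t ->
    site T [:: o0] = Some k0 -> site T [:: o1] = None ->
    site T [:: o2] = None ->
    evaluates (t - death T [::]) (subtree o0 T) v ->
    evaluates t T ((Cf S)%:C *: v)
| evaluates_branch t T k k1 k2 v1 v2 :
    site T [::] = Some k -> death T [::] < t ->
    site T [:: o0] = None -> site T [:: o1] = Some k1 ->
    site T [:: o2] = Some k2 ->
    evaluates (t - death T [::]) (subtree o1 T) v1 ->
    evaluates (t - death T [::]) (subtree o2 T) v2 ->
    evaluates t T ((Cb S)%:C *: B S k k1 k2 v1 v2).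

Lemma evaluates_unique t T v v' : evaluates t T v -> evaluates t T v' -> v = v'.
Proof.
move=> ev; elim: ev v' => {t T v}
  [t T k e h | t T k e h e0 e1 e2 | t T k k0 v e h e0 e1 e2 _ IH
  | t T k k1 k2 v1 v2 e h e0 e1 e2 _ IH1 _ IH2] v' ev';
  inversion ev' as [u T' k' f g | u T' k' f g f0 f1 f2
    | u T' k' k0' w f g f0 f1 f2 ev | u T' k' k1' k2' w1 w2 f g f0 f1 f2 ev1 ev2];
  subst; try congruence; try by [move: h; rewrite leNgt g | move: g; rewrite leNgt h].
- by rewrite (IH _ ev).
- have [<- <- <-] : [/\ k = k', k1 = k1' & k2 = k2'] by split; congruence.
  by rewrite (IH1 _ ev1) (IH2 _ ev2).
Qed.

(* The value 0 is used where the recursion is undefined or does not terminate;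
   this does not happen for almost every branching tree. *)
Definition evalR (t : R) (T : tree R d) : Cr R r :=
  xget 0 [set v | evaluates t T v].

End evaluation.

(* Main.v *)
(** Uniqueness is deterministic.  The difference of two bounded mild solutions
    satisfies |w_k(t)| <= int_0^t lam_k e^{-lam_k (t - s)} A_k |w(s)| ds with A_k
    a multiple of p_k + q_k; since A_k -> 0, a weight e^{theta t} with theta large
    makes this a contraction, uniformly in k.

    Existence is the first-step decomposition of the tree.  By independence, on
    the event that the root dies before t, the flip, branch or death mark, the
    offspring sites, the time s left at the death of the root (with density
    lam_k e^{-lam_k (t - s)} on [0, t]) and the subtrees are independent, and each
    subtree is again a branching tree; taking the expectation of the recursion for
    R_t gives the mild equation.  The value 0, which [evalR] takes when the recursion
    does not terminate, is absorbing, so that the recursion holds surely and the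
    almost sure finiteness of N_{[0, t]} is not needed. *)

Require Import Defs.
From HB Require Import structures.
From mathcomp Require Import all_boot all_order all_algebra.
From mathcomp Require Import complex ring lra zify.
From mathcomp Require Import all_classical all_reals all_analysis.
From mathcomp Require Import measurable_realfun.

Set Implicit Arguments.
Unset Strict Implicit.
Unset Printing Implicit Defensive.

Import Order.TTheory GRing.Theory Num.Theory.
Import numFieldNormedType.Exports.

Local Open Scope classical_set_scope.
Local Open Scope ring_scope.

(** The hypothesis bounds a first moment, while the branch term is quadratic in the subtrees. Given
    the time left, the mean of a product of one real coordinate from each subtree is a product of
    two means, at most [C * C]. This is why bilinear maps are expanded into real coordinates, and
    why the sum over offspring pairs is dominated by a multiple of [qr S k l m].

    The second obstacle is measurability. [evalR] is an [xget] of an inductive predicate, [gamma] is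
    arbitrary outside [[0, T]], and the law of [Y] is arbitrary where [qtot] vanishes. So [evalR] is
    written as an eventually constant limit of a truncated recursion on a space of configurations,
    with [gamma] cut to [[0, T]] and [Y] made constant where its law is free. These changes are
    invisible off the null event that some clock is negative or some uniform draw is at least 1, and
    null events do not affect integrals, even those of non-measurable functions.

    Laws are restricted to an event of the root without normalisation, since that event may have
    probability zero. *)

Section real_coordinates.
Local Open Scope complex_scope.
Context {R : realType} {r : nat}.
Implicit Types (c : 'I_r * bool) (v w x y : Cr R r) (a : R).

(** [Cr R r] is handled as a real vector space of dimension 2r: [(j, true)] selects the real part of
    entry j and [(j, false)] the imaginary part. [vint] and [vsum] act on each such coordinate
    separately, so identities are proved between real numbers. *)
Definition rcoord c v : R :=
  if c.2 then complex.Re (v 0 c.1) else complex.Im (v 0 c.1).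

Definition rbasis c : Cr R r :=
  (if c.2 then 1 else 'i) *: delta_mx 0 c.1.

Lemma rcoordP v w : (forall c, rcoord c v = rcoord c w) -> v = w.
Proof.
move=> h; apply/rowP => j.
have := h (j, true); have := h (j, false); rewrite /rcoord/=.
by case: (v 0 j) (w 0 j) => [a b] [a' b'] /= -> ->.
Qed.

Lemma rcoord0 c : rcoord c 0 = 0.
Proof. by rewrite /rcoord mxE; case: ifP. Qed.

Lemma rcoordD c v w : rcoord c (v + w) = rcoord c v + rcoord c w.
Proof.
by rewrite /rcoord mxE; case: (v 0 _) (w 0 _) => [a b] [a' b'] /=; case: ifP.
Qed.

Lemma rcoordN c v : rcoord c (- v) = - rcoord c v.
Proof. by rewrite /rcoord mxE; case: (v 0 _) => [a b] /=; case: ifP. Qed.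

Lemma rcoordB c v w : rcoord c (v - w) = rcoord c v - rcoord c w.
Proof. by rewrite rcoordD rcoordN. Qed.

Lemma rcoordZ c a v : rcoord c (a%:C *: v) = a * rcoord c v.
Proof.
rewrite /rcoord mxE; case: (v 0 _) => [b b'] /=.
by case: ifP => _; rewrite !(mul0r, subr0, addr0).
Qed.

Lemma rcoord_sum c (I : Type) (s : seq I) (F : I -> Cr R r) :
  rcoord c (\sum_(i <- s) F i) = \sum_(i <- s) rcoord c (F i).
Proof.
elim: s => [|i s ih]; first by rewrite !big_nil rcoord0.
by rewrite !big_cons rcoordD ih.
Qed.

Lemma rcoord_vint c (disp : measure_display) (X : measurableType disp)
    (mu : {measure set X -> \bar R}) (D : set X) (f : X -> Cr R r) :
  rcoord c (vint mu D f) = \int[mu]_(x in D) rcoord c (f x).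
Proof. by rewrite /rcoord mxE /=; case: ifP. Qed.

Lemma rcoord_vsum c (I : choiceType) (f : I -> Cr R r) :
  rcoord c (vsum f) = rsum (fun i => rcoord c (f i)).
Proof. by rewrite /rcoord mxE /=; case: ifP. Qed.

Lemma normc_sqr (z : R[i]) :
  ComplexField.Normc.normc z ^+ 2 = complex.Re z ^+ 2 + complex.Im z ^+ 2.
Proof. by case: z => a b /=; rewrite sqr_sqrtr// addr_ge0// sqr_ge0. Qed.

Lemma sumr_rcoord (V : nmodType) (F : 'I_r * bool -> V) :
  \sum_c F c = \sum_j (F (j, true) + F (j, false)).
Proof.
rewrite (eq_bigr (fun p => F (p.1, p.2))); last by case.
rewrite -(pair_bigA _ (fun j b => F (j, b))) /=; apply: eq_bigr => j _.
by rewrite big_bool.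
Qed.

Lemma enormE v : enorm v = Num.sqrt (\sum_c rcoord c v ^+ 2).
Proof.
congr Num.sqrt; rewrite sumr_rcoord; apply: eq_bigr => j _.
exact: normc_sqr.
Qed.

Lemma enorm_ge0 v : 0 <= enorm v.
Proof. exact: sqrtr_ge0. Qed.

Lemma enorm0 : enorm (0 : Cr R r) = 0.
Proof.
rewrite enormE big1 ?sqrtr0// => c _.
by rewrite rcoord0 expr0n.
Qed.

Lemma rcoord_le_enorm c v : `|rcoord c v| <= enorm v.
Proof.
rewrite enormE -sqrtr_sqr ler_sqrt; last by apply: sumr_ge0 => *; exact: sqr_ge0.
by rewrite (bigD1 c)//= lerDl sumr_ge0// => *; exact: sqr_ge0.
Qed.

Lemma enorm_le_sum v : enorm v <= \sum_c `|rcoord c v|.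
Proof.
have s0 : 0 <= \sum_c `|rcoord c v| by apply: sumr_ge0.
rewrite enormE -(ger0_norm s0) -sqrtr_sqr ler_sqrt ?sqr_ge0//.
rewrite expr2 mulr_suml; apply: ler_sum => c _.
rewrite -real_normK ?num_real// expr2 ler_wpM2l//.
by rewrite (bigD1 c)//= lerDl sumr_ge0.
Qed.

Lemma rcoord_decomp v : v = \sum_c (rcoord c v)%:C *: rbasis c.
Proof.
rewrite {1}[v]row_sum_delta sumr_rcoord; apply: eq_bigr => j _.
rewrite /rbasis /rcoord/= !scalerA -scalerDl; congr (_ *: _).
case: (v 0 j) => a b /=; apply/eqP; rewrite eq_complex /=.
by rewrite !(mulr1, mulr0, mul0r, subr0, add0r, addr0) !eqxx.
Qed.

(** The coefficients depend on [B] alone, so measurability and expectation of [B x y] reduce to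
    products of one real coordinate of [x] and one of [y]. The independence of two subtrees is
    applied to such products. *)
Lemma rcoord_bilinear (B : {bilinear 'rV[R[i]]_r -> 'rV[R[i]]_r -> 'rV[R[i]]_r})
    c x y :
  rcoord c (B x y) =
  \sum_c1 \sum_c2 rcoord c (B (rbasis c1) (rbasis c2)) *
                  (rcoord c1 x * rcoord c2 y).
Proof.
rewrite {1}[x]rcoord_decomp linear_sumlz rcoord_sum; apply: eq_bigr => c1 _.
rewrite {1}[y]rcoord_decomp linear_sumr rcoord_sum; apply: eq_bigr => c2 _.
by rewrite linearZl_LR linearZr_LR !rcoordZ; ring.
Qed.

(** Euclidean norms are traded for sums of coordinates because the means that get computed are those
    of products of single coordinates. *)
Lemma rcoord_bilinear_bound
    (B : {bilinear 'rV[R[i]]_r -> 'rV[R[i]]_r -> 'rV[R[i]]_r}) c x y :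
  (forall x y, enorm (B x y) <= enorm x * enorm y) ->
  `|rcoord c (B x y)| <= \sum_c1 \sum_c2 `|rcoord c1 x| * `|rcoord c2 y|.
Proof.
move=> hB; apply: (le_trans (rcoord_le_enorm _ _)); apply: (le_trans (hB _ _)).
apply: (le_trans (ler_pM (enorm_ge0 _) (enorm_ge0 _) (enorm_le_sum _) (enorm_le_sum _))).
by rewrite mulr_suml; apply: ler_sum => c1 _; rewrite mulr_sumr.
Qed.

End real_coordinates.

(** * Absolutely convergent sums over a countable index *)

Section countable_sums.
Context {R : realType} {I : countType}.
Implicit Types a b : I -> R.

(** Coding the index by [pickle] turns the sum into a series over the natural numbers, padded with 0
    at numbers that code nothing, so that the theorems on series of measurable functions apply. *)
Lemma esum_nneseries (a : I -> \bar R) : (forall i, 0 <= a i)%E ->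
  (\esum_(i in [set: I]) a i =
   \sum_(n <oo) oapp a 0 (@pickle_inv I n))%E.
Proof.
move=> a0; rewrite nneseries_esumT; last by move=> n; case: pickle_inv.
rewrite (eq_esum (b := fun i => oapp a 0%E (@pickle_inv I (pickle i)))); last first.
  by move=> i _; rewrite pickleK_inv.
rewrite -(esum_image [set: I] pickle (fun n => oapp a 0%E (@pickle_inv I n))); last first.
  by move=> i j _ _; exact: (pcan_inj pickleK_inv).
rewrite esum_mkcond; apply: eq_esum => n _; case: ifPn => // nr.
case e : (@pickle_inv I n) => [i|]//; exfalso; move/negP: nr; apply; rewrite inE.
by exists i => //; have := @pickle_invK I n; rewrite /ocancel e.
Qed.

Lemma le_nnesum_lty a b : (forall i, 0 <= a i <= b i) ->
  (\esum_(i in [set: I]) (b i)%:E < +oo ->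
  \esum_(i in [set: I]) (a i)%:E < +oo)%E.
Proof.
move=> ab; apply: le_lt_trans; apply: le_esum => i _.
by rewrite lee_fin; case/andP: (ab i).
Qed.

Definition rsummable a := (\esum_(i in [set: I]) `|a i|%:E < +oo)%E.

(** [rsum] is defined through positive and negative parts. Any other splitting into nonnegative
    summable families gives the same value, which is what linearity of [rsum] rests on. *)
Lemma rsumE_sub a b (c : I -> R) : (forall i, 0 <= b i) -> (forall i, 0 <= c i) ->
  rsummable b -> rsummable c -> (forall i, a i = b i - c i) ->
  rsum a = fine (\esum_(i in [set: I]) (b i)%:E) -
           fine (\esum_(i in [set: I]) (c i)%:E).
Proof.
move=> b0 c0 sb sc abc.
have fb : (\esum_(i in [set: I]) (b i)%:E)%E \is a fin_num.
  rewrite ge0_fin_numE; last by apply: esum_ge0 => i _; rewrite lee_fin.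
  by apply: le_nnesum_lty sb => i; rewrite b0 ler_norm.
have fc : (\esum_(i in [set: I]) (c i)%:E)%E \is a fin_num.
  rewrite ge0_fin_numE; last by apply: esum_ge0 => i _; rewrite lee_fin.
  by apply: le_nnesum_lty sc => i; rewrite c0 ler_norm.
rewrite -fineB// -(@esumB R I [set: I] (EFin \o b) (EFin \o c))//; last 2 first.
- by move=> i _; rewrite /= lee_fin.
- by move=> i _; rewrite /= lee_fin.
have -> : ((EFin \o b) \- (EFin \o c))%E = EFin \o a.
  by apply/funext => i /=; rewrite abc EFinB.
rewrite fineB//.
- rewrite ge0_fin_numE ?esum_ge0//; apply: le_lt_trans sb; apply: le_esum => i _.
  rewrite funeposE /= ger0_norm// -EFin_max lee_fin abc ge_max b0 andbT.
  by rewrite gerBl.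
- rewrite ge0_fin_numE ?esum_ge0//; apply: le_lt_trans sc; apply: le_esum => i _.
  rewrite funenegE /= ger0_norm// -EFin_max lee_fin abc ge_max c0 andbT.
  by rewrite opprB gerBl.
Qed.

Lemma rsummable_maxr a : rsummable a ->
  rsummable (fun i => Num.max (a i) 0) /\ rsummable (fun i => Num.max (- a i) 0).
Proof.
by move=> sa; split; apply: le_nnesum_lty sa => i;
  rewrite normr_ge0 ger0_norm ?le_max ?lexx ?orbT// ge_max normr_ge0
    ?(ler_norm, ler_normr, lexx, orbT)// -normrN ler_norm.
Qed.

Lemma maxr_sub (x : R) : x = Num.max x 0 - Num.max (- x) 0.
Proof. by rewrite oppr_max opprK oppr0 addr_max_min addr0. Qed.

Lemma rsummableD a b : rsummable a -> rsummable b ->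
  rsummable (fun i => a i + b i).
Proof.
move=> sa sb; apply: (@le_lt_trans _ _ (\esum_(i in [set: I])
    (`|a i|%:E + `|b i|%:E))%E).
  by apply: le_esum => i _; rewrite -EFinD lee_fin ler_normD.
by rewrite esumD//; exact: lte_add_pinfty.
Qed.

Lemma rsummable_fin_num a : (forall i, 0 <= a i) -> rsummable a ->
  (\esum_(i in [set: I]) (a i)%:E)%E \is a fin_num.
Proof.
move=> a0 sa; rewrite ge0_fin_numE; last by apply: esum_ge0 => i _; rewrite lee_fin.
by apply: le_nnesum_lty sa => i; rewrite a0 ler_norm.
Qed.

Lemma fine_esumD a b : (forall i, 0 <= a i) -> (forall i, 0 <= b i) ->
  rsummable a -> rsummable b ->
  fine (\esum_(i in [set: I]) (a i + b i)%:E) =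
  fine (\esum_(i in [set: I]) (a i)%:E) + fine (\esum_(i in [set: I]) (b i)%:E).
Proof.
move=> a0 b0 sa sb; rewrite -fineD ?rsummable_fin_num//.
rewrite -esumD//.
- by move=> i _; rewrite lee_fin.
- by move=> i _; rewrite lee_fin.
Qed.

Let max0 (x : R) : 0 <= Num.max x 0. Proof. by rewrite le_max lexx orbT. Qed.

Lemma rsumE_maxr a : rsummable a ->
  rsum a = fine (\esum_(i in [set: I]) (Num.max (a i) 0)%:E) -
           fine (\esum_(i in [set: I]) (Num.max (- a i) 0)%:E).
Proof.
by move=> /rsummable_maxr[sp sn]; apply: rsumE_sub => // i; exact: maxr_sub.
Qed.

Lemma rsumB a b : rsummable a -> rsummable b ->
  rsum a - rsum b = rsum (fun i => a i - b i).
Proof.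
move=> sa sb; have [pa na] := rsummable_maxr sa.
have [pb nb] := rsummable_maxr sb.
(* The splitting (a^+ + b^-) - (a^- + b^+) is in general not the one into the parts of a - b, hence
   the use of [rsumE_sub]. *)
rewrite (@rsumE_sub (fun i => a i - b i)
  (fun i => Num.max (a i) 0 + Num.max (- b i) 0)
  (fun i => Num.max (- a i) 0 + Num.max (b i) 0)).
- rewrite (rsumE_maxr sa) (rsumE_maxr sb).
  have -> := @fine_esumD (fun i => Num.max (a i) 0) _ (fun=> max0 _)
    (fun=> max0 _) pa nb.
  have -> := @fine_esumD (fun i => Num.max (- a i) 0) _ (fun=> max0 _)
    (fun=> max0 _) na pb.
  by ring.
- by move=> i; rewrite addr_ge0.
- by move=> i; rewrite addr_ge0.
- exact: rsummableD.
- exact: rsummableD.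
- by move=> i; rewrite {1}[a i]maxr_sub {1}[b i]maxr_sub; ring.
Qed.

Lemma rsum_norm_le a b : (forall i, `|a i| <= b i) ->
  (\esum_(i in [set: I]) (b i)%:E < +oo)%E ->
  `|rsum a| <= fine (\esum_(i in [set: I]) (b i)%:E).
Proof.
move=> ab sb; have b0 i : 0 <= b i by exact: le_trans (ab i).
have sa : rsummable a by apply: le_nnesum_lty sb => i; rewrite normr_ge0 ab.
have [pa na] := rsummable_maxr sa.
rewrite (rsumE_maxr sa); apply: (le_trans (ler_normB _ _)).
rewrite !ger0_norm ?fine_ge0//; first last.
- by apply: esum_ge0 => i _; rewrite lee_fin.
- by apply: esum_ge0 => i _; rewrite lee_fin.
rewrite -fine_esumD//; apply: fine_le.
- apply: rsummable_fin_num; first by move=> i; rewrite addr_ge0.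
  exact: rsummableD.
- apply: rsummable_fin_num => //.
  by apply: le_nnesum_lty sb => i; rewrite ger0_norm// b0/=.
apply: le_esum => i _; rewrite lee_fin; apply: le_trans (ab i).
case: (leP 0 (a i)) => h.
  by rewrite max_r ?oppr_le0// addr0 ger0_norm.
by rewrite max_l ?oppr_ge0 ?(ltW h)// add0r ltr0_norm.
Qed.

Lemma rsum1 a i0 : (forall i, i != i0 -> a i = 0) -> rsum a = a i0.
Proof.
move=> a0.
have s1 (b : I -> R) : (forall i, 0 <= b i) -> (forall i, i != i0 -> b i = 0) ->
    (\esum_(i in [set: I]) (b i)%:E = (b i0)%:E)%E.
  move=> b0 bi0; rewrite (esumID [set i0]); last by move=> i _; rewrite lee_fin.
  rewrite setTI esum_set1 ?lee_fin// esum1 ?adde0// => i [_ /= /eqP ii0].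
  by rewrite bi0.
have sa : rsummable a.
  rewrite /rsummable s1 ?ltry// => i /a0 ->; exact: normr0.
rewrite (rsumE_maxr sa) !s1/= -?maxr_sub// => i /a0 ->.
- by rewrite oppr0 maxxx.
- by rewrite maxxx.
Qed.

Lemma esumZl (k : R) (a : I -> R) : 0 <= k -> (forall i, 0 <= a i) ->
  (\esum_(i in [set: I]) (k * a i)%:E = k%:E * \esum_(i in [set: I]) (a i)%:E)%E.
Proof.
move=> k0 a0; rewrite !esum_nneseries; last 2 first.
- by move=> i; rewrite lee_fin.
- by move=> i; rewrite lee_fin mulr_ge0.
rewrite -nneseriesZl; last by move=> n _; case: pickle_inv => //= i; rewrite lee_fin.
by apply: eq_eseriesr => n _; case: pickle_inv => /= [i|]; rewrite ?mule0 ?EFinM.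
Qed.

Lemma rsumZ (k : R) a : rsummable a -> rsum (fun i => k * a i) = k * rsum a.
Proof.
move=> sa; have [pa na] := rsummable_maxr sa.
(* A negative factor exchanges the two parts; it is reduced to a positive one by writing k a as 0 -
   (- k) a. *)
wlog k0 : k / 0 <= k.
  move=> H; have [k0|k0] := leP 0 k; first exact: H.
  have := H (- k); rewrite oppr_ge0 => /(_ (ltW k0)) e.
  have s0 : rsummable (fun i : I => 0 : R).
    by rewrite /rsummable esum1 ?ltry// => i _; rewrite normr0.
  have sk : rsummable (fun i => - k * a i).
    rewrite /rsummable (eq_esum (b := fun i => (- k * `|a i|)%:E)); last first.
      by move=> i _; rewrite normrM ger0_norm// oppr_ge0 ltW.
    rewrite esumZl ?oppr_ge0 ?ltW// lte_mul_pinfty// ?lee_fin ?oppr_ge0 ?ltW//.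
  have i0 : rsum (fun i : I => 0 : R) = 0.
    rewrite -[RHS](subrr (rsum (fun i : I => 0 : R))) rsumB//.
    by congr rsum; apply/funext => i; rewrite subr0.
  have := rsumB s0 sk; rewrite i0 e sub0r mulNr opprK => ->.
  by congr rsum; apply/funext => i; rewrite sub0r mulNr opprK.
have sZ (b : I -> R) : (forall i, 0 <= b i) -> rsummable b ->
    rsummable (fun i => k * b i) /\
    fine (\esum_(i in [set: I]) (k * b i)%:E) =
    k * fine (\esum_(i in [set: I]) (b i)%:E).
  move=> b0 sb; split; last by rewrite esumZl// fineM ?rsummable_fin_num.
  rewrite /rsummable (eq_esum (b := fun i => (k * `|b i|)%:E)); last first.
    by move=> i _; rewrite normrM ger0_norm.
  by rewrite esumZl// lte_mul_pinfty// ?lee_fin.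
have [p1 p2] := sZ _ (fun i => max0 (a i)) pa.
have [n1 n2] := sZ _ (fun i => max0 (- a i)) na.
rewrite (rsumE_maxr sa) mulrBr -p2 -n2.
apply: rsumE_sub => // i; rewrite ?mulr_ge0//.
by rewrite -mulrBr -maxr_sub.
Qed.

End countable_sums.

(** * Exchange of countable sums and integrals *)

Section integral_countable_sum.
Context {R : realType} {I : countType} {disp : measure_display}
  {T : measurableType disp} (m : {measure set T -> \bar R}).
Variables (D : set T) (mD : measurable D).

Lemma integral_esum (f : I -> T -> \bar R) :
  (forall i, measurable_fun D (f i)) -> (forall i x, D x -> 0 <= f i x)%E ->
  (\int[m]_(x in D) (\esum_(i in [set: I]) f i x) =
   \esum_(i in [set: I]) \int[m]_(x in D) f i x)%E.
Proof.
move=> mf f0.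
rewrite esum_nneseries; last by move=> i; apply: integral_ge0 => x; exact: f0.
transitivity (\int[m]_(x in D)
    \sum_(n <oo) oapp (fun i => f i x) 0 (@pickle_inv I n))%E.
  by apply: eq_integral => x /[!inE] Dx; rewrite esum_nneseries// => i; exact: f0.
rewrite integral_nneseries//.
- apply: eq_eseriesr => n _; case: pickle_inv => //=; exact: integral0.
- by move=> n; case: pickle_inv.
- by move=> n x Dx; case: pickle_inv => //= i; exact: f0.
Qed.

Lemma measurable_esum (f : I -> T -> \bar R) :
  (forall i, measurable_fun D (f i)) -> (forall i x, D x -> 0 <= f i x)%E ->
  measurable_fun D (fun x => \esum_(i in [set: I]) f i x)%E.
Proof.
move=> mf f0; apply: (@eq_measurable_fun _ _ _ _ _
  (fun x => \sum_(n <oo) oapp (fun i => f i x) 0 (@pickle_inv I n))%E).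
  by move=> x /[!inE] Dx; rewrite esum_nneseries// => i; exact: f0.
apply: ge0_emeasurable_sum.
- by move=> n x Dx _; case: pickle_inv => //= i; exact: f0.
- by move=> n _; case: pickle_inv.
Qed.

Lemma measurable_rsum (f : I -> T -> R) :
  (forall i, measurable_fun D (f i)) ->
  measurable_fun D (fun x => rsum (fun i => f i x)).
Proof.
move=> mf; apply: measurable_funB; apply: measurableT_comp => //.
- apply: (@measurable_esum (fun i x => (EFin \o f ^~ x)^\+ i)%E) => [i|i x _].
    rewrite (_ : (fun x => _) = (EFin \o f i)^\+%E).
      by apply: measurable_funepos; exact/measurable_EFinP.
    by apply/funext => x; rewrite !funeposE.
  by rewrite funeposE le_max lexx orbT.
- apply: (@measurable_esum (fun i x => (EFin \o f ^~ x)^\- i)%E) => [i|i x _].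
    rewrite (_ : (fun x => _) = (EFin \o f i)^\-%E).
      by apply: measurable_funeneg; exact/measurable_EFinP.
    by apply/funext => x; rewrite !funenegE.
  by rewrite funenegE le_max lexx orbT.
Qed.

(** Fubini for a signed sum: Tonelli is applied to the positive and to the negative parts of the
    summands, and absolute convergence keeps both results finite. *)
Lemma Rintegral_rsum (f : I -> T -> R) :
  (forall i, measurable_fun D (f i)) ->
  (\esum_(i in [set: I]) \int[m]_(x in D) `|f i x|%:E < +oo)%E ->
  \int[m]_(x in D) rsum (fun i => f i x) = rsum (fun i => \int[m]_(x in D) f i x).
Proof.
move=> mf sf.
have mp i : measurable_fun D (fun x => Num.max (f i x) 0).
  by apply: measurable_maxr => //; exact: measurable_cst.
have mn i : measurable_fun D (fun x => Num.max (- f i x) 0).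
  apply: measurable_maxr; last exact: measurable_cst.
  exact: measurableT_comp.
(* [g] will be the positive or the negative part of [f]. *)
have bnd (g : I -> T -> R) : (forall i, measurable_fun D (g i)) ->
    (forall i x, 0 <= g i x <= `|f i x|) ->
  (forall i, m.-integrable D (EFin \o g i)) /\
  (let G := (fun x => \esum_(i in [set: I]) (g i x)%:E)%E in
   [/\ m.-integrable D G, m.-integrable D (EFin \o (fine \o G)),
      rsummable (fun i => \int[m]_(x in D) g i x) &
      \int[m]_(x in D) fine (G x) =
      fine (\esum_(i in [set: I]) (\int[m]_(x in D) g i x)%:E)]).
  move=> mg g01.
  have mg' i : measurable_fun D (EFin \o g i) by exact/measurable_EFinP.
  have g0 i x : (0 <= (g i x)%:E)%E.
    by rewrite lee_fin; case/andP: (g01 i x).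
  have le_gf i : (\int[m]_(x in D) (g i x)%:E <= \int[m]_(x in D) `|f i x|%:E)%E.
    apply: ge0_le_integral => //.
    - exact: mg'.
    - by apply/measurable_EFinP; exact: measurableT_comp.
    - by move=> x _; rewrite lee_fin; case/andP: (g01 i x).
  have sg : (\esum_(i in [set: I]) \int[m]_(x in D) (g i x)%:E < +oo)%E.
    by apply: le_lt_trans sf; apply: le_esum => i _.
  have ig i : m.-integrable D (EFin \o g i).
    apply/integrableP; split => //.
    under eq_integral => x _ do rewrite gee0_abs//=.
    apply: le_lt_trans sg; rewrite (esumID [set i])//; last first.
      by move=> *; exact: integral_ge0.
    rewrite setTI esum_set1 ?integral_ge0// leeDl// esum_ge0// => *.
    exact: integral_ge0.
  have EF i : (\int[m]_(x in D) g i x)%:E = (\int[m]_(x in D) (g i x)%:E)%E.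
    by rewrite /Rintegral fineK//; exact: (integrable_fin_num mD (ig i)).
  split=> // G.
  have mG : measurable_fun D G by exact: measurable_esum.
  have G0 x : (0 <= G x)%E by apply: esum_ge0.
  have GE : (\int[m]_(x in D) G x =
      \esum_(i in [set: I]) (\int[m]_(x in D) g i x)%:E)%E.
    by rewrite integral_esum//; apply: eq_esum => i _; rewrite EF.
  have iG : m.-integrable D G.
    apply/integrableP; split => //; under eq_integral do rewrite gee0_abs//.
    by rewrite GE; apply: le_lt_trans sg; apply: le_esum => i _; rewrite EF.
  have mfG : measurable_fun D (EFin \o (fine \o G)).
    by apply/measurable_EFinP; exact: measurableT_comp.
  (* [G] may be infinite on a null set, where [fine] turns it into 0. *)
  have aeG : ae_eq m D (EFin \o (fine \o G)) G.
    apply: filterS (integrable_ae mD iG) => x h Dx /=.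
    by rewrite fineK// h.
  split => //.
  - apply/integrableP; split=> //.
    rewrite (ae_eq_integral (abse \o G))//; first by case/integrableP: iG.
    + exact: measurableT_comp.
    + exact: measurableT_comp.
    + by apply: filterS aeG => x h Dx /=; rewrite -h.
  - apply: le_lt_trans sg; apply: le_esum => i _.
    by rewrite ger0_norm ?EF// Rintegral_ge0// => x _; rewrite -lee_fin.
  - by rewrite -GE; congr fine; exact: ae_eq_integral.
have m01 (y : R) : 0 <= Num.max y 0 <= `|y|.
  by rewrite le_max lexx orbT/= ge_max ler_norm normr_ge0.
have [ip [iP iP' sP eP]] := bnd _ mp (fun i x => m01 (f i x)).
have [] := bnd _ mn; first by move=> i x; rewrite -normrN.
move=> in_ [iN iN' sN eN].
rewrite (@rsumE_sub _ _ (fun i => \int[m]_(x in D) f i x)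
   (fun i => \int[m]_(x in D) Num.max (f i x) 0)
   (fun i => \int[m]_(x in D) Num.max (- f i x) 0))//.
- rewrite -eP -eN -RintegralB//; apply: eq_Rintegral => x _.
  rewrite /rsum; congr (fine _ - fine _); apply: eq_esum => i _.
    by rewrite funeposE /= EFin_max.
  by rewrite funenegE /= EFin_max.
- by move=> i; apply: Rintegral_ge0 => x _; case/andP: (m01 (f i x)).
- by move=> i; apply: Rintegral_ge0 => x _; case/andP: (m01 (- f i x)).
- move=> i; rewrite -RintegralB//; apply: eq_Rintegral => x _.
  exact: maxr_sub.
Qed.

End integral_countable_sum.

(** * The exponential kernel and its integrals *)

Section exponential_kernel.
Context {R : realType}.
Notation mu := (@lebesgue_measure R).
Implicit Types lam t a th s : R.

(** Duhamel's kernel of the mild equation. For s <= t it is also the density at s of the time left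
    when an exponential clock of rate [lam] rings, and this coincidence links the tree to the
    equation. *)
Definition ekernel lam t s : R := lam * expR (- lam * (t - s)).

Lemma ekernel_ge0 lam t s : 0 < lam -> 0 <= ekernel lam t s.
Proof. by move=> l0; rewrite mulr_ge0 ?expR_ge0// ltW. Qed.

Lemma measurable_ekernel lam t (D : set R) : measurable_fun D (ekernel lam t).
Proof.
apply: measurable_funTS; apply: measurable_funM => //.
apply: measurableT_comp => //; apply: measurable_funM => //.
exact: measurable_funB.
Qed.

Lemma is_derive_expR_affine (k c m s : R) :
  is_derive s 1 (fun s : R => k * expR (c * s + m)) (k * (expR (c * s + m) * c)).
Proof.
have h1 : is_derive s 1 (fun s : R => c * s + m) c.
  have h2 : is_derive s 1 (fun s : R => c * s) c.
    have h3 := @is_deriveZ _ _ _ (fun s : R => s) c s 1 1 (is_derive_id s 1).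
    by apply: is_derive_eq h3 _; rewrite /GRing.scale/= mulr1.
  by apply: is_derive_eq (is_deriveD h2 (is_derive_cst m s 1)) _; rewrite addr0.
have h5 := @is_derive1_comp R expR (fun s => c * s + m) s _ _
  (is_derive_expR (c * s + m)) h1.
exact: (@is_deriveZ _ _ _ _ k s 1 _ h5).
Qed.

Lemma continuous_expR_affine (k c m : R) :
  continuous (fun s : R => k * expR (c * s + m)).
Proof.
move=> s; apply: differentiable_continuous; apply/derivable1_diffP.
by have [] := is_derive_expR_affine k c m s.
Qed.

Lemma integral_expR_affine (k c m a b : R) : c != 0 -> a <= b ->
  (\int[mu]_(s in `[a, b]) (k * expR (c * s + m))%:E =
   (k / c * (expR (c * b + m) - expR (c * a + m)))%:E)%E.
Proof.
move=> c0; rewrite le_eqVlt => /predU1P[->|ab].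
  by rewrite set_itv1 integral_set1 subrr mulr0.
rewrite (@continuous_FTC2 _ _ (fun s => k / c * expR (c * s + m)))//.
- by rewrite -EFinB mulrBr.
- apply: continuous_subspaceT => s; exact: continuous_expR_affine.
- split.
  + by move=> s _; have [] := is_derive_expR_affine (k / c) c m s.
  + by apply: cvg_at_right_filter; exact: continuous_expR_affine.
  + by apply: cvg_at_left_filter; exact: continuous_expR_affine.
- move=> s _; rewrite derive1E.
  have := is_derive_expR_affine (k / c) c m s => h; rewrite derive_val.
  by field.
Qed.

(** The factor [lam / (lam + th)] is the gain from the exponential weight: it is at most 1 and, for
    fixed [lam], tends to 0 as [th] grows. *)
Lemma integral_ekernel_expR lam t a th : 0 < lam -> 0 <= th -> a <= t ->
  (\int[mu]_(s in `[a, t]) (ekernel lam t s * expR (th * s))%:E =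
   (lam / (lam + th) * (expR (th * t) - expR (- lam * (t - a) + th * a)))%:E)%E.
Proof.
move=> l0 th0 at_.
have lth : lam + th != 0 by rewrite gt_eqF// ltr_wpDr.
under eq_integral => s _.
  rewrite /ekernel -mulrA -expRD.
  rewrite (_ : - lam * (t - s) + th * s = (lam + th) * s + - (lam * t)); last by ring.
  over.
rewrite integral_expR_affine//; congr ((_ * (expR _ - expR _))%:E); ring.
Qed.

Lemma integral_ekernel lam t a : 0 < lam -> a <= t ->
  (\int[mu]_(s in `[a, t]) (ekernel lam t s)%:E =
   (1 - expR (- lam * (t - a)))%:E)%E.
Proof.
move=> l0 at_; have := integral_ekernel_expR l0 (lexx 0) at_.
under eq_integral => s _ do rewrite mul0r expR0 mulr1.
by move=> ->; rewrite !mul0r expR0 !addr0 divff ?gt_eqF// mul1r.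
Qed.

End exponential_kernel.

(** * Bounds and measurability for the nonlinearity *)

Section system_facts.
Context {R : realType} {d r : nat} (S : system R d r).

Lemma qsum_ge0 k : (0 <= qsum (qr S) k)%E.
Proof. by apply: esum_ge0 => i _; rewrite lee_fin; case/andP: (qr_01 S k i.1 i.2). Qed.

Lemma qsumE k : qsum (qr S) k = (qtot S k)%:E.
Proof.
rewrite /qtot fineK// ge0_fin_numE ?qsum_ge0//.
have := total_mass S k; have := qsum_ge0 k; case: (qsum _ _) => //=.
by move=> x _ _; rewrite ltry.
Qed.

Lemma qtot_ge0 k : 0 <= qtot S k.
Proof. exact/fine_ge0/qsum_ge0. Qed.

Lemma total_massE k : pr S k + qtot S k + dr S k = 1.
Proof. by have := total_mass S k; rewrite qsumE -!EFinD => -[]. Qed.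

Lemma pr_ge0 k : 0 <= pr S k. Proof. by case/andP: (pr_01 S k). Qed.
Lemma qr_ge0 k l m : 0 <= qr S k l m. Proof. by case/andP: (qr_01 S k l m). Qed.
Lemma dr_ge0 k : 0 <= dr S k. Proof. by case/andP: (dr_01 S k). Qed.

Lemma qr_eq0 k l m : qtot S k = 0 -> qr S k l m = 0.
Proof.
move=> q0; have : (qsum (qr S) k <= 0)%E by rewrite qsumE q0.
move=> h; apply/eqP; rewrite eq_le qr_ge0 andbT -lee_fin; apply: le_trans h.
rewrite /qsum (esumID [set (l, m)]); last by move=> *; rewrite lee_fin qr_ge0.
rewrite setTI esum_set1 ?lee_fin ?qr_ge0//= leeDl// esum_ge0// => *.
by rewrite lee_fin qr_ge0.
Qed.

Lemma esum_qrZ k (M : R) : 0 <= M ->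
  (\esum_(lm in [set: Zd d * Zd d]) (M * qr S k lm.1 lm.2)%:E = (M * qtot S k)%:E)%E.
Proof. by move=> M0; rewrite esumZl// ?EFinM -?qsumE// => i; exact: qr_ge0. Qed.

(** Sums over offspring pairs are dominated by a constant times the branching mass q_k. *)
Lemma qr_rsum_bound k (M : R) (a : Zd d * Zd d -> R) : 0 <= M ->
  (forall lm, `|a lm| <= M * qr S k lm.1 lm.2) ->
  rsummable a /\ `|rsum a| <= M * qtot S k.
Proof.
move=> M0 h; split.
  apply: (@le_lt_trans _ _ (M * qtot S k)%:E); last exact: ltry.
  by rewrite -esum_qrZ//; apply: le_esum => i _; rewrite lee_fin.
rewrite -[leRHS]/(fine (M * qtot S k)%:E) -esum_qrZ//; apply: rsum_norm_le => //.
by rewrite esum_qrZ// ltry.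
Qed.

Definition bsummand (chi : Zd d -> R -> Cr R r) c k s (lm : Zd d * Zd d) : R :=
  qr S k lm.1 lm.2 * rcoord c (B S k lm.1 lm.2 (chi lm.1 s) (chi lm.2 s)).

Lemma rcoord_nonlinearity c gamma chi k s :
  rcoord c (nonlinearity S gamma chi k s) =
  Cf S * pr S k * rcoord c (chi k s) + Cb S * rsum (bsummand chi c k s) +
  dr S k * rcoord c (gamma k s).
Proof.
rewrite /nonlinearity 2!rcoordD !rcoordZ rcoord_vsum.
congr (_ + _ + _); congr (_ * rsum _); apply/funext => lm.
by rewrite rcoordZ.
Qed.

Lemma bsummand_bound chi c k s M : (forall l, enorm (chi l s) <= M) ->
  rsummable (bsummand chi c k s) /\
  `|rsum (bsummand chi c k s)| <= M ^+ 2 * qtot S k.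
Proof.
move=> h; apply: qr_rsum_bound; first exact: sqr_ge0.
move=> [l m] /=; rewrite normrM ger0_norm ?qr_ge0// mulrC ler_wpM2r ?qr_ge0//.
apply: (le_trans (rcoord_le_enorm _ _)); apply: (le_trans (B_le _ _ _ _ _ _)).
by rewrite expr2 ler_pM ?enorm_ge0.
Qed.

(** Each of p_k, q_k, d_k is at most 1, so the bound is uniform over the sites. *)
Lemma nonlinearity_bound gamma chi c k s M : 
  (forall l, enorm (chi l s) <= M) -> enorm (gamma k s) <= M ->
  `|rcoord c (nonlinearity S gamma chi k s)| <= Cf S * M + Cb S * M ^+ 2 + M.
Proof.
move=> hchi hgamma.
have M0 : 0 <= M by exact: le_trans (enorm_ge0 _) hgamma.
have p0 := pr_ge0 k; have q0 := qtot_ge0 k; have d0 := dr_ge0 k.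
have tot := total_massE k.
rewrite rcoord_nonlinearity.
apply: (le_trans (ler_normD _ _)); apply: lerD.
  apply: (le_trans (ler_normD _ _)); apply: lerD; rewrite normrM.
    rewrite ger0_norm ?mulr_ge0 ?Cf_ge0// -mulrA ler_wpM2l ?Cf_ge0//.
    rewrite -[leRHS]mul1r ler_pM//; first by lra.
    exact: le_trans (rcoord_le_enorm _ _) (hchi k).
  rewrite ger0_norm ?Cb_ge0// ler_wpM2l ?Cb_ge0//.
  have [_ h] := bsummand_bound c k hchi; apply: (le_trans h).
  by rewrite -[leRHS]mulr1 ler_wpM2l ?sqr_ge0//; lra.
rewrite normrM ger0_norm// -[leRHS]mul1r ler_pM//; first by lra.
exact: le_trans (rcoord_le_enorm _ _) hgamma.
Qed.

Lemma measurable_rcoord_Linfty (T : R) (f : Zd d -> R -> Cr R r) c k : Linfty T f ->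
  measurable_fun `[0, T] (fun t => rcoord c (f k t)).
Proof. case=> h _; case: (h k c.1) => h1 h2; by rewrite /rcoord; case: (c.2). Qed.

Lemma measurable_bilinear (disp : measure_display) (X : measurableType disp)
    (D : set X) (B : {bilinear 'rV[R[i]]_r -> 'rV[R[i]]_r -> 'rV[R[i]]_r}) c
    (f g : X -> Cr R r) :
  (forall c, measurable_fun D (fun x => rcoord c (f x))) ->
  (forall c, measurable_fun D (fun x => rcoord c (g x))) ->
  measurable_fun D (fun x => rcoord c (B (f x) (g x))).
Proof.
move=> mf mg; under eq_fun do rewrite rcoord_bilinear.
apply: measurable_sum => c1; apply: measurable_sum => c2.
by apply: measurable_funM => //; apply: measurable_funM.
Qed.

Lemma measurable_nonlinearity (D : set R) gamma chi c k :
  (forall c k, measurable_fun D (fun s => rcoord c (chi k s))) ->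
  (forall c k, measurable_fun D (fun s => rcoord c (gamma k s))) ->
  measurable_fun D (fun s => rcoord c (nonlinearity S gamma chi k s)).
Proof.
move=> mchi mgamma; under eq_fun do rewrite rcoord_nonlinearity.
apply: measurable_funD; last by apply: measurable_funM.
apply: measurable_funD; first by apply: measurable_funM.
apply: measurable_funM => //.
apply: (@measurable_rsum _ (Zd d * Zd d)%type _ _ _
  (fun lm s => bsummand chi c k s lm)) => lm.
by apply: measurable_funM => //; exact: measurable_bilinear.
Qed.

End system_facts.

(** Often applied with the same premise given twice, where it is plain monotonicity of almost
    everywhere statements. *)
Lemma ae_imp2 (disp : measure_display) (X : ringOfSetsType disp) (R : realFieldType)
    (m : {measure set X -> \bar R}) (P Q W : X -> Prop) :
  (forall x, P x -> Q x -> W x) ->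
  {ae m, forall x, P x} -> {ae m, forall x, Q x} -> {ae m, forall x, W x}.
Proof. exact: (@filterS2 _ _ (ae_filter_ringOfSetsType m)). Qed.

Section kernel_estimate.
Context {R : realType}.
Notation mu := (@lebesgue_measure R).

Lemma ekernel_estimate (lam t D th : R) (h : R -> R) :
  0 < lam -> 0 <= th -> 0 <= t -> 0 <= D -> measurable_fun `[0, t] h ->
  {ae mu, forall s : R, s \in `[0, t] -> `|h s| <= D * expR (th * s)} ->
  mu.-integrable `[0, t] (EFin \o (fun s => ekernel lam t s * h s)) /\
  `|\int[mu]_(s in `[0, t]) (ekernel lam t s * h s)| <=
     lam / (lam + th) * D * expR (th * t).
Proof.
move=> l0 th0 t0 D0 mh bh.
have mk := @measurable_ekernel R lam t `[0, t]%classic.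
have mF : measurable_fun `[0, t] (EFin \o (fun s => ekernel lam t s * h s)).
  by apply/measurable_EFinP; exact: measurable_funM.
have mE : measurable_fun `[0, t] (fun s => ekernel lam t s * expR (th * s)).
  apply: measurable_funM => //; apply: measurable_funTS.
  by apply: measurableT_comp => //; exact: measurable_funM.
have g0 s : 0 <= ekernel lam t s * expR (th * s).
  by apply: mulr_ge0; [exact: ekernel_ge0|exact: expR_ge0].
have bnd : (\int[mu]_(s in `[0%R, t]) `|(ekernel lam t s * h s)%:E| <=
            (lam / (lam + th) * D * expR (th * t))%:E)%E.
  apply: (@le_trans _ _ (\int[mu]_(s in `[0%R, t])
      (D%:E * (ekernel lam t s * expR (th * s))%:E))%E).
    apply: ae_ge0_le_integral => //.
    - exact: measurableT_comp.
    - by move=> s _; rewrite -EFinM lee_fin; exact: mulr_ge0.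
    - by apply: measurable_funeM; exact/measurable_EFinP.
    - apply: (ae_imp2 _ bh bh) => s hs _ /= /hs h'; rewrite lee_fin normrM.
      by rewrite ger0_norm ?ekernel_ge0// mulrCA ler_wpM2l ?ekernel_ge0.
  rewrite ge0_integralZl//; last 2 first.
  - exact/measurable_EFinP.
  - by move=> s _; rewrite lee_fin.
  rewrite integral_ekernel_expR// -EFinM lee_fin mulrCA -mulrA ler_wpM2l//.
    by rewrite divr_ge0 ?addr_ge0// ltW.
  (* The boundary term at time 0 enters with a negative sign and is dropped. *)
  by rewrite ler_wpM2l// lerBlDr lerDl expR_ge0.
have iF : mu.-integrable `[0, t] (EFin \o (fun s => ekernel lam t s * h s)).
  by apply/integrableP; split => //; apply: le_lt_trans bnd (ltry _).
split => //; rewrite -lee_fin EFin_normr_Rintegral//.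
exact: le_trans (le_abse_integral _ _ _) bnd.
Qed.

Lemma ekernel_bounded (lam t D : R) (h : R -> R) :
  0 < lam -> 0 <= t -> 0 <= D -> measurable_fun `[0, t] h ->
  {ae mu, forall s : R, s \in `[0, t] -> `|h s| <= D} ->
  mu.-integrable `[0, t] (EFin \o (fun s => ekernel lam t s * h s)) /\
  `|\int[mu]_(s in `[0, t]) (ekernel lam t s * h s)| <= D.
Proof.
move=> l0 t0 D0 mh hD.
have [|] := ekernel_estimate l0 (lexx 0) t0 D0 mh.
  by apply: (ae_imp2 _ hD hD) => s h1 _ /h1; rewrite mul0r expR0 mulr1.
by rewrite mul0r expR0 mulr1 addr0 divff ?mul1r// gt_eqF.
Qed.

End kernel_estimate.

(** * Finiteness of lattice balls and the choice of the weight *)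

Section lattice.
Context {R : realType} {d : nat}.

Lemma finite_lattice_ball (M : R) : finite_set [set k : Zd d | lattice_norm R k < M].
Proof.
pose N := Num.Def.truncn M.
(* The coordinates of a point of the ball lie in [-N, N]; adding N codes them by ordinals. *)
pose F (f : {ffun 'I_d -> 'I_(N + N).+1}) : Zd d :=
  \row_i ((f i)%:Z - N%:Z).
apply: (@sub_finite_set _ _ (F @` [set: {ffun 'I_d -> 'I_(N + N).+1}])); last first.
  exact/finite_image/finite_finset.
move=> k /= kM.
have kN i : (absz (k 0%R i) <= N)%N.
  have M0 : 0 <= M by apply: le_trans (ltW kM); exact: sqrtr_ge0.
  rewrite truncn_ge_nat// natr_absz intr_norm; apply: le_trans (ltW kM).
  rewrite -sqrtr_sqr ler_sqrt; last by apply: sumr_ge0 => *; exact: sqr_ge0.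
  by rewrite (bigD1 i)//= lerDl sumr_ge0// => *; exact: sqr_ge0.
exists [ffun i => inord (absz (k 0%R i + N%:Z)%R)] => //.
apply/rowP => i; rewrite mxE ffunE inordK; have := kN i; lia.
Qed.

(* The weight [expR (th * t)] turns the kernel into [lam / (lam + th)]: large
   sites are damped by [L -> 0], the finitely many others by a large [th]. *)
Lemma exists_damping (L lam : Zd d -> R) : (forall k, 0 <= L k) ->
  (forall k, 0 < lam k) -> tends_to_0 L ->
  exists2 th : R, 0 <= th & forall k, L k * (lam k / (lam k + th)) <= 2^-1.
Proof.
move=> L0 lam0 Lcvg; have [M hM] := Lcvg 2^-1 ltac:(by rewrite invr_gt0).
have /finite_seqP[s0 sE] := finite_lattice_ball M.
pose s := undup s0.
have term0 k : 0 <= 2 * L k * lam k by rewrite !mulr_ge0// ltW.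
(* For a site of the ball the sum contains its own term [2 * L k * lam k], which yields the factor
   1/2. Outside the ball [L k] is below 1/2 and the quotient is at most 1. *)
exists (\sum_(k <- s) 2 * L k * lam k); first exact: sumr_ge0.
move=> k; have lth : 0 < lam k + \sum_(k <- s) 2 * L k * lam k.
  by rewrite ltr_pwDl// sumr_ge0.
rewrite mulrA ler_pdivrMr// mulrDr.
have [kM|Mk] := ltP (lattice_norm R k) M.
  have ks : k \in s by rewrite mem_undup; have : [set` s0] k by rewrite -sE.
  rewrite (bigD1_seq k) ?undup_uniq//= mulrDr !mulrA mulVf// mul1r.
  have := lam0 k; have : 0 <= \sum_(j <- s | j != k) 2 * L j * lam j by exact: sumr_ge0.
  lra.
have := hM k Mk; rewrite ger0_norm// => /ltW h.
rewrite -[leLHS]addr0 lerD// ?ler_wpM2r ?mulr_ge0 ?sumr_ge0// ltW//.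
Qed.

End lattice.

(** * Uniqueness of bounded mild solutions *)

Section uniqueness.
Context {R : realType} {d r : nat} (S : system R d r).
Variables (T : R) (chi0 : Zd d -> Cr R r) (gamma : Zd d -> R -> Cr R r).
Hypotheses (T_gt0 : 0 < T) (chi0_bounded : linfty chi0)
  (gamma_Linfty : Linfty T gamma).
Notation mu := (@lebesgue_measure R).

Lemma mild_solution_rcoord chi k t c : mild_solution S T chi0 gamma chi ->
  t \in `[0, T] ->
  rcoord c (chi k t) = expR (- lam S k * t) * rcoord c (chi0 k) +
   \int[mu]_(s in `[0, t]) (ekernel (lam S k) t s *
     rcoord c (nonlinearity S gamma chi k s)).
Proof.
move=> [_ h] /h ->; rewrite rcoordD rcoordZ rcoord_vint; congr (_ + _).
by apply: eq_Rintegral => s _; rewrite rcoordZ.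
Qed.

Lemma measurable_nonlinearity_Linfty chi c k t : Linfty T chi -> t <= T ->
  measurable_fun `[0, t] (fun s => rcoord c (nonlinearity S gamma chi k s)).
Proof.
move=> mchi tT; apply: (@measurable_funS _ _ _ _ `[0, T]) => //.
  exact: subset_itvl.
by apply: measurable_nonlinearity => *; exact: measurable_rcoord_Linfty.
Qed.

(** Membership in L^oo bounds a solution at almost every time. The right-hand side of the mild
    equation is bounded at every time, which upgrades this to all times. *)
Lemma mild_solution_bounded chi : mild_solution S T chi0 gamma chi ->
  exists M, 0 <= M /\ forall k t, t \in `[0, T] -> enorm (chi k t) <= M.
Proof.
move=> sol; have [Lchi _] := sol.
have [_ [M1 hM1]] := Lchi; have [_ [M2 hM2]] := gamma_Linfty.
have [M0 hM0] := chi0_bounded.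
pose M := Num.max 0 (Num.max M1 M2).
have [M_ge0 M1M M2M] : [/\ 0 <= M, M1 <= M & M2 <= M].
  by rewrite /M !le_max !lexx !orbT.
pose A := Cf S * M + Cb S * M ^+ 2 + M.
have A0 : 0 <= A by rewrite !addr_ge0 ?mulr_ge0 ?Cf_ge0 ?Cb_ge0 ?sqr_ge0.
have M00 : 0 <= M0 by exact: le_trans (enorm_ge0 _) (hM0 0).
exists (\sum_(c : 'I_r * bool) (M0 + A)); split.
  by apply: sumr_ge0 => *; exact: addr_ge0.
move=> k t tT; apply: (le_trans (enorm_le_sum _)); apply: ler_sum => c _.
have [t0 tT'] : 0 <= t /\ t <= T by move: tT; rewrite in_itv/= => /andP[].
rewrite (mild_solution_rcoord k c sol tT).
apply: (le_trans (ler_normD _ _)); apply: lerD.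
  rewrite normrM -[leRHS]mul1r ler_pM//; last exact: le_trans (rcoord_le_enorm _ _) (hM0 _).
  by rewrite ger0_norm ?expR_ge0// -expR0 ler_expR mulNr oppr_le0 mulr_ge0// ltW// lam_gt0.
have [|_ h] := @ekernel_estimate R (lam S k) t A 0
  (fun s => rcoord c (nonlinearity S gamma chi k s)) (lam_gt0 S k) (lexx _) t0 A0
  (measurable_nonlinearity_Linfty _ _ Lchi tT').
  apply: ae_imp2 hM1 hM2 => s h1 h2 st.
  have sT : s \in `[0, T] by move: st; rewrite !in_itv/= => /andP[-> /= /le_trans ->].
  rewrite mul0r expR0 mulr1; apply: nonlinearity_bound.
    by move=> l; exact: le_trans (h1 sT l) M1M.
  exact: le_trans (h2 sT k) M2M.
apply: (le_trans h); rewrite mul0r expR0 addr0 mulr1 divff ?mul1r//.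
by rewrite gt_eqF// lam_gt0.
Qed.

(** The identity B(x, y) - B(x', y') = B(x - x', y) + B(x', y - y') accounts for [2 * M]. The number
    of real coordinates enters when a bound on each coordinate becomes one on the Euclidean norm.
    Keeping p_k and q_k in the constant makes it vanish at infinity. *)
Lemma nonlinearity_lipschitz chi chi' c k s (M D : R) :
  (forall l, enorm (chi l s) <= M) -> (forall l, enorm (chi' l s) <= M) ->
  (forall l c, `|rcoord c (chi l s - chi' l s)| <= D) ->
  `|rcoord c (nonlinearity S gamma chi k s) - rcoord c (nonlinearity S gamma chi' k s)|
   <= (Cf S * pr S k + Cb S * (2 * M * #|{: 'I_r * bool}|%:R) * qtot S k) * D.
Proof.
move=> hchi hchi' hD.
have M0 : 0 <= M by exact: le_trans (enorm_ge0 _) (hchi 0).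
have D0 : 0 <= D by exact: le_trans (hD 0 c).
set n := #|{: 'I_r * bool}|%:R.
have hE l : enorm (chi l s - chi' l s) <= n * D.
  apply: (le_trans (enorm_le_sum _)); rewrite /n -sum1_card natr_sum mulr_suml.
  by apply: ler_sum => c' _; rewrite mul1r.
rewrite [X in `|X - _|]rcoord_nonlinearity [X in `|_ - X|]rcoord_nonlinearity.
set a := rsum _; set b := rsum _.
have E (x y z u v e f : R) : x * y + u * e + z - (x * v + u * f + z) =
   x * (y - v) + u * (e - f) by ring.
rewrite E.
apply: (le_trans (ler_normD _ _)); rewrite mulrDl; apply: lerD.
  rewrite -rcoordB normrM ger0_norm ?mulr_ge0 ?Cf_ge0 ?pr_ge0//.
  by rewrite ler_wpM2l// ?mulr_ge0 ?Cf_ge0 ?pr_ge0.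
rewrite normrM ger0_norm ?Cb_ge0// -!mulrA ler_wpM2l ?Cb_ge0//.
have [sa _] := bsummand_bound S c k hchi.
have [sb _] := bsummand_bound S c k hchi'.
rewrite /a /b rsumB//.
have -> : 2 * (M * (n * (qtot S k * D))) = (2 * M * n * D) * qtot S k by ring.
apply: (qr_rsum_bound _ _).2 => [|[l m] /=].
  by rewrite !mulr_ge0.
rewrite /bsummand/= -mulrBr normrM ger0_norm ?qr_ge0// mulrC ler_wpM2r ?qr_ge0//.
rewrite -rcoordB; set x := chi l s; set y := chi m s.
set x' := chi' l s; set y' := chi' m s.
have -> : B S k l m x y - B S k l m x' y' =
  B S k l m (x - x') y + B S k l m x' (y - y').
  by rewrite linearBl linearBr addrA subrK.
rewrite rcoordD; apply: (le_trans (ler_normD _ _)).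
have -> : 2 * M * n * D = (n * D) * M + M * (n * D) by ring.
apply: lerD; apply: (le_trans (rcoord_le_enorm _ _));
  apply: (le_trans (B_le _ _ _ _ _ _)).
  by apply: ler_pM; [exact: enorm_ge0|exact: enorm_ge0|exact: hE|exact: hchi].
by apply: ler_pM; [exact: enorm_ge0|exact: enorm_ge0|exact: hchi'|exact: hE].
Qed.

Theorem mild_solution_unique chi chi' :
  mild_solution S T chi0 gamma chi -> mild_solution S T chi0 gamma chi' ->
  forall k t, t \in `[0, T] -> chi k t = chi' k t.
Proof.
move=> sol sol'; have [Lchi _] := sol; have [Lchi' _] := sol'.
have [M1 [M10 hM1]] := mild_solution_bounded sol.
have [M2 [M20 hM2]] := mild_solution_bounded sol'.
pose M := M1 + M2.
have hM k t : t \in `[0, T] -> enorm (chi k t) <= M.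
  by move=> tT; apply: (le_trans (hM1 _ _ tT)); rewrite lerDl.
have hM' k t : t \in `[0, T] -> enorm (chi' k t) <= M.
  by move=> tT; apply: (le_trans (hM2 _ _ tT)); rewrite lerDr.
have M0 : 0 <= M by exact: addr_ge0.
pose a := Cb S * (2 * M * #|{: 'I_r * bool}|%:R).
have a0 : 0 <= a by rewrite !mulr_ge0// Cb_ge0.
pose L k := Cf S * pr S k + a * qtot S k.
have L0 k : 0 <= L k.
  by rewrite addr_ge0// mulr_ge0 ?Cf_ge0 ?pr_ge0 ?qtot_ge0.
have Lcvg : tends_to_0 L.
  (* The summand 1 keeps the denominator positive and the final inequality strict. *)
  move=> e e0; pose e' := e / (Cf S + a + 1).
  have C0 := Cf_ge0 S.
  have s0 : 0 < Cf S + a + 1 by rewrite ltr_wpDl// addr_ge0.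
  have e'0 : 0 < e' by rewrite divr_gt0.
  have [N1 h1] := pr_cvg S e'0; have [N2 h2] := qr_cvg S e'0.
  exists (Num.max N1 N2) => k; rewrite ge_max => /andP[/h1 + /h2].
  rewrite -/(qtot S k) !ger0_norm ?pr_ge0 ?qtot_ge0// => hp hq.
  apply: (@le_lt_trans _ _ (Cf S * e' + a * e')).
    by apply: lerD; rewrite ler_wpM2l// ltW.
  rewrite -mulrDl mulrCA gtr_pMr// ltr_pdivrMr// mul1r; lra.
have [th th0 hth] := exists_damping L0 (lam_gt0 S) Lcvg.
(* The contraction: by the choice of [th], the Lipschitz constant [L k] times the damping factor of
   the kernel is at most 1/2, at every site. *)
have step D : 0 <= D ->
    (forall k c t, t \in `[0, T] ->
      `|rcoord c (chi k t - chi' k t)| <= D * expR (th * t)) ->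
    (forall k c t, t \in `[0, T] ->
      `|rcoord c (chi k t - chi' k t)| <= D / 2 * expR (th * t)).
  move=> D0 hD k c t tT.
  have [t0 tT'] : 0 <= t /\ t <= T by move: tT; rewrite in_itv/= => /andP[].
  have l0 := lam_gt0 S k.
  pose g s := rcoord c (nonlinearity S gamma chi k s).
  pose g' s := rcoord c (nonlinearity S gamma chi' k s).
  have sub s : s \in `[0, t] -> s \in `[0, T].
    by rewrite !in_itv/= => /andP[-> /= /le_trans ->].
  have mg : measurable_fun `[0, t] g by exact: measurable_nonlinearity_Linfty.
  have mg' : measurable_fun `[0, t] g' by exact: measurable_nonlinearity_Linfty.
  have [_ [Mg hMg]] := gamma_Linfty.
  pose MM := Num.max M Mg.
  pose A := Cf S * MM + Cb S * MM ^+ 2 + MM.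
  have MM0 : 0 <= MM by rewrite le_max M0.
  have A0 : 0 <= A by rewrite !addr_ge0 ?mulr_ge0 ?Cf_ge0 ?Cb_ge0 ?sqr_ge0.
  have [ig _] := @ekernel_estimate R (lam S k) t A 0 g l0 (lexx _) t0 A0 mg
    ltac:(apply: (ae_imp2 _ hMg hMg) => s hs _ /sub sT;
      rewrite mul0r expR0 mulr1; apply: nonlinearity_bound;
      [by move=> l; rewrite le_max hM | by rewrite le_max hs// orbT]).
  have [ig' _] := @ekernel_estimate R (lam S k) t A 0 g' l0 (lexx _) t0 A0 mg'
    ltac:(apply: (ae_imp2 _ hMg hMg) => s hs _ /sub sT;
      rewrite mul0r expR0 mulr1; apply: nonlinearity_bound;
      [by move=> l; rewrite le_max hM' | by rewrite le_max hs// orbT]).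
  rewrite rcoordB (mild_solution_rcoord k c sol tT) (mild_solution_rcoord k c sol' tT).
  have E : \int[mu]_(s in `[0, t]) (ekernel (lam S k) t s * (g s - g' s)) =
      \int[mu]_(s in `[0, t]) (ekernel (lam S k) t s * g s) -
      \int[mu]_(s in `[0, t]) (ekernel (lam S k) t s * g' s).
    rewrite -(RintegralB _ ig ig')//; apply: eq_Rintegral => s _.
    by rewrite mulrBr.
  rewrite opprD addrACA subrr add0r.
  rewrite -[X in `|X|]E.
  have [|_ h] := @ekernel_estimate R (lam S k) t (L k * D) th
     (fun s => g s - g' s) l0 th0 t0 (mulr_ge0 (L0 k) D0) (measurable_funB mg mg').
    apply: aeW => s /sub sT; rewrite -mulrA.
    apply: nonlinearity_lipschitz => [l|l|l c'].
    - exact: hM.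
    - exact: hM'.
    - exact: hD.
  apply: (le_trans h); rewrite ler_wpM2r ?expR_ge0//.
  by rewrite mulrCA mulrA (mulrC D) ler_wpM2r.
(* The starting value [2 * M] comes from the triangle inequality, the weight being at least 1. *)
have iter n k c t : t \in `[0, T] ->
   `|rcoord c (chi k t - chi' k t)| <= 2 * M / 2 ^+ n * expR (th * t).
  elim: n k c t => [|n ih] k c t tT.
    have [t0 _] : 0 <= t /\ t <= T by move: tT; rewrite in_itv/= => /andP[].
    rewrite expr0 divr1 rcoordB; apply: (le_trans (ler_normB _ _)).
    apply: (@le_trans _ _ (2 * M)).
      rewrite (_ : 2 * M = M + M); last by ring.
      apply: lerD; apply: (le_trans (rcoord_le_enorm _ _)); [exact: hM|exact: hM'].
    rewrite ler_peMr ?mulr_ge0// -expR0 ler_expR mulr_ge0//.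
  rewrite exprSr invfM mulrA; apply: step => //.
  by rewrite divr_ge0 ?mulr_ge0 ?exprn_ge0.
move=> k t tT; apply: rcoordP => c; apply/eqP; rewrite -subr_eq0 -rcoordB.
rewrite -normr_le0; apply/ler_addgt0Pr => e e0; rewrite add0r.
pose x := 2 * M * expR (th * t) / e.
have x0 : 0 <= x by rewrite divr_ge0 ?mulr_ge0 ?expR_ge0// ltW.
(* With n = trunc x + 1 one has 2^n >= n >= x, so that the n-th bound is at most [e]. *)
have := iter (Num.Def.trunc x).+1 k c t tT.
move/le_trans; apply; rewrite mulrAC ler_pdivrMr ?exprn_gt0//.
rewrite -ler_pdivrMl// mulrC -/x.
apply: (@le_trans _ _ (Num.Def.trunc x).+1%:R).
  by have /andP[_ /ltW] := truncn_itv x0.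
by rewrite -natrX ler_nat ltnW// ltn_expl.
Qed.

End uniqueness.

(** * The evaluation as an eventually constant limit *)

Section truncated_evaluation.
Context {R : realType} {d r : nat} (S : system R d r).
Variables (chi0 : Zd d -> Cr R r) (gamma : Zd d -> R -> Cr R r).

(** A structurally recursive counterpart of [evaluates], with fuel [n] and value 0 when the fuel
    runs out. Measurability can then be proved by induction on [n]. *)
Fixpoint evaln (n : nat) (t : R) (T : tree R d) : Cr R r :=
  if n isn't n'.+1 then 0 else
  if site T [::] isn't Some k then 0 else
  if t <= death T [::] then chi0 k else
  let s := t - death T [::] in
  match site T [:: o0], site T [:: o1], site T [:: o2] with
  | None, None, None => gamma k s
  | Some _, None, None => (Cf S)%:C%C *: evaln n' s (subtree o0 T)
  | None, Some l, Some m =>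
      (Cb S)%:C%C *: B S k l m (evaln n' s (subtree o1 T)) (evaln n' s (subtree o2 T))
  | _, _, _ => 0
  end.

Lemma evalnS n t T : evaln n.+1 t T =
  if site T [::] isn't Some k then 0 else
  if t <= death T [::] then chi0 k else
  let s := t - death T [::] in
  match site T [:: o0], site T [:: o1], site T [:: o2] with
  | None, None, None => gamma k s
  | Some _, None, None => (Cf S)%:C%C *: evaln n s (subtree o0 T)
  | None, Some l, Some m =>
      (Cb S)%:C%C *: B S k l m (evaln n s (subtree o1 T)) (evaln n s (subtree o2 T))
  | _, _, _ => 0
  end.
Proof. by []. Qed.

(** Scaling and the maps [B] send 0 to 0, so a recursive call that runs out of fuel makes the whole
    result 0; a nonzero result is therefore genuine. *)
Lemma evaln_evaluates n t T : evaln n t T != 0 ->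
  evaluates S chi0 gamma t T (evaln n t T).
Proof.
elim: n t T => [|n ih] t T /=; first by rewrite eqxx.
case e : (site T [::]) => [k|]; last by rewrite eqxx.
case: ifPn => [td _|]; first exact: (evaluates_initial S chi0 gamma e td).
rewrite -ltNge => td.
case e0 : (site T [:: o0]) => [k0|]; case e1 : (site T [:: o1]) => [k1|];
  case e2 : (site T [:: o2]) => [k2|]; rewrite ?eqxx// => h.
- apply: (evaluates_flip e td e0 e1 e2); apply: ih.
  by apply: contra_neq h => ->; rewrite scaler0.
- apply: (evaluates_branch e td e0 e1 e2); apply: ih; apply: contra_neq h => ->.
    by rewrite linear0l scaler0.
  by rewrite linear0r scaler0.
- exact: (evaluates_death S chi0 gamma e td e0 e1 e2).
Qed.

Lemma evaluates_evaln t T v : evaluates S chi0 gamma t T v ->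
  exists N, forall n, (N <= n)%N -> evaln n t T = v.
Proof.
elim=> {t T v} [t T k e td|t T k e td e0 e1 e2|t T k k0 v e td e0 e1 e2 _ [N hN]
  |t T k k1 k2 v1 v2 e td e0 e1 e2 _ [N1 h1] _ [N2 h2]].
- by exists 1%N => -[|n]//= _; rewrite e td.
- by exists 1%N => -[|n]//= _; rewrite e leNgt td/= e0 e1 e2.
- exists N.+1 => -[|n]//= Nn; rewrite e leNgt td/= e0 e1 e2.
  by rewrite hN.
- exists (maxn N1 N2).+1 => -[|n]//; rewrite ltnS geq_max => /andP[/h1 {}h1 /h2 {}h2] /=.
  by rewrite e leNgt td/= e0 e1 e2 h1 h2.
Qed.

(** If the recursion has a value, the truncations reach it. If it has none, [evalR] is 0 and every
    truncation is 0 by [evaln_evaluates]. *)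
Lemma evaln_eventually t T :
  exists N, forall n, (N <= n)%N -> evaln n t T = evalR S chi0 gamma t T.
Proof.
rewrite /evalR; case: xgetP => [v _ /evaluates_evaln//|h].
exists 0%N => n _; apply: contrapT => /eqP h'.
exact: (h _ (evaln_evaluates h')).
Qed.

End truncated_evaluation.

(** * Subtrees of a branching tree as branching trees *)

Section shifted_tree.
Context {R : realType} {d r : nat} (S : system R d r).
Context {disp : measure_display} {Omega : measurableType disp}.
Implicit Types (E U : label -> Omega -> R) (Y : label -> Zd d -> Omega -> Zd d * Zd d).

(** The tree is built by appending to labels whereas subtrees prepend; induction on the last letter
    reconciles the two. *)
Lemma hatK_cons Y k w i a :
  hatK Y k w (i :: a) = hatK (fun b => Y (i :: b)) (hatK Y k w [:: i]) w a.
Proof.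
elim/last_ind: a => [//|a j ih].
by rewrite -rcons_cons /hatK !label_rec_rcons -!/(hatK _ _ _ _) ih.
Qed.

Lemma tauB_cons E Y k w i a :
  tauB S E Y k w (i :: a) - tauD S E Y k w [::] =
  tauB S (fun b => E (i :: b)) (fun b => Y (i :: b)) (hatK Y k w [:: i]) w a.
Proof.
elim/last_ind: a => [|a j ih].
  by rewrite -[[:: i]]/(rcons [::] i) tauB_rcons subrr.
by rewrite -rcons_cons !tauB_rcons /tauD addrAC ih (hatK_cons Y k w i a).
Qed.

Lemma tauD_cons E Y k w i a :
  tauD S E Y k w (i :: a) - tauD S E Y k w [::] =
  tauD S (fun b => E (i :: b)) (fun b => Y (i :: b)) (hatK Y k w [:: i]) w a.
Proof. by rewrite {1}/tauD addrAC tauB_cons (hatK_cons Y k w i a). Qed.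

(** The empty label is excluded because its indicator is always true, while that of [[:: i]] depends
    on the draw at the root. *)
Lemma indic_I_cons U Y k w i a : a != [::] ->
  indic_I S U Y k w (i :: a) =
  indic_I S (fun b => U (i :: b)) (fun b => Y (i :: b)) (hatK Y k w [:: i]) w a.
Proof.
elim/last_ind: a => [//|a j _] _.
by rewrite -rcons_cons /indic_I !label_rec_rcons hatK_cons.
Qed.

Lemma alive_cons U Y k w i a :
  alive S U Y k w (i :: a) = indic_I S U Y k w [:: i] &&
  alive S (fun b => U (i :: b)) (fun b => Y (i :: b)) (hatK Y k w [:: i]) w a.
Proof.
rewrite /alive big_ltn//= take0; congr andb.
rewrite big_add1 /= !big_nat; apply: eq_bigr => j /andP[j0 ja].
by apply: indic_I_cons; case: j a j0 ja => // j [].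
Qed.

(** If the child were not drawn, the left side would have no living vertex, while the right side is
    always alive at its root. *)
Lemma subtree_branching_tree E U Y k w i : indic_I S U Y k w [:: i] ->
  subtree i (branching_tree S E U Y k w) =
  branching_tree S (fun b => E (i :: b)) (fun b => U (i :: b))
    (fun b => Y (i :: b)) (hatK Y k w [:: i]) w.
Proof.
move=> Ii; rewrite /subtree /branching_tree /=; congr Tree; apply/funext => a.
- by rewrite (alive_cons U Y k w i a) Ii (hatK_cons Y k w i a).
- exact: (tauB_cons E Y k w i a).
- exact: (tauD_cons E Y k w i a).
Qed.

Lemma alive1 U Y k w i : alive S U Y k w [:: i] = indic_I S U Y k w [:: i].
Proof. by rewrite alive_cons /alive big_geq// andbT. Qed.

End shifted_tree.

(** * The first-step recursion of the evaluation *)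

Section first_step.
Context {R : realType} {d r : nat} (S : system R d r).
Variables (chi0 : Zd d -> Cr R r) (gamma : Zd d -> R -> Cr R r).

(** The intervals are closed, as in the tree. When d_k = 0 they meet in one point, which belongs to
    none of the three regions, and [death_region] also contains what lies outside [0, 1]; both are
    null for the uniform law. *)
Definition flip_region k : set R :=
  [set u | (0 <= u <= pr S k) && ~~ (1 - qtot S k <= u <= 1)].
Definition branch_region k : set R :=
  [set u | ~~ (0 <= u <= pr S k) && (1 - qtot S k <= u <= 1)].
Definition death_region k : set R :=
  [set u | ~~ (0 <= u <= pr S k) && ~~ (1 - qtot S k <= u <= 1)].

(* On the null event that both a flip and a branch are drawn the value is 0,
   as it is for [evalR]. *)
Definition first_step (k : Zd d) (t e u : R) (y : Zd d * Zd d)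
    (F : 'I_3 -> R -> Zd d -> Cr R r) : Cr R r :=
  let s := t - (lam S k)^-1 * e in
  if s <= 0 then chi0 k
  else if u \in flip_region k then (Cf S)%:C%C *: F o0 s k
  else if u \in branch_region k then
    (Cb S)%:C%C *: B S k y.1 y.2 (F o1 s y.1) (F o2 s y.2)
  else if u \in death_region k then gamma k s else 0.

Context {disp : measure_display} {Omega : measurableType disp}.
Implicit Types (E U : label -> Omega -> R) (Y : label -> Zd d -> Omega -> Zd d * Zd d).

Lemma evaln_first_step n E U Y k w t :
  evaln S chi0 gamma n.+1 t (branching_tree S E U Y k w) =
  first_step k t (E [::] w) (U [::] w) (Y [::] k w)
    (fun i s l => evaln S chi0 gamma n s
      (branching_tree S (fun b => E (i :: b)) (fun b => U (i :: b))
         (fun b => Y (i :: b)) l w)).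
Proof.
set L := LHS.
have dE : death (branching_tree S E U Y k w) [::] = (lam S k)^-1 * E [::] w.
  by rewrite /= /tauD /tauB /= add0r.
have siteE i : site (branching_tree S E U Y k w) [:: i] =
   if indic_I S U Y k w [:: i] then Some (hatK Y k w [:: i]) else None.
  by rewrite /= alive1.
have site0 : site (branching_tree S E U Y k w) [::] = Some k.
  by rewrite /= /alive big_geq.
have I0 : indic_I S U Y k w [:: o0] = (0 <= U [::] w <= pr S k) by [].
have I1 : indic_I S U Y k w [:: o1] = (1 - qtot S k <= U [::] w <= 1) by [].
have I2 : indic_I S U Y k w [:: o2] = (1 - qtot S k <= U [::] w <= 1) by [].
have sub0 := @subtree_branching_tree _ _ _ S _ _ E U Y k w o0.
have sub1 := @subtree_branching_tree _ _ _ S _ _ E U Y k w o1.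
have sub2 := @subtree_branching_tree _ _ _ S _ _ E U Y k w o2.
rewrite {}/L evalnS site0 dE !siteE /first_step subr_le0.
case: ifP => // _.
rewrite I0 I1 I2 in sub0 sub1 sub2 *.
have memE (A : R -> bool) u : (u \in [set u | A u]) = A u.
  by apply/idP/idP; rewrite inE.
rewrite !memE.
case: (0 <= U [::] w <= pr S k) in sub0 *;
  case: (1 - qtot S k <= U [::] w <= 1) in sub1 sub2 * => //=.
- by rewrite sub0.
- by rewrite sub1// sub2.
Qed.

(** The truncations satisfy the recursion exactly, with the fuel lowered by one, and for large [n]
    those of the tree and of its possible subtrees have all reached their final values. *)
Lemma evalR_first_step E U Y k w t :
  evalR S chi0 gamma t (branching_tree S E U Y k w) =
  first_step k t (E [::] w) (U [::] w) (Y [::] k w)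
    (fun i s l => evalR S chi0 gamma s
      (branching_tree S (fun b => E (i :: b)) (fun b => U (i :: b))
         (fun b => Y (i :: b)) l w)).
Proof.
set s := t - (lam S k)^-1 * E [::] w; set y := Y [::] k w.
pose T i l := branching_tree S (fun b => E (i :: b)) (fun b => U (i :: b))
         (fun b => Y (i :: b)) l w.
have [N hN] := evaln_eventually S chi0 gamma t (branching_tree S E U Y k w).
have [N0 h0] := evaln_eventually S chi0 gamma s (T o0 k).
have [N1 h1] := evaln_eventually S chi0 gamma s (T o1 y.1).
have [N2 h2] := evaln_eventually S chi0 gamma s (T o2 y.2).
pose n := (N + (N0 + (N1 + N2)))%N.
rewrite -(hN n.+1) ?evaln_first_step; last by rewrite /n; lia.
rewrite /first_step -/s -/y -/(T o0 k) -/(T o1 y.1) -/(T o2 y.2).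
rewrite (h0 n) ?(h1 n) ?(h2 n)//; rewrite /n; lia.
Qed.

End first_step.

(** * Finite intersections of events and independence of blocks of variables *)

Section finite_intersections.
Context {T : Type} {I : choiceType}.
Implicit Types (F : I -> set (set T)) (K : set I).

(** Independence is assumed for finite families of events, one per variable. Their intersections
    form a pi-system, from which independence is carried to larger classes of events. *)
Definition finite_meets F K : set (set T) :=
  [set B | exists (J : seq I) (A : I -> set T),
    [/\ uniq J, forall i, i \in J -> K i, forall i, i \in J -> F i (A i) &
        B = \bigcap_(i in [set` J]) A i]].

Lemma finite_meets1 F K i A : K i -> F i A -> finite_meets F K A.
Proof.
move=> Ki FA; exists [:: i], (fun=> A); split => //.
- by move=> j; rewrite inE => /eqP ->.
- by move=> j; rewrite inE => /eqP ->.
- by apply/seteqP; split => [x Ax j //|x]; apply => /=; rewrite inE.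
Qed.

Lemma finite_meetsT F K : finite_meets F K setT.
Proof.
by exists [::], (fun=> setT); split => //; rewrite set_nil bigcap_set0.
Qed.

Lemma finite_meets_disjointI F K1 K2 B1 B2 : K1 `&` K2 = set0 ->
  finite_meets F K1 B1 -> finite_meets F K2 B2 ->
  finite_meets F (K1 `|` K2) (B1 `&` B2).
Proof.
move=> K12 [J1 [A1 [u1 k1 f1 ->]]] [J2 [A2 [u2 k2 f2 ->]]].
have dis i : i \in J1 -> i \in J2 -> False.
  by move=> /k1 h1 /k2 h2; have : (K1 `&` K2) i by []; rewrite K12.
exists (J1 ++ J2), (fun i => if i \in J1 then A1 i else A2 i); split.
- rewrite cat_uniq u1 u2 andbT/=; apply/hasPn => i iJ2; apply/negP => iJ1.
  exact: (dis i).
- by move=> i; rewrite mem_cat => /orP[/k1|/k2]; [left|right].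
- by move=> i; rewrite mem_cat; case: ifPn => [iJ1 _|_ /=]; [exact: f1|exact: f2].
- apply/seteqP; split => [x [h1 h2] i /=|x h].
    by rewrite mem_cat; case: ifPn => [iJ1 _|_ /= iJ2]; [exact: h1|exact: h2].
  split => i /= iJ.
    by have := h i; rewrite /= mem_cat iJ => /(_ isT).
  have := h i; rewrite /= mem_cat iJ orbT => /(_ isT); case: ifPn => // iJ1.
  by have := dis i iJ1 iJ.
Qed.

Lemma finite_meets_setI F K : (forall i, setI_closed (F i)) ->
  (forall i, F i setT) -> setI_closed (finite_meets F K).
Proof.
move=> FI FT _ _ [J1 [A1 [u1 k1 f1 ->]]] [J2 [A2 [u2 k2 f2 ->]]].
(* Missing indices are padded with the whole space, so that one index list serves both families. *)
exists (undup (J1 ++ J2)), (fun i => (if i \in J1 then A1 i else setT) `&`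
  (if i \in J2 then A2 i else setT)); split.
- exact: undup_uniq.
- by move=> i; rewrite mem_undup mem_cat => /orP[/k1|/k2].
- move=> i _; apply: FI; case: ifPn => //; [exact: f1|exact: f2].
- apply/seteqP; split => [x [h1 h2] i _|x h].
    by split; case: ifPn => // iJ; [exact: h1|exact: h2].
  split => i /= iJ; have := h i; rewrite /= mem_undup mem_cat iJ ?orbT => /(_ isT) [];
    by rewrite ?iJ.
Qed.

End finite_intersections.

Section independence_finite_meets.
Context {R : realType} {disp : measure_display} {Omega : measurableType disp}.
Variables (P : probability Omega R) (I : choiceType) (F : I -> set (set Omega)).
Hypothesis indF : independent_events P F.

(** The product formula for the concatenated family factors over the two disjoint blocks of
    indices. *)
Lemma independent_finite_meets K1 K2 B1 B2 : K1 `&` K2 = set0 ->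
  finite_meets F K1 B1 -> finite_meets F K2 B2 ->
  P (B1 `&` B2) = (P B1 * P B2)%E.
Proof.
move=> K12 [J1 [A1 [u1 k1 f1 ->]]] [J2 [A2 [u2 k2 f2 ->]]].
have dis i : i \in J1 -> i \in J2 -> False.
  by move=> /k1 h1 /k2 h2; have : (K1 `&` K2) i by []; rewrite K12.
pose A i := if i \in J1 then A1 i else A2 i.
have e1 i : i \in J1 -> A i = A1 i by rewrite /A => ->.
have e2 i : i \in J2 -> A i = A2 i.
  by rewrite /A; case: ifPn => // h1 h2; have := dis i h1 h2.
have -> : \bigcap_(i in [set` J1]) A1 i = \bigcap_(i in [set` J1]) A i.
  by apply: eq_bigcapr => i /e1 ->.
have -> : \bigcap_(i in [set` J2]) A2 i = \bigcap_(i in [set` J2]) A i.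
  by apply: eq_bigcapr => i /e2 ->.
rewrite -bigcap_setU (_ : [set` J1] `|` [set` J2] = [set` J1 ++ J2]); last first.
  by apply/seteqP; split => i /=; rewrite mem_cat => /orP.
rewrite indF ?big_cat//=.
- by rewrite !indF// => i ij; [rewrite e2//; exact: f2|rewrite e1//; exact: f1].
- rewrite cat_uniq u1 u2 andbT/=; apply/hasPn => i iJ2; apply/negP => iJ1.
  exact: (dis i).
- by move=> i; rewrite mem_cat => /orP[h|h]; [rewrite e1//; exact: f1|rewrite e2//; exact: f2].
Qed.

End independence_finite_meets.

(** * The space of configurations *)

Section configurations.
Context {R : realType} {d : nat}.

(* The product space of all E, U, Y.  The subtrees at distinct children depend on
   independent configurations with the same law, and [evalR] is jointly measurable
   in the time and the configuration, so that Tonelli applies. *)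
Definition config : Type :=
  ((label -> R) * (label -> R) * (label -> Zd d -> Zd d * Zd d))%type.

Definition zpt : Zd d * Zd d := (0, 0).
HB.instance Definition _ := Choice.on config.
HB.instance Definition _ :=
  isPointed.Build config ((fun=> 0, fun=> 0), fun _ _ => zpt).

Definition coord_events (i : label + label + label * Zd d) : set (set config) :=
  match i with
  | inl (inl a) => [set [set th : config | A (th.1.1 a)] | A in [set A : set R | measurable A]]
  | inl (inr a) => [set [set th : config | A (th.1.2 a)] | A in [set A : set R | measurable A]]
  | inr (a, k) => [set [set th : config | A (th.2 a k)] | A in [set: set (Zd d * Zd d)]]
  end.

Definition cylinders : set (set config) := finite_meets coord_events setT.

Lemma coord_eventsI i : setI_closed (coord_events i).
Proof.
case: i => [[a|a]|[a k]] _ _ [A mA <-] [B mB <-].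
- by exists (A `&` B) => //; exact: measurableI.
- by exists (A `&` B) => //; exact: measurableI.
- by exists (A `&` B).
Qed.

Lemma coord_eventsT i : coord_events i setT.
Proof.
by case: i => [[a|a]|[a k]]; exists setT => //=; exact: measurableT.
Qed.

Lemma cylindersI : setI_closed cylinders.
Proof. by apply: finite_meets_setI; [exact: coord_eventsI|exact: coord_eventsT]. Qed.

Definition configT := g_sigma_algebraType cylinders.

Lemma measurable_coord_event i (A : set configT) : coord_events i A -> measurable A.
Proof. by move=> h; apply: sub_sigma_algebra; exact: (@finite_meets1 _ _ _ _ i). Qed.

Lemma measurable_cfgE a : measurable_fun [set: configT] (fun th : configT => th.1.1 a).
Proof.
move=> _ A mA; rewrite setTI; apply: (@measurable_coord_event (inl (inl a))).
by exists A.
Qed.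

Lemma measurable_cfgU a : measurable_fun [set: configT] (fun th : configT => th.1.2 a).
Proof.
move=> _ A mA; rewrite setTI; apply: (@measurable_coord_event (inl (inr a))).
by exists A.
Qed.

Lemma measurable_cfgY a k (A : set (Zd d * Zd d)) :
  measurable [set th : configT | A (th.2 a k)].
Proof. by apply: (@measurable_coord_event (inr (a, k))); exists A. Qed.

(** Acts on whole configurations so that the child trees in [evaln_first_step] are, up to
    conversion, trees of a shifted configuration. *)
Definition shift_config (v : label) (th : configT) : configT :=
  ((fun a => th.1.1 (v ++ a), fun a => th.1.2 (v ++ a)), fun a k => th.2 (v ++ a) k).

Lemma measurable_to_config (disp : measure_display) (X : measurableType disp)
    (f : X -> configT) :
  (forall i A, coord_events i A -> measurable (f @^-1` A)) ->
  measurable_fun [set: X] f.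
Proof.
move=> h; apply: (@measurability _ _ _ _ setT f cylinders) => //.
move=> _ [_ [J [A [uJ _ fJ ->]]] <-]; rewrite setTI preimage_bigcap.
apply: fin_bigcap_measurable; first exact: finite_seq.
by move=> i iJ; apply: h (fJ i iJ).
Qed.

Lemma measurable_shift_config v : measurable_fun [set: configT] (shift_config v).
Proof.
apply: measurable_to_config => -[[a|a]|[a k]] _ [A mA <-].
- by rewrite -[_ @^-1` _]setTI; exact: measurable_cfgE.
- by rewrite -[_ @^-1` _]setTI; exact: measurable_cfgU.
- exact: measurable_cfgY.
Qed.

End configurations.

(** * All vertices carry configurations with the same law *)

Section branching_configurations.
Context {R : realType} {d r : nat} (S : system R d r).
Context {disp : measure_display} {Omega : measurableType disp}.
Variables (P : probability Omega R) (E U : label -> {RV P >-> R})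
  (Y : label -> Zd d -> Omega -> Zd d * Zd d).
Hypothesis EUY : branching_variables S E U Y.

Notation index := (label + label + label * Zd d)%type.

(* The law of [Y a k] is arbitrary when [qtot S k = 0]; making it constant
   there gives all vertices the same law. *)
Definition Ynorm a k w : Zd d * Zd d := if 0 < qtot S k then Y a k w else zpt.

(** The variables at the descendants of [v], read as one random configuration; [lab] and [relab]
    locate its coordinates among the original variables. *)
Definition cfg (v : label) (w : Omega) : @configT R d :=
  ((fun a => E (v ++ a) w, fun a => U (v ++ a) w), fun a k => Ynorm (v ++ a) k w).

Definition lab (i : index) : label :=
  match i with inl (inl a) => a | inl (inr a) => a | inr (a, _) => a end.

Definition relab (f : label -> label) (i : index) : index :=
  match i with
  | inl (inl a) => inl (inl (f a)) | inl (inr a) => inl (inr (f a))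
  | inr (a, k) => inr (f a, k)
  end.

Let F : index -> set (set Omega) := generated_events E U Y.

Lemma measurable_Y_preimage a k (A : set (Zd d * Zd d)) : measurable (Y a k @^-1` A).
Proof.
have -> : Y a k @^-1` A = \bigcup_(z in A) (Y a k @^-1` [set z]).
  by apply/seteqP; split => [w Aw|w [z Az /= e]]; [by exists (Y a k w)|rewrite /preimage/= e].
rewrite bigcup_mkcond; apply: countable_bigcupT_measurable => [|z].
  exact: countableP.
by case: ifPn => // _; exact: (measurable_Y EUY).
Qed.

Lemma measurable_generated_events i A : F i A -> measurable A.
Proof.
case: i => [[a|a]|[a k]] [B mB <-].
- by rewrite -[_ @^-1` _]setTI; exact: measurable_funP.
- by rewrite -[_ @^-1` _]setTI; exact: measurable_funP.
- exact: measurable_Y_preimage.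
Qed.

(** Where [qtot] vanishes [Ynorm] is constant, so the event is everything or nothing, and both are
    events of [Y]. *)
Lemma cfg_coord_events v i A : coord_events i A ->
  F (relab (cat v) i) (cfg v @^-1` A).
Proof.
case: i => [[a|a]|[a k]] [B mB <-] /=.
- by exists B.
- by exists B.
- have [q0|q0] := boolP (0 < qtot S k).
    by exists B => //; apply/seteqP; split => w; rewrite /preimage/= /Ynorm q0.
  have [Bz|Bz] := pselect (B zpt).
    exists setT => //; apply/seteqP; split => w //=.
    by rewrite /Ynorm (negbTE q0).
  exists set0 => //; apply/seteqP; split => w //=.
  by rewrite /Ynorm (negbTE q0).
Qed.

Lemma measurable_cfg v : measurable_fun [set: Omega] (cfg v).
Proof.
apply: measurable_to_config => i A /(cfg_coord_events v).
exact: measurable_generated_events.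
Qed.

(** [law_Y] gives the probability of singletons; a set of pairs is a countable disjoint union of
    these. *)
Lemma law_Y_eq a b k A : 0 < qtot S k -> P (Y a k @^-1` A) = P (Y b k @^-1` A).
Proof.
move=> q0.
pose G a n : set Omega := if pickle_inv n is Some z then
  (if z \in A then Y a k @^-1` [set z] else set0) else set0.
have GE c : Y c k @^-1` A = \bigcup_n G c n.
  apply/seteqP; split => [w Aw|w [n _]].
    exists (pickle (Y c k w)) => //; rewrite /G pickleK_inv mem_set//.
  rewrite /G; case: pickle_inv => [z|//]; case: ifPn => // /[!inE] Az /= e.
  by rewrite /preimage/= e.
have mG c n : measurable (G c n).
  by rewrite /G; case: pickle_inv => [z|//]; case: ifPn => // _; exact: measurable_Y_preimage.
have tG c : trivIset setT (G c).
  apply/trivIsetP => i j _ _ ij; apply/seteqP; split => // w [].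
  rewrite /G; case ei : (pickle_inv i) => [z|//]; case ej : (pickle_inv j) => [z'|//].
  case: ifPn => // _ /= e; case: ifPn => // _ /= e'.
  have := @pickle_invK (Zd d * Zd d)%type i; have := @pickle_invK (Zd d * Zd d)%type j.
  rewrite /ocancel ei ej/= => h1 h2; move/eqP: ij; apply.
  by rewrite -h1 -h2 -e -e'.
rewrite !GE !measure_bigcup//; apply: eq_eseriesr => n _.
rewrite /G; case: pickle_inv => [[l m]|//]; case: ifPn => // _.
exact: (etrans (law_Y EUY a l m q0) (esym (law_Y EUY b l m q0))).
Qed.

Lemma law_coord_events v i A : coord_events i A ->
  P (cfg v @^-1` A) = P (cfg [::] @^-1` A).
Proof.
case: i => [[a|a]|[a k]] [B mB <-] /=.
- exact: (etrans (law_E EUY (v ++ a) mB) (esym (law_E EUY a mB))).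
- exact: (etrans (law_U EUY (v ++ a) mB) (esym (law_U EUY a mB))).
- rewrite /preimage/= /Ynorm.
  have [q0|q0] := boolP (0 < qtot S k); last by [].
  exact: (law_Y_eq (v ++ a) a B q0).
Qed.

(** Prefixing by [v] is undone by dropping [size v] letters, so a cylinder pulls back to a finite
    intersection over variables labelled below [v]. Distinct children thus use disjoint blocks of
    variables. *)
Lemma cfg_cylinders v C : cylinders C ->
  finite_meets F [set i | exists a, lab i = v ++ a] (cfg v @^-1` C).
Proof.
move=> [J [A [uJ _ fJ ->]]].
have rK : cancel (relab (cat v)) (relab (drop (size v))).
  by case=> [[a|a]|[a k]] /=; rewrite drop_size_cat.
exists (map (relab (cat v)) J), (fun i => cfg v @^-1` (A (relab (drop (size v)) i))).
split.
- by rewrite (map_inj_uniq (can_inj rK)).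
- by move=> _ /mapP[[[a|a]|[a k]] _ ->]; exists a.
- by move=> _ /mapP[i iJ ->]; rewrite rK; apply: cfg_coord_events; exact: fJ.
- rewrite preimage_bigcap; apply/seteqP; split => [w h _ /mapP[i iJ ->]|w h i iJ].
    by rewrite /= rK; exact: h.
  by have := h (relab (cat v) i); rewrite /= rK; apply; exact: map_f.
Qed.

Lemma law_cfg_cylinders v C : cylinders C ->
  P (cfg v @^-1` C) = P (cfg [::] @^-1` C).
Proof.
move=> cC; move: (cC) => [J [A [uJ _ fJ CE]]].
suff H u : P (cfg u @^-1` C) = (\prod_(i <- J) P (cfg u @^-1` A i))%E.
  by rewrite !H; apply: eq_big_seq => i iJ; apply: law_coord_events; exact: fJ.
have rK : cancel (relab (cat u)) (relab (drop (size u))).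
  by case=> [[a|a]|[a k]] /=; rewrite drop_size_cat.
have := independence_EUY EUY (J := map (relab (cat u)) J)
  (A := fun i => cfg u @^-1` (A (relab (drop (size u)) i))).
rewrite (map_inj_uniq (can_inj rK)) => /(_ uJ).
rewrite big_map; under eq_bigr do rewrite rK.
move=> <-; last first.
  by move=> _ /mapP[i iJ ->]; rewrite rK; apply: cfg_coord_events; exact: fJ.
congr (P _); rewrite CE preimage_bigcap.
apply/seteqP; split => [w h _ /mapP[i iJ ->]|w h i iJ].
  by rewrite /= rK; exact: h.
by have := h (relab (cat u) i); rewrite /= rK; apply; exact: map_f.
Qed.

Definition cfg_rv v : {mfun Omega >-> @configT R d} :=
  mfun_Sub (mem_set (measurable_cfg v)).

Definition config_law : probability (@configT R d) R := distribution P (cfg_rv [::]).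

(** Two probabilities that agree on the pi-system of cylinders are equal; hence the subtree at any
    vertex has the law of the whole tree. *)
Lemma config_lawE v A : measurable A -> P (cfg v @^-1` A) = config_law A.
Proof.
move=> mA; rewrite -[LHS]/(distribution P (cfg_rv v) A).
apply: (@measure_unique _ R (@configT R d) cylinders (fun=> setT) _ _ _ _
  (distribution P (cfg_rv v)) config_law) => //.
- exact: cylindersI.
- by move=> _; exact: finite_meetsT.
- by rewrite bigcup_const.
- by move=> C; exact: law_cfg_cylinders.
- by move=> _; exact: fin_num_fun_lty.
Qed.

End branching_configurations.

(** * Densities, and laws restricted to an event *)

Section density.
Context {R : realType} {disp : measure_display} {T : measurableType disp}.
Variables (mu nu : {measure set T -> \bar R}) (p : T -> R).
Hypotheses (mp : measurable_fun [set: T] p) (p0 : forall x, 0 <= p x)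
  (nuE : forall A, measurable A -> nu A = (\int[mu]_(x in A) (p x)%:E)%E).

Import HBNNSimple.

Let integral_density_indic A : measurable A ->
  (\int[nu]_x (\1_A x)%:E = \int[mu]_x ((\1_A x)%:E * (p x)%:E))%E.
Proof.
move=> mA; rewrite integral_indic// setIT nuE// integral_mkcond.
apply: eq_integral => x _; rewrite patchE indicE.
by case: ifPn => xA; rewrite ?mul1e ?mul0e.
Qed.

Let integral_density_nnsfun (f : {nnsfun T >-> R}) :
  (\int[nu]_x (f x)%:E = \int[mu]_x ((f x)%:E * (p x)%:E))%E.
Proof.
under [LHS]eq_integral do rewrite fimfunE -fsumEFin//.
rewrite [LHS]ge0_integral_fsum//; last 2 first.
  - by move=> y; exact/measurable_EFinP/measurableT_comp.
  - by move=> n x _; rewrite EFinM nnfun_muleindic_ge0.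
under [RHS]eq_integral.
  move=> x xD; rewrite fimfunE -fsumEFin// muleC ge0_mule_fsumr; last first.
    by move=> y; rewrite EFinM nnfun_muleindic_ge0.
  over.
have mpE : measurable_fun [set: T] (EFin \o p) by exact/measurable_EFinP.
rewrite [RHS]ge0_integral_fsum//; last 2 first.
  - move=> y; apply: emeasurable_funM => //.
    by apply/measurable_EFinP; do 2 apply/measurableT_comp => //.
  - move=> n x _; apply: mule_ge0; first by rewrite lee_fin.
    by rewrite EFinM nnfun_muleindic_ge0.
apply: eq_fsbigr => y /[!inE] -[z _ <-].
under [RHS]eq_integral do rewrite EFinM muleCA (muleC (p _)%:E).
rewrite [RHS]ge0_integralZl//; last 3 first.
- by apply: emeasurable_funM => //; exact/measurable_EFinP.
- by move=> x _; rewrite mule_ge0// lee_fin.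
- by rewrite lee_fin.
rewrite -integral_density_indic//.
under [LHS]eq_integral do rewrite EFinM.
rewrite ge0_integralZl//; last by rewrite lee_fin.
exact/measurable_EFinP.
Qed.

(** Indicators, simple functions, monotone limits. It serves for the density of the time left at the
    first death and, with an indicator as density, for the restriction of a probability to an
    event. *)
Lemma ge0_integral_density (f : T -> \bar R) :
  measurable_fun [set: T] f -> (forall x, 0 <= f x)%E ->
  (\int[nu]_x f x = \int[mu]_x (f x * (p x)%:E))%E.
Proof.
move=> mf f0.
pose f_ := nnsfun_approx measurableT mf.
transitivity (lim (\int[nu]_x (f_ n x)%:E @[n --> \oo])%E).
  rewrite -monotone_convergence//=.
  - apply: eq_integral => ? /[!inE] xD; apply/esym/cvg_lim => //=.
    exact: cvg_nnsfun_approx.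
  - by move=> n; exact/measurable_EFinP/measurable_funTS.
  - by move=> n ? _; rewrite lee_fin.
  - by move=> ? _ ? ? mn; rewrite lee_fin; exact/lefP/nd_nnsfun_approx.
under eq_fun do rewrite integral_density_nnsfun.
have mpE : measurable_fun [set: T] (EFin \o p) by exact/measurable_EFinP.
rewrite -monotone_convergence//=.
- apply: eq_integral => x _; rewrite muleC; apply/cvg_lim => //.
  under eq_fun do rewrite muleC.
  by apply: cvgeZl => //; exact: cvg_nnsfun_approx.
- by move=> n; apply: emeasurable_funM => //; exact/measurable_EFinP/measurable_funTS.
- by move=> n x _; rewrite mule_ge0// lee_fin.
- move=> x _ m n mn; rewrite lee_wpmul2r ?lee_fin//.
  exact/lefP/nd_nnsfun_approx.
Qed.

End density.

Section density_measure.
Context {R : realType} {disp : measure_display} {T : measurableType disp}.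
Variables (mu : {measure set T -> \bar R}) (p : T -> R).
Hypotheses (mp : measurable_fun [set: T] p) (p0 : forall x, 0 <= p x).

Definition density_measure (A : set T) : \bar R := (\int[mu]_(x in A) (p x)%:E)%E.

Let density0 : density_measure set0 = 0%E.
Proof. by rewrite /density_measure integral_set0. Qed.

Let density_ge0 A : (0 <= density_measure A)%E.
Proof. by apply: integral_ge0 => x _; rewrite lee_fin. Qed.

Let density_sigma_additive : semi_sigma_additive density_measure.
Proof.
move=> /= F mF tF mUF; rewrite /density_measure; apply: cvg_toP.
  apply: ereal_nondecreasing_is_cvgn => m n mn.
  apply: lee_sum_nneg_natr => // k _ _.
  by apply: integral_ge0 => /= x Fkx; rewrite lee_fin.
rewrite ge0_integral_bigcup//=.
- by apply: measurable_funTS; exact/measurable_EFinP.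
- by move=> x _; rewrite lee_fin.
Qed.

HB.instance Definition _ := isMeasure.Build _ _ _ density_measure
  density0 density_ge0 density_sigma_additive.

End density_measure.

Section restricted_law.
Context {R : realType} {d1 d2 : measure_display}
  {T1 : measurableType d1} {T2 : measurableType d2}.
Variables (P : probability T1 R) (D : set T1) (mD : measurable D)
  (X : T1 -> T2) (mX : measurable_fun [set: T1] X).

(** The law of [X] on the event [D], not divided by [P D], which may vanish. *)
Definition restricted_law (A : set T2) : \bar R := P (X @^-1` A `&` D).

Let mpre A : measurable A -> measurable (X @^-1` A).
Proof. by move=> mA; rewrite -[_ @^-1` _]setTI; exact: mX. Qed.

Let law0 : restricted_law set0 = 0%E.
Proof. by rewrite /restricted_law preimage_set0 set0I measure0. Qed.

Let law_ge0 A : (0 <= restricted_law A)%E.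
Proof. exact: measure_ge0. Qed.

Let law_sigma_additive : semi_sigma_additive restricted_law.
Proof.
move=> F mF tF mUF; rewrite /restricted_law preimage_bigcup.
apply: (@measure_semi_sigma_additive _ _ _ (mrestr P mD) (fun n => X @^-1` F n)).
- by move=> n; exact: mpre.
- apply/trivIsetP => /= i j _ _ ij; rewrite -preimage_setI.
  by move/trivIsetP : tF => /(_ _ _ _ _ ij) ->//; rewrite preimage_set0.
- by rewrite -preimage_bigcup; exact: mpre.
Qed.

HB.instance Definition _ := isMeasure.Build _ _ _ restricted_law
  law0 law_ge0 law_sigma_additive.

Let law_fin : fin_num_fun restricted_law.
Proof.
move=> A mA; rewrite ge0_fin_numE//.
apply: (@le_lt_trans _ _ 1%E); last exact: ltry.
by apply: probability_le1; apply: measurableI => //; exact: mpre.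
Qed.

HB.instance Definition _ := @Measure_isFinite.Build _ _ _ restricted_law law_fin.

Definition restricted_law_measure : {finite_measure set T2 -> \bar R} :=
  restricted_law.

Lemma ge0_integral_restricted_law (f : T2 -> \bar R) :
  measurable_fun [set: T2] f -> (forall x, 0 <= f x)%E ->
  (\int[restricted_law]_x f x = \int[P]_(x in D) f (X x))%E.
Proof.
move=> mf f0.
have := @ge0_integral_pushforward _ _ _ _ R X mX (mrestr P mD) setT f measurableT mf
  (fun x _ => f0 x).
rewrite preimage_setT => H.
transitivity (\int[mrestr P mD]_x (f \o X) x)%E.
  by rewrite -H; exact: eq_measure_integral.
rewrite (@ge0_integral_density _ _ _ P (mrestr P mD) \1_D)//.
- rewrite [RHS]integral_mkcond; apply: eq_integral => x _ /=.
  by rewrite patchE indicE; case: ifPn => _; rewrite ?mule1 ?mule0.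
- by move=> A mA; rewrite integral_indic// setIC.
- exact: measurableT_comp.
- by move=> x /=.
Qed.

End restricted_law.

Section scaled_law.
Context {R : realType} {d1 d2 : measure_display}
  {T1 : measurableType d1} {T2 : measurableType d2}.
Variables (P : probability T1 R) (D : set T1) (mD : measurable D)
  (X : T1 -> T2) (mX : measurable_fun [set: T1] X) (mu : probability T2 R)
  (G : set (set T2)).
Hypotheses (GE : @measurable _ T2 = <<s G >>) (GI : setI_closed G) (GT : G setT)
  (GX : forall C, G C -> P (X @^-1` C `&` D) = (P D * mu C)%E).

(** Uniqueness of measures for the restricted law and the multiple [P D] of [mu]. No conditional
    probability is formed, so the case [P D = 0] is no exception. *)
Lemma law_unique_scaled A : measurable A -> P (X @^-1` A `&` D) = (P D * mu A)%E.
Proof.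
have fD : 0 <= fine (P D) by exact: fine_ge0.
have PDE : P D = (fine (P D))%:E by rewrite fineK// fin_num_measure.
move=> mA; rewrite PDE -[LHS]/(restricted_law P D X A).
rewrite -[RHS]/(mscale (NngNum fD) mu A).
apply: (@measure_unique _ R T2 G (fun=> setT) GE GI _ _
  (restricted_law P D X) (mscale (NngNum fD) mu)) => //.
- by rewrite bigcup_const.
- by move=> C GC; apply: (etrans (GX GC)); rewrite {1}PDE.
- move=> _; apply: (@le_lt_trans _ _ 1%E); last exact: ltry.
  by apply: probability_le1; rewrite preimage_setT setTI.
Qed.

End scaled_law.

(** * Independence of the root and two of its child configurations *)

Section root_independence.
Context {R : realType} {d r : nat} (S : system R d r).
Context {disp : measure_display} {Omega : measurableType disp}.
Variables (P : probability Omega R) (E U : label -> {RV P >-> R})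
  (Y : label -> Zd d -> Omega -> Zd d * Zd d).
Hypothesis EUY : branching_variables S E U Y.

Let F := generated_events E U Y.
Notation mu := (config_law EUY).
Notation cfg := (cfg S E U Y).

Definition root_event k (A1 A2 : set R) (A3 : set (Zd d * Zd d)) : set Omega :=
  E [::] @^-1` A1 `&` U [::] @^-1` A2 `&` Ynorm S Y [::] k @^-1` A3.

Lemma generated_eventsI i : setI_closed (F i).
Proof.
case: i => [[a|a]|[a k]] _ _ [A mA <-] [B mB <-].
- by exists (A `&` B) => //; exact: measurableI.
- by exists (A `&` B) => //; exact: measurableI.
- by exists (A `&` B).
Qed.

Lemma generated_eventsT i : F i setT.
Proof. by case: i => [[a|a]|[a k]]; exists setT => //=; exact: measurableT. Qed.

Lemma root_event_finite_meets k A1 A2 A3 : measurable A1 -> measurable A2 ->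
  finite_meets F [set i | lab i = [::]] (root_event k A1 A2 A3).
Proof.
move=> mA1 mA2.
apply: finite_meets_setI; [exact: generated_eventsI|exact: generated_eventsT| |].
  apply: finite_meets_setI; [exact: generated_eventsI|exact: generated_eventsT| |].
    by apply: (@finite_meets1 _ _ F _ (inl (inl [::]))) => //; exists A1.
  by apply: (@finite_meets1 _ _ F _ (inl (inr [::]))) => //; exists A2.
apply: (@finite_meets1 _ _ F _ (inr ([::], k))) => //.
apply: (@cfg_coord_events _ _ _ S _ _ P E U Y [::] (inr ([::], k))
  [set th | A3 (th.2 [::] k)]).
by exists A3.
Qed.

Lemma finite_meets_measurable K B : finite_meets F K B -> measurable B.
Proof.
move=> [J [A [_ _ fJ ->]]]; apply: fin_bigcap_measurable; first exact: finite_seq.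
by move=> i iJ; apply: (measurable_generated_events EUY (fJ i iJ)).
Qed.

Lemma measurable_cfg_preimage v A : measurable A -> measurable (cfg v @^-1` A).
Proof. by move=> mA; rewrite -[_ @^-1` _]setTI; exact: measurable_cfg. Qed.

(** The pi-system argument enlarges one class at a time: from cylinders to measurable sets for child
    [i], with the rest fixed, and then for child [j]. *)
Lemma children_independent D (i j : 'I_3) B1 B2 : i != j ->
  finite_meets F [set i | lab i = [::]] D -> measurable B1 -> measurable B2 ->
  P (cfg [:: i] @^-1` B1 `&` (cfg [:: j] @^-1` B2 `&` D)) =
  (P D * (mu B1 * mu B2))%E.
Proof.
move=> ij fD mB1 mB2; have mD := finite_meets_measurable fD.
have root_child v : [set x : label + label + label * Zd d | exists a, lab x = v :: a] `&`
    [set i | lab i = [::]] = set0.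
  by apply/seteqP; split => // x [[a /= ->]].
have sep : [set x : label + label + label * Zd d | exists a, lab x = i :: a] `&`
   ([set x | exists a, lab x = j :: a] `|` [set x | lab x = [::]]) = set0.
  apply/seteqP; split => // x [[a /= ->]] [[b [e _]]|//].
  by move: ij; rewrite e eqxx.
have one v C : cylinders C -> P (cfg [:: v] @^-1` C `&` D) = (P D * mu C)%E.
  move=> cC; have fC := cfg_cylinders S E U Y [:: v] cC.
  rewrite (independent_finite_meets (independence_EUY EUY) (root_child v) fC fD).
  by rewrite muleC config_lawE//; exact: sub_sigma_algebra.
have two C1 C2 : cylinders C1 -> cylinders C2 ->
    P (cfg [:: i] @^-1` C1 `&` (cfg [:: j] @^-1` C2 `&` D)) =
    (P (cfg [:: j] @^-1` C2 `&` D) * mu C1)%E.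
  move=> c1 c2.
  have f1 := cfg_cylinders S E U Y [:: i] c1.
  have f2 := cfg_cylinders S E U Y [:: j] c2.
  have f3 := finite_meets_disjointI (root_child j) f2 fD.
  rewrite (independent_finite_meets (independence_EUY EUY) sep f1 f3).
  by rewrite muleC config_lawE//; exact: sub_sigma_algebra.
have mcyl C : cylinders C -> measurable (C : set (@configT R d)).
  exact: sub_sigma_algebra.
have step1 C2 : cylinders C2 ->
    P (cfg [:: i] @^-1` B1 `&` (cfg [:: j] @^-1` C2 `&` D)) =
    (P (cfg [:: j] @^-1` C2 `&` D) * mu B1)%E.
  move=> c2; apply: (@law_unique_scaled _ _ _ _ (@configT R d) P _ _
    (cfg [:: i]) _ mu cylinders) => //.
  - by apply: measurableI => //; exact: measurable_cfg_preimage (mcyl _ c2).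
  - exact: measurable_cfg.
  - exact: cylindersI.
  - exact: finite_meetsT.
  - by move=> C c1; exact: two.
have PD' : P (cfg [:: i] @^-1` B1 `&` D) = (P D * mu B1)%E.
  by have := step1 setT (finite_meetsT _ _); rewrite preimage_setT setTI.
rewrite setICA (@law_unique_scaled _ _ _ _ (@configT R d) P
  (cfg [:: i] @^-1` B1 `&` D) _ (cfg [:: j]) _ mu cylinders) //.
- by rewrite PD' muleA.
- by apply: measurableI => //; exact: measurable_cfg_preimage.
- exact: measurable_cfg.
- exact: cylindersI.
- exact: finite_meetsT.
- move=> C cC; rewrite setICA step1// one// PD'.
  by rewrite -muleA (muleC (mu C)) muleA.
Qed.

End root_independence.

(** * The law of the time left at the first death *)

Section exponential_law.
Context {R : realType}.
Notation leb := (@lebesgue_measure R).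

Lemma exponential_prob_Nyo (z : R) :
  exponential_prob 1 `]-oo, z[%classic =
  (if (0 < z)%R then (1 - expR (- z))%:E else 0)%E.
Proof.
have mpdf : measurable_fun [set: R] (EFin \o exponential_pdf (1 : R)).
  by apply/measurable_EFinP; exact: measurable_exponential_pdf.
case: ifPn => [z0|]; last first.
  rewrite -leNgt => z0; apply: integral0_eq => x /=.
  rewrite in_itv/= => xz; rewrite lt0_exponential_pdf//.
  exact: lt_le_trans z0.
have -> : exponential_prob 1 `]-oo, z[%classic = exponential_prob 1 `[0, z]%classic.
  rewrite /exponential_prob integral_itv_bndo_bndc; last exact: measurable_funTS.
  rewrite [LHS]integral_mkcond [RHS]integral_mkcond.
  apply: eq_integral => x _; rewrite !patchE; have [x0|x0] := ltP x 0.
    by rewrite lt0_exponential_pdf//; do 2 case: ifP.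
  suff -> : (x \in `]-oo, z]%classic) = (x \in `[0, z]%classic) by [].
  by apply/idP/idP; rewrite !inE/= !in_itv/= x0.
by rewrite exponential_prob_itv0c// mulN1r.
Qed.

Lemma measurable_exp_cut (lam t y : R) : measurable [set e : R | y < t - lam^-1 * e].
Proof.
have m : measurable_fun [set: R] (fun e : R => t - lam^-1 * e).
  by apply: measurable_funB => //; exact: measurable_funM.
have -> : [set e : R | y < t - lam^-1 * e] = [set: R] `&` (fun e : R => t - lam^-1 * e) @^-1` `]y, +oo[%classic.
  by rewrite setTI; apply/seteqP; split => e /=; rewrite in_itv/= andbT.
by apply: m.
Qed.

(** The time left, restricted to be positive, is tested on the half-lines []x, +oo[]; [Num.max x 0]
    expresses both conditions at once. *)
Lemma exponential_prob_cut (lam t x : R) : 0 < lam ->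
  exponential_prob 1 [set e : R | Num.max x 0 < t - lam^-1 * e] =
  (\int[leb]_(s in `]x, +oo[) (ekernel lam t s * \1_`[0%R, t] s)%:E)%E.
Proof.
move=> l0; set y := Num.max x 0.
have [xy y0] : x <= y /\ 0 <= y by rewrite /y !le_max !lexx orbT.
have -> : [set e : R | y < t - lam^-1 * e] = `]-oo, lam * (t - y)[%classic.
  apply/seteqP; split => e /=; rewrite in_itv/= ltrBrDl -ltrBrDr.
    by rewrite ltr_pdivrMl.
  by rewrite ltr_pdivrMl.
rewrite exponential_prob_Nyo pmulr_rgt0// subr_gt0.
have mk : measurable_fun [set: R] (EFin \o ekernel lam t).
  by apply/measurable_EFinP; exact: measurable_ekernel.
under eq_integral => s _.
  have -> : (ekernel lam t s * \1_`[0%R, t] s)%:E =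
    ((EFin \o ekernel lam t) \_ `[0%R, t]) s.
    by rewrite patchE indicE; case: ifPn => _; rewrite ?mulr1 ?mulr0.
  over.
rewrite -integral_mkcondr.
case: ifPn => [yt|]; last first.
  (* At most the point [t] remains in the domain of integration. *)
  rewrite -leNgt => ty; rewrite (@integral_Sset1 _ _ _ t)//.
  move=> s [/=]; rewrite !in_itv/= andbT => xs /andP[s0 st].
  by apply/eqP; rewrite eq_le st (le_trans ty)// /y ge_max s0 ltW.
have E : (\int[leb]_(s in `[y, t]) (EFin \o ekernel lam t) s =
    (1 - expR (- (lam * (t - y))))%:E)%E.
  by rewrite integral_ekernel ?ltW// mulNr.
have [x0|x0] := leP 0 x.
  have yx : y = x by rewrite /y max_l.
  have -> : `]x, +oo[%classic `&` `[0, t]%classic = `]x, t]%classic.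
    apply/seteqP; split => s /=; rewrite !in_itv/= ?andbT.
      by move=> [-> /andP[_ ->]].
    by move=> /andP[xs ->]; split => //; rewrite andbT ltW// (le_lt_trans x0).
  by rewrite integral_itv_obnd_cbnd -?yx//; exact: measurable_funTS.
have yx : y = 0 by rewrite /y max_r// ltW.
have -> : `]x, +oo[%classic `&` `[0, t]%classic = `[0, t]%classic.
  apply/seteqP; split => s /=; rewrite !in_itv/= ?andbT.
    by move=> [_ ->].
  by move=> /andP[s0 ->]; split => //; rewrite ?s0// (lt_le_trans x0).
by rewrite -{1}yx.
Qed.

End exponential_law.

(** * Joint law of the first death and two child configurations *)

Section first_step_law.
Context {R : realType} {d r : nat} (S : system R d r).
Context {disp : measure_display} {Omega : measurableType disp}.
Variables (P : probability Omega R) (E U : label -> {RV P >-> R})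
  (Y : label -> Zd d -> Omega -> Zd d * Zd d).
Hypothesis EUY : branching_variables S E U Y.

Let F := generated_events E U Y.
Notation mu := (config_law EUY).
Notation cfg := (cfg S E U Y).
Notation leb := (@lebesgue_measure R).
Notation root_event := (root_event S E U Y).

Lemma children_pair_law D (i j : 'I_3) X : i != j ->
  finite_meets F [set i | lab i = [::]] D -> measurable X ->
  P ((fun w => (cfg [:: i] w, cfg [:: j] w)) @^-1` X `&` D) =
  (P D * (mu \x mu) X)%E.
Proof.
move=> ij fD mX.
apply: (@law_unique_scaled _ _ _ _ (@configT R d * @configT R d)%type P D _ _ _
  [the probability _ _ of (mu \x mu)%E]
  [set A `*` B | A in measurable & B in measurable]) => //.
- exact: (finite_meets_measurable EUY fD).
- by apply/measurable_fun_pair; exact: measurable_cfg.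
- by rewrite measurable_prod_measurableType.
- move=> _ _ [A1 mA1 [B1 mB1 <-]] [A2 mA2 [B2 mB2 <-]].
  rewrite -setXI; exists (A1 `&` A2); first exact: measurableI.
  by exists (B1 `&` B2) => //; exact: measurableI.
- by exists setT => //; exists setT => //; rewrite setXTT.
- move=> _ [A mA [B mB <-]].
  rewrite -[LHS]/(P (cfg [:: i] @^-1` A `&` cfg [:: j] @^-1` B `&` D)).
  rewrite -setIA (children_independent EUY ij fD mA mB).
  by congr (_ * _)%E; rewrite /= product_measure1E.
Qed.

Let root_event3 k A1 A2 A3 : measurable A1 -> measurable A2 ->
  (P (E [::] @^-1` A1) * P (U [::] @^-1` A2) * P (Ynorm S Y [::] k @^-1` A3))%E =
  P (root_event k A1 A2 A3).
Proof.
move=> mA1 mA2.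
have fE : finite_meets F [set inl (inl [::])] (E [::] @^-1` A1).
  by apply: (@finite_meets1 _ _ F _ (inl (inl [::]))) => //; exists A1.
have fU : finite_meets F [set inl (inr [::])] (U [::] @^-1` A2).
  by apply: (@finite_meets1 _ _ F _ (inl (inr [::]))) => //; exists A2.
have fY : finite_meets F [set inr ([::], k)] (Ynorm S Y [::] k @^-1` A3).
  apply: (@finite_meets1 _ _ F _ (inr ([::], k))) => //.
  apply: (@cfg_coord_events _ _ _ S _ _ P E U Y [::] (inr ([::], k))
    [set th | A3 (th.2 [::] k)]).
  by exists A3.
have sEU : [set inl (inl [::])] `&` [set inl (inr [::])] = set0 :> set (label + label + label * Zd d).
  by apply/seteqP; split => // x [/= ->].
have sEUY : ([set inl (inl [::])] `|` [set inl (inr [::])]) `&` [set inr ([::], k)] =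
    set0 :> set (label + label + label * Zd d).
  by apply/seteqP; split => // x [[|] /= ->].
have ind := independence_EUY EUY.
rewrite /root_event (independent_finite_meets ind sEUY)//.
  by rewrite (independent_finite_meets ind sEU fE fU).
exact: finite_meets_disjointI.
Qed.

Lemma root_event_split k A1 A2 A3 : measurable A1 -> measurable A2 ->
  P (root_event k A1 A2 A3) =
  (exponential_prob 1 A1 * P (root_event k setT A2 A3))%E.
Proof.
move=> mA1 mA2; rewrite -root_event3// -root_event3//.
rewrite preimage_setT probability_setT mul1e -muleA.
by congr (_ * _)%E; exact: (law_E EUY [::] mA1).
Qed.

Lemma root_event_prob k A2 A3 : measurable A2 ->
  P (root_event k setT A2 A3) =
  (uniform_prob (@ltr01 R) A2 * P (Ynorm S Y [::] k @^-1` A3))%E.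
Proof.
move=> mA2; rewrite -root_event3// preimage_setT probability_setT mul1e.
by congr (_ * _)%E; exact: (law_U EUY [::] mA2).
Qed.

Section fixed_root.
Variables (k : Zd d) (t : R) (A2 : set R) (A3 : set (Zd d * Zd d)).
Hypothesis mA2 : measurable A2.

(** To be read as a remaining time on [jump_event], where it is positive. *)
Definition jump_time (w : Omega) : R := t - (lam S k)^-1 * E [::] w.
Definition jump_event : set Omega :=
  root_event k [set e | 0 < t - (lam S k)^-1 * e] A2 A3.
Let p0 : R := fine (P (root_event k setT A2 A3)).

Lemma jump_eventE : jump_event =
  [set w | 0 < jump_time w] `&` root_event k setT A2 A3.
Proof.
by apply/seteqP; split => w; rewrite /jump_event /root_event /jump_time/= => -[]; tauto.
Qed.

Lemma measurable_jump_time :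
  @measurable_fun _ _ Omega (measurableTypeR R) [set: Omega] jump_time.
Proof. by apply: measurable_funB => //; exact: measurable_funM. Qed.

Lemma measurable_jump_event : measurable jump_event.
Proof.
apply: (finite_meets_measurable EUY).
exact: (root_event_finite_meets S E U Y k A3 (measurable_exp_cut _ _ _) mA2).
Qed.

Let dens (s : R) : R := p0 * (ekernel (lam S k) t s * \1_`[0, t] s).

Let dens_ge0 s : 0 <= dens s.
Proof.
by rewrite mulr_ge0// ?fine_ge0// mulr_ge0// ekernel_ge0// lam_gt0.
Qed.

Let mdens : measurable_fun [set: R] dens.
Proof.
by apply: measurable_funM => //; apply: measurable_funM => //; exact: measurable_ekernel.
Qed.

(** Both sides are finite measures that agree on the half-lines []x, +oo[]. The clock of the root is
    independent of its mark and offspring, which contribute the factor [p0]. *)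
Lemma jump_time_law (A : set (measurableTypeR R)) : measurable A ->
  P (jump_time @^-1` A `&` jump_event) = (\int[leb]_(s in A) (dens s)%:E)%E.
Proof.
move=> mA.
rewrite -[LHS]/(restricted_law P jump_event (jump_time : Omega -> measurableTypeR R) A).
rewrite -[RHS]/(density_measure leb dens A).
apply: (@measure_unique _ R (measurableTypeR R) (@RGenOInfty.G R)
  (fun n => `](- n%:R), +oo[%classic) (@RGenOInfty.measurableE R) _ _ _
  (restricted_law P jump_event (jump_time : Omega -> measurableTypeR R))
  (density_measure leb dens)) => //.
- move=> _ _ [x ->] [y ->]; exists (Num.max x y).
  apply/seteqP; split => s /=; rewrite !in_itv/= !andbT gt_max.
    by move=> [-> ->].
  by move=> /andP[-> ->].
- by move=> n; exists (- n%:R).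
- apply/seteqP; split => // x _; exists (Num.Def.trunc `|x|).+1 => //=.
  rewrite in_itv/= andbT ltrNl; apply: le_lt_trans (ler_norm _) _.
  by rewrite normrN; have /andP[] := truncn_itv (normr_ge0 x).
- exact: measurable_jump_event.
- exact: measurable_jump_time.
- move=> h1 h2 _ [x ->].
  transitivity (P (jump_time @^-1` `]x, +oo[%classic `&` jump_event)); first by [].
  transitivity (\int[leb]_(s in `]x, +oo[) (dens s)%:E)%E; last by [].
  have -> : jump_time @^-1` `]x, +oo[%classic `&` jump_event =
    root_event k [set e | Num.max x 0 < t - (lam S k)^-1 * e] A2 A3.
    rewrite /jump_event /root_event /jump_time; apply/seteqP; split => w /=.
      by rewrite in_itv/= andbT gt_max => -[-> [[-> ?] ?]].
    by rewrite in_itv/= andbT gt_max => -[[/andP[-> ->] ?] ?].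
  rewrite root_event_split//; last exact: measurable_exp_cut.
  rewrite exponential_prob_cut ?lam_gt0//.
  under [RHS]eq_integral do rewrite EFinM.
  rewrite ge0_integralZl//; last 3 first.
  + apply: measurable_funTS; apply/measurable_EFinP.
    by apply: measurable_funM => //; exact: measurable_ekernel.
  + by move=> s _; rewrite lee_fin mulr_ge0// ekernel_ge0// lam_gt0.
  + by rewrite lee_fin fine_ge0.
  rewrite muleC fineK// fin_num_measure//.
  apply: (finite_meets_measurable EUY).
  exact: (root_event_finite_meets S E U Y k A3 measurableT mA2).
- move=> h1 h2 n; apply: (@le_lt_trans _ _ 1%E); last exact: ltry.
  apply: probability_le1; apply: measurableI; last exact: measurable_jump_event.
  by rewrite -[X in measurable X]setTI; exact: measurable_jump_time.
Qed.

Let measurable_jump_children (i j : 'I_3) :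
  measurable_fun [set: Omega] (fun w => (jump_time w : measurableTypeR R,
    (cfg [:: i] w, cfg [:: j] w))).
Proof.
apply/measurable_fun_pair; first exact: measurable_jump_time.
by apply/measurable_fun_pair; exact: measurable_cfg.
Qed.

Let mm : probability (@configT R d * @configT R d)%type R := (mu \x mu)%E.

(** On rectangles this is [children_pair_law], the condition on the time left being absorbed into
    the set [A1] of admissible clock values. *)
Let jump_law (i j : 'I_3)
    (X : set (measurableTypeR R * (@configT R d * @configT R d))%type) :
  i != j -> measurable X ->
  restricted_law_measure P measurable_jump_event (measurable_jump_children i j) X =
  (restricted_law_measure P measurable_jump_event measurable_jump_time \x mm)%E X.
Proof.
move=> ij mX; apply/esym.
apply: (product_measure_unique (m1 := restricted_law_measure P
  measurable_jump_event measurable_jump_time) (m2 := mm)) => //.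
move=> A B mA mB; rewrite /restricted_law_measure /= /restricted_law.
pose A1 := [set e : R | 0 < t - (lam S k)^-1 * e] `&`
  (fun e : R => t - (lam S k)^-1 * e) @^-1` A.
have mA1 : measurable A1.
  apply: measurableI; first exact: measurable_exp_cut.
  rewrite -[X in measurable X]setTI.
  have m : measurable_fun [set: R] (fun e : R => t - (lam S k)^-1 * e).
    by apply: measurable_funB => //; exact: measurable_funM.
  exact: m.
have fD := root_event_finite_meets S E U Y k A3 mA1 mA2.
have e1 : jump_time @^-1` A `&` jump_event = root_event k A1 A2 A3.
  apply/seteqP; split => w; rewrite /jump_event /root_event /jump_time /=.
    by move=> [? [[? ?] ?]].
  by move=> [[[? ?] ?] ?].
rewrite e1 -(children_pair_law ij fD mB); congr (P _).
by rewrite -e1 setICA setIA; apply/seteqP; split => w /=; tauto.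
Qed.

(** Both factors are read at the same random time, so Tonelli is applied in two stages: once the
    time is fixed, the mean over the two independent configurations factors. *)
Lemma jump_ge0_integral (i j : 'I_3)
    (f g : (measurableTypeR R * @configT R d)%type -> \bar R) : i != j ->
  measurable_fun [set: _] f -> measurable_fun [set: _] g ->
  (forall z, 0 <= f z)%E -> (forall z, 0 <= g z)%E ->
  (\int[P]_(w in jump_event) (f (jump_time w, cfg [:: i] w) *
                              g (jump_time w, cfg [:: j] w)) =
   P (root_event k setT A2 A3) * \int[leb]_(s in `[0%R, t])
     ((ekernel (lam S k) t s)%:E *
      (\int[mu]_x f (s, x) * \int[mu]_x g (s, x))))%E.
Proof.
move=> ij mf mg f0 g0.
pose h (z : (measurableTypeR R * (@configT R d * @configT R d))%type) :=
  (f (z.1, z.2.1) * g (z.1, z.2.2))%E.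
have mh : measurable_fun [set: _] h.
  apply: emeasurable_funM.
    apply: measurableT_comp => //; apply/measurable_fun_pair => //.
    exact: measurableT_comp.
  apply: measurableT_comp => //; apply/measurable_fun_pair => //.
  exact: measurableT_comp.
have h0 z : (0 <= h z)%E by exact: mule_ge0.
transitivity (\int[restricted_law_measure P measurable_jump_event
    (measurable_jump_children i j)]_z h z)%E.
  apply/esym; exact: (@ge0_integral_restricted_law _ _ _ _ _ P _
    measurable_jump_event _ (measurable_jump_children i j) h mh h0).
rewrite (eq_measure_integral (restricted_law_measure P measurable_jump_event
  measurable_jump_time \x mm)%E); last first.
  by move=> A mA _; exact: jump_law.
rewrite fubini_tonelli1//.
have mF : measurable_fun [set: measurableTypeR R] (fun s => \int[mu]_x f (s, x))%E.
  exact: measurable_fun_fubini_tonelli_F.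
have mG : measurable_fun [set: measurableTypeR R] (fun s => \int[mu]_x g (s, x))%E.
  exact: measurable_fun_fubini_tonelli_F.
transitivity (\int[restricted_law_measure P measurable_jump_event
    measurable_jump_time]_s (\int[mu]_x f (s, x) * \int[mu]_x g (s, x)))%E.
  apply: eq_integral => s _; rewrite /fubini_F.
  have mfs : measurable_fun [set: @configT R d] (fun x => f (s, x)).
    by apply: measurableT_comp => //; exact: measurable_pair1.
  have mgs : measurable_fun [set: @configT R d] (fun x => g (s, x)).
    by apply: measurableT_comp => //; exact: measurable_pair1.
  rewrite (fubini_tonelli1 (fun y : (@configT R d * @configT R d)%type => h (s, y)))//.
    rewrite /fubini_F /h/=.
    under eq_integral => x _ do rewrite ge0_integralZl//.
    by rewrite ge0_integralZr// integral_ge0.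
  by apply: measurableT_comp => //; exact: measurable_pair1.
rewrite (@ge0_integral_density _ _ _ leb _ dens)//; last 3 first.
- by move=> A mA; rewrite -jump_time_law.
- exact: emeasurable_funM.
- by move=> s; rewrite mule_ge0// integral_ge0.
have PE : P (root_event k setT A2 A3) = p0%:E.
  rewrite /p0 fineK// fin_num_measure//; apply: (finite_meets_measurable EUY).
  exact: (root_event_finite_meets S E U Y k A3 measurableT mA2).
rewrite PE -ge0_integralZl//; last 3 first.
- apply: emeasurable_funM; last exact: measurable_funTS (emeasurable_funM mF mG).
  by apply/measurable_EFinP; exact: measurable_ekernel.
- move=> s _; apply: mule_ge0; first by rewrite lee_fin ekernel_ge0// lam_gt0.
  by apply: mule_ge0; exact: integral_ge0.
- by rewrite lee_fin fine_ge0.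
rewrite [RHS]integral_mkcond; apply: eq_integral => s _.
rewrite patchE /dens indicE; case: ifPn => _.
  by rewrite mulr1 EFinM muleC !muleA.
by rewrite mulr0 mulr0 mule0.
Qed.

End fixed_root.
End first_step_law.

(** * Joint measurability of the evaluation in time and configuration *)

Section measurable_tools.
Context {disp disp' : measure_display} {X : measurableType disp} {Z : measurableType disp'}.

Lemma measurable_fun_if_mem (A : set X) (g h : X -> Z) : measurable A ->
  measurable_fun [set: X] g -> measurable_fun [set: X] h ->
  measurable_fun [set: X] (fun x => if x \in A then g x else h x).
Proof.
move=> mA mg mh; apply: measurable_fun_ifT => //.
apply: (measurable_fun_bool true); rewrite setTI.
rewrite (_ : _ @^-1` _ = A)//; apply/seteqP; split => x /=; first exact: set_mem.
exact: mem_set.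
Qed.

(** Serves to insert the random offspring sites into a family that is measurable for each fixed pair
    of sites. *)
Lemma measurable_fun_countable_index (I : countType) (f : X -> I) (g : I -> X -> Z) :
  (forall i, measurable (f @^-1` [set i])) ->
  (forall i, measurable_fun [set: X] (g i)) ->
  measurable_fun [set: X] (fun x => g (f x) x).
Proof.
move=> mf mg _ B mB; rewrite setTI.
have -> : (fun x => g (f x) x) @^-1` B = \bigcup_i (f @^-1` [set i] `&` g i @^-1` B).
  apply/seteqP; split => [x /= Bx|x [i _ [/= <- //]]].
  by exists (f x).
apply: countable_bigcupT_measurable => [|i]; first exact: countableP.
by apply: measurableI => //; rewrite -[_ @^-1` _]setTI; exact: mg.
Qed.

End measurable_tools.

Section regions.
Context {R : realType} {d r : nat} (S : system R d r).

Lemma measurable_flip_region k : measurable (flip_region S k).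
Proof.
rewrite (_ : flip_region S k = `[0, pr S k]%classic `&` ~` `[1 - qtot S k, 1]%classic).
  by apply: measurableI => //; exact: measurableC.
apply/seteqP; split => u; rewrite /flip_region/= !in_itv/=.
  by case/andP => ? /negP.
by case=> ? /negP ?; apply/andP.
Qed.

Lemma measurable_branch_region k : measurable (branch_region S k).
Proof.
rewrite (_ : branch_region S k = ~` `[0, pr S k]%classic `&` `[1 - qtot S k, 1]%classic).
  by apply: measurableI => //; exact: measurableC.
apply/seteqP; split => u; rewrite /branch_region/= !in_itv/=.
  by case/andP => /negP.
by case=> /negP ? ?; apply/andP.
Qed.

Lemma measurable_death_region k : measurable (death_region S k).
Proof.
rewrite (_ : death_region S k = ~` `[0, pr S k]%classic `&` ~` `[1 - qtot S k, 1]%classic).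
  by apply: measurableI => //; exact: measurableC.
apply/seteqP; split => u; rewrite /death_region/= !in_itv/=.
  by case/andP => /negP ? /negP.
by case=> /negP ? /negP ?; apply/andP.
Qed.

End regions.

Section measurable_evaluation.
Context {R : realType} {d r : nat} (S : system R d r).
Variables (chi0 : Zd d -> Cr R r) (gamma : Zd d -> R -> Cr R r).
Hypothesis mgamma : forall c k, measurable_fun [set: R] (fun t => rcoord c (gamma k t)).

Definition config_tree (k : Zd d) (th : @configT R d) : tree R d :=
  branching_tree S (fun a (th : @configT R d) => th.1.1 a) (fun a th => th.1.2 a)
    (fun a k th => th.2 a k) k th.

(** Induction on the fuel through [evaln_first_step]: a case distinction over measurable conditions,
    in which the recursive values are earlier ones composed with the new time and the shifted
    configuration. *)
Lemma measurable_evaln n k c :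
  measurable_fun [set: (measurableTypeR R * @configT R d)%type]
    (fun z => rcoord c (evaln S chi0 gamma n z.1 (config_tree k z.2))).
Proof.
elim: n k c => [|n ih] k c.
  rewrite (_ : (fun _ => _) = cst 0) //.
  by apply/funext => z /=; rewrite rcoord0.
pose XX := (measurableTypeR R * @configT R d)%type.
pose s (z : XX) : R := z.1 - (lam S k)^-1 * z.2.1.1 [::].
have ms : measurable_fun [set: XX] (s : XX -> measurableTypeR R).
  apply: measurable_funB; first exact: measurable_fst.
  apply: measurable_funM => //.
  by apply: (measurableT_comp (measurable_cfgE [::])); exact: measurable_snd.
have mu_ : measurable_fun [set: XX] (fun z : XX => z.2.1.2 [::]).
  by apply: (measurableT_comp (measurable_cfgU [::])); exact: measurable_snd.
have reg (A : set R) : measurable A -> measurable [set z : XX | A (z.2.1.2 [::])].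
  by move=> mA; rewrite -[X in measurable X]setTI; exact: mu_.
have sub i l c' : measurable_fun [set: XX]
    (fun z => rcoord c' (evaln S chi0 gamma n (s z)
       (config_tree l (shift_config [:: i] z.2)))).
  apply: (@measurableT_comp _ _ _ _ _ _ _ _ (fun z : XX => (s z, shift_config [:: i] z.2)) (ih l c')).
  apply/measurable_fun_pair => //.
  by apply: measurableT_comp; [exact: measurable_shift_config|exact: measurable_snd].
pose G (z : XX) := if z \in [set z | s z <= 0] then rcoord c (chi0 k)
  else if z \in [set z : XX | flip_region S k (z.2.1.2 [::])] then
    Cf S * rcoord c (evaln S chi0 gamma n (s z) (config_tree k (shift_config [:: o0] z.2)))
  else if z \in [set z : XX | branch_region S k (z.2.1.2 [::])] then
    Cb S * rcoord c (B S k (z.2.2 [::] k).1 (z.2.2 [::] k).2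
      (evaln S chi0 gamma n (s z) (config_tree (z.2.2 [::] k).1 (shift_config [:: o1] z.2)))
      (evaln S chi0 gamma n (s z) (config_tree (z.2.2 [::] k).2 (shift_config [:: o2] z.2))))
  else if z \in [set z : XX | death_region S k (z.2.1.2 [::])] then
    rcoord c (gamma k (s z)) else 0.
rewrite (_ : (fun _ => _) = G); last first.
  apply/funext => z; rewrite /config_tree evaln_first_step /first_step /G.
  have memE (A : set R) : (z \in [set z : XX | A (z.2.1.2 [::])]) = (z.2.1.2 [::] \in A).
    by apply/idP/idP; rewrite !inE.
  rewrite !memE.
  have -> : (z \in [set z | s z <= 0]) = (s z <= 0) by apply/idP/idP; rewrite inE.
  rewrite -/(s z); case: ifP => // _.
  case: ifP => // _; first by rewrite rcoordZ.
  case: ifP => // _; first by rewrite rcoordZ.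
  by case: ifP => // _; rewrite rcoord0.
apply: measurable_fun_if_mem => //.
  rewrite -[X in measurable X]setTI.
  have -> : [set z | s z <= 0] = s @^-1` `]-oo, 0]%classic.
    by apply/seteqP; split => z /=; rewrite in_itv.
  exact: ms.
apply: measurable_fun_if_mem; first by apply: reg; exact: measurable_flip_region.
  by apply: measurable_funM => //; exact: sub.
apply: measurable_fun_if_mem; first by apply: reg; exact: measurable_branch_region.
  apply: measurable_funM => //.
  apply: (@measurable_fun_countable_index _ _ XX _ (Zd d * Zd d)%type
    (fun z => z.2.2 [::] k) (fun lm z => rcoord c (B S k lm.1 lm.2
      (evaln S chi0 gamma n (s z) (config_tree lm.1 (shift_config [:: o1] z.2)))
      (evaln S chi0 gamma n (s z) (config_tree lm.2 (shift_config [:: o2] z.2)))))).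
    move=> lm; rewrite -[X in measurable X]setTI.
    exact: (measurable_snd measurableT _ (measurable_cfgY [::] k [set lm])).
  move=> lm; apply: measurable_bilinear => c'; exact: sub.
apply: measurable_fun_if_mem; first by apply: reg; exact: measurable_death_region.
  by apply: (measurableT_comp (mgamma c k)); exact: ms.
exact: measurable_cst.
Qed.

Lemma measurable_evalR k c :
  measurable_fun [set: (measurableTypeR R * @configT R d)%type]
    (fun z => rcoord c (evalR S chi0 gamma z.1 (config_tree k z.2))).
Proof.
apply: (measurable_fun_cvg (fun n => measurable_evaln n k c)).
move=> z _.
have [N hN] := evaln_eventually S chi0 gamma z.1 (config_tree k z.2).
apply: cvg_near_cst; exists N => // n /= Nn; by rewrite hN.
Qed.

End measurable_evaluation.

(** * Replacement of the evaluation off a null event *)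

Section integral_off_null.
Context {R : realType} {disp : measure_display} {X : measurableType disp}.
Variables (m : {measure set X -> \bar R}) (N : set X).
Hypotheses (mN : measurable N) (N0 : m N = 0%E).
Local Open Scope ereal_scope.

Import HBNNSimple.

(** The integral of a nonnegative function is a supremum over simple functions below it. A simple
    function below [f], set to 0 on [N], lies below [g] and keeps its integral. *)
Let le_ge0_integral_off_null (f g : X -> \bar R) :
  (forall x, 0 <= f x) -> (forall x, 0 <= g x) ->
  (forall x, ~ N x -> f x = g x) -> \int[m]_x f x <= \int[m]_x g x.
Proof.
move=> f0 g0 fg; rewrite !ge0_integralTE//.
apply: ge_ereal_sup => _ [h /= hf <-].
apply: ereal_sup_ubound; exists (proj_nnsfun h (measurableC mN)) => /=.
  move=> x; rewrite /mindic indicE in_setC.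
  by case: (boolP (x \in N)) => [_|/negP Nx]; rewrite ?mulr0// mulr1 -fg// => /mem_set.
rewrite -!integralT_nnsfun; apply: ge0_ae_eq_integral => //.
- by apply/measurable_EFinP; exact: measurable_funP.
- by apply/measurable_EFinP; exact: measurable_funP.
- by move=> x _; rewrite lee_fin.
- by move=> x _; rewrite lee_fin.
exists N; split => // x /= /not_implyP[_ h1]; apply: contrapT => Nx.
by apply: h1; rewrite /= /mindic indicE in_setC memNset// mulr1.
Qed.

(* No measurability of [f] and [g] is needed: [evalR] may fail to be
   measurable on a null event. *)
Lemma integral_off_null (f g : X -> \bar R) :
  (forall x, ~ N x -> f x = g x) -> \int[m]_x f x = \int[m]_x g x.
Proof.
move=> fg; rewrite integralE [RHS]integralE.
congr (_ - _); apply/eqP; rewrite eq_le; apply/andP; split;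
  apply: le_ge0_integral_off_null => x //; rewrite ?funeposE ?funenegE => Nx;
  by rewrite fg.
Qed.

End integral_off_null.

Section almost_sure_replacement.
Context {R : realType} {d r : nat} (S : system R d r).
Variables (chi0 : Zd d -> Cr R r) (gamma : Zd d -> R -> Cr R r) (T : R).

(* Outside [0, T] nothing is assumed on [gamma], not even measurability. *)
Definition gamma_cut (k : Zd d) (t : R) : Cr R r :=
  if t \in `[0, T]%classic then gamma k t else 0.

(** With nonnegative clocks the time left never exceeds [T], and [gamma] is read at positive times,
    so the cut is invisible. With uniform draws below 1 a branch requires [qtot] to be positive, so
    [Y] is never read where its law is arbitrary. *)
Lemma evaln_gamma_cut n t k (th th' : @configT R d) :
  t <= T -> th.1 = th'.1 ->
  (forall a k, 0 < qtot S k -> th.2 a k = th'.2 a k) ->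
  (forall a, 0 <= th.1.1 a) -> (forall a, th.1.2 a < 1) ->
  evaln S chi0 gamma n t (config_tree S k th) =
  evaln S chi0 gamma_cut n t (config_tree S k th').
Proof.
elim: n t k th th' => [//|n ih] t k [[e u] y] [eu' y'] tT e1.
have {e1} e1 : eu' = (e, u) by exact: esym e1.
subst eu' => yy' e0 u1.
rewrite /config_tree (evaln_first_step S chi0 gamma) (evaln_first_step S chi0 gamma_cut).
rewrite /first_step; case: ifPn => // s0.
set s := t - _ in s0 *.
have l0 : 0 < (lam S k)^-1 by rewrite invr_gt0 lam_gt0.
have sT : s <= T by rewrite /s; have := e0 [::]; nra.
have sub i l : evaln S chi0 gamma n s (config_tree S l (shift_config [:: i] ((e, u), y))) =
  evaln S chi0 gamma_cut n s (config_tree S l (shift_config [:: i] ((e, u), y'))).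
  apply: ih => //=.
  - by move=> a k' q0; exact: yy'.
case: ifPn => // _; first by rewrite (sub o0).
case: ifPn => [ub|_].
  have q0 : 0 < qtot S k.
    move: ub; rewrite inE /branch_region/= => /andP[_ /andP[qu _]].
    by have := le_lt_trans qu (u1 [::]); rewrite ltrBlDr ltrDl.
  by rewrite -(yy' [::] k q0) (sub o1) (sub o2).
case: ifPn => // _; rewrite /gamma_cut mem_set//= in_itv/=.
by rewrite -ltNge in s0; rewrite ltW.
Qed.

Lemma evalR_gamma_cut t k (th th' : @configT R d) :
  t <= T -> th.1 = th'.1 ->
  (forall a k, 0 < qtot S k -> th.2 a k = th'.2 a k) ->
  (forall a, 0 <= th.1.1 a) -> (forall a, th.1.2 a < 1) ->
  evalR S chi0 gamma t (config_tree S k th) =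
  evalR S chi0 gamma_cut t (config_tree S k th').
Proof.
move=> tT e1 e2 e0 u1.
have [N hN] := evaln_eventually S chi0 gamma t (config_tree S k th).
have [N' hN'] := evaln_eventually S chi0 gamma_cut t (config_tree S k th').
rewrite -(hN (N + N')%N) ?leq_addr// -(hN' (N + N')%N) ?leq_addl//.
exact: evaln_gamma_cut.
Qed.

Context {disp : measure_display} {Omega : measurableType disp}.
Variables (P : probability Omega R) (E U : label -> {RV P >-> R})
  (Y : label -> Zd d -> Omega -> Zd d * Zd d).
Hypothesis EUY : branching_variables S E U Y.

(** The outcomes that violate the sign conditions of [evaln_gamma_cut] at some label; null because
    there are countably many labels. *)
Definition bad_event : set Omega :=
  \bigcup_a (E a @^-1` `]-oo, 0[%classic `|` U a @^-1` `[1, +oo[%classic).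

Lemma measurable_bad_event : measurable bad_event.
Proof.
apply: countable_bigcupT_measurable => [|a]; first exact: countableP.
by apply: measurableU; rewrite -[X in measurable X]setTI; exact: measurable_funP.
Qed.

Lemma bad_event0 : P bad_event = 0%E.
Proof.
have null a : P (E a @^-1` `]-oo, 0[%classic `|` U a @^-1` `[1, +oo[%classic) = 0%E.
  rewrite measureU0.
  - apply: (etrans (law_E EUY a (measurable_itv _))).
    by rewrite exponential_prob_Nyo ltxx.
  - by rewrite -[X in measurable X]setTI; exact: measurable_funP.
  - by rewrite -[X in measurable X]setTI; exact: measurable_funP.
  - apply: (etrans (law_U EUY a (measurable_itv _))).
    rewrite /uniform_prob integral_uniform_pdf.
    apply: (@integral_Sset1 _ _ _ 1) => x [/=].
    by rewrite !in_itv/= andbT => h1 /andP[_ h2]; apply/eqP; rewrite eq_le h1 h2.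
pose B (n : nat) : set Omega := if unpickle n is Some a then
  E a @^-1` `]-oo, 0[%classic `|` U a @^-1` `[1, +oo[%classic else set0.
apply: (proj1 (negligibleP P measurable_bad_event)).
have -> : bad_event = \bigcup_n B n.
  apply/seteqP; split => [w [a _ h]|w [n _]].
    by exists (pickle a) => //; rewrite /B pickleK.
  by rewrite /B; case: unpickle => [a h|//]; exists a.
apply: negligible_bigcup => n; rewrite /B; case: unpickle => [a|].
  apply/negligibleP; last exact: null.
  by apply: measurableU; rewrite -[X in measurable X]setTI; exact: measurable_funP.
exact: negligible_set0.
Qed.

Lemma evalR_cfg t k w : t <= T -> ~ bad_event w ->
  evalR S chi0 gamma t (branching_tree S E U Y k w) =
  evalR S chi0 gamma_cut t (config_tree S k (cfg S E U Y [::] w)).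
Proof.
move=> tT good.
have E0 a : 0 <= E a w.
  rewrite leNgt; apply/negP => h; apply: good; exists a => //; left.
  by rewrite /= in_itv/= h.
have U1 a : U a w < 1.
  rewrite ltNge; apply/negP => h; apply: good; exists a => //; right.
  by rewrite /= in_itv/= h.
pose th : @configT R d := ((fun a => E a w, fun a => U a w), fun a k => Y a k w).
rewrite -[branching_tree S E U Y k w]/(config_tree S k th).
apply: evalR_gamma_cut => //.
by move=> a k' q0 /=; rewrite /Ynorm q0.
Qed.

End almost_sure_replacement.

(** * Expectations of products evaluated at the first death *)

Section first_step_expectation.
Context {R : realType} {d r : nat} (S : system R d r).
Context {disp : measure_display} {Omega : measurableType disp}.
Variables (P : probability Omega R) (E U : label -> {RV P >-> R})
  (Y : label -> Zd d -> Omega -> Zd d * Zd d).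
Hypothesis EUY : branching_variables S E U Y.

Notation mu := (config_law EUY).
Notation cfg := (cfg S E U Y).
Notation leb := (@lebesgue_measure R).
Notation state := (measurableTypeR R * @configT R d)%type.

Definition config_mean (h : state -> R) (s : R) : R := \int[mu]_x h (s, x).

(** The bound holds for almost every time because one of the functions in question is the
    forcing. *)
Definition config_bounded (t C : R) (h : state -> R) :=
  {ae leb, forall s : R, s \in `[0, t] -> (\int[mu]_x `|h (s, x)|%:E <= C%:E)%E}.

Lemma measurable_config_section (h : state -> R) (s : R) :
  measurable_fun [set: state] h -> measurable_fun [set: @configT R d] (fun x => h (s, x)).
Proof. by move=> mh; apply: measurableT_comp => //; exact: measurable_pair1. Qed.

(** Tonelli makes the integrals of the two parts measurable in time, and the integral is their
    difference by definition; times at which [h] fails to be integrable are thus covered. *)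
Lemma measurable_config_mean (h : state -> R) :
  measurable_fun [set: state] h -> measurable_fun [set: measurableTypeR R] (config_mean h).
Proof.
move=> mh.
have me : measurable_fun [set: state] (EFin \o h) by exact/measurable_EFinP.
pose hp z := ((EFin \o h)^\+ z)%E; pose hn z := ((EFin \o h)^\- z)%E.
have mhp : measurable_fun [set: state] hp by exact: measurable_funepos.
have mhn : measurable_fun [set: state] hn by exact: measurable_funeneg.
have hp0 z : (0 <= hp z)%E by exact: funepos_ge0.
have hn0 z : (0 <= hn z)%E by exact: funeneg_ge0.
have mp : measurable_fun [set: measurableTypeR R] (fun s => \int[mu]_x hp (s, x))%E.
  exact: measurable_fun_fubini_tonelli_F.
have mn : measurable_fun [set: measurableTypeR R] (fun s => \int[mu]_x hn (s, x))%E.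
  exact: measurable_fun_fubini_tonelli_F.
have hE : (fun s => \int[mu]_x (h (s, x))%:E)%E =
    (fun s => \int[mu]_x hp (s, x) - \int[mu]_x hn (s, x))%E.
  apply/funext => s; rewrite [LHS]integralE; congr (_ - _)%E;
    by apply: eq_integral => x _; rewrite /hp /hn ?funeposE ?funenegE.
have mF := emeasurable_funB mp mn; rewrite -hE in mF.
exact: (@measurableT_comp _ _ _ _ _ _ _ _ _ _ mF).
Qed.

Lemma config_integrable (h : state -> R) s C : measurable_fun [set: state] h ->
  (\int[mu]_x `|h (s, x)|%:E <= C%:E)%E ->
  mu.-integrable [set: @configT R d] (EFin \o (fun x => h (s, x))).
Proof.
move=> mh hC; apply/integrableP; split.
  by apply/measurable_EFinP; exact: measurable_config_section.
by apply: le_lt_trans hC (ltry _).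
Qed.

Lemma config_mean_norm (h : state -> R) s C : measurable_fun [set: state] h ->
  (\int[mu]_x `|h (s, x)|%:E <= C%:E)%E -> `|config_mean h s| <= C.
Proof.
move=> mh hC; have ih := config_integrable mh hC.
rewrite -lee_fin EFin_normr_Rintegral//; apply: le_trans hC.
exact: (le_abse_integral _ measurableT (measurable_int _ ih)).
Qed.

Section fixed_jump.
Variables (k : Zd d) (t : R) (A2 : set R) (A3 : set (Zd d * Zd d)).
Hypotheses (t0 : 0 <= t) (mA2 : measurable A2).
Variables (i j : 'I_3).
Hypothesis ij : i != j.

Notation J := (jump_event S E U Y k t A2 A3).
Notation jt := (jump_time S E k t).
Notation ker := (ekernel (lam S k) t).
Let p := fine (P (root_event S E U Y k [set: R] A2 A3)).

Let root_fine : P (root_event S E U Y k [set: R] A2 A3) = p%:E.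
Proof.
rewrite /p fineK// fin_num_measure//; apply: (finite_meets_measurable EUY).
exact: (root_event_finite_meets S E U Y k A3 measurableT mA2).
Qed.

Let p0 : 0 <= p. Proof. exact: fine_ge0. Qed.

Let measurable_at_jump (f : state -> R) v : measurable_fun [set: state] f ->
  measurable_fun [set: Omega] (fun w => f (jt w, cfg v w)).
Proof.
move=> mf; apply: measurableT_comp => //; apply/measurable_fun_pair.
  exact: measurable_jump_time.
exact: measurable_cfg.
Qed.

Lemma jump_mean_integrable (f g : state -> R) C1 C2 :
  measurable_fun [set: state] f -> measurable_fun [set: state] g ->
  0 <= C1 -> 0 <= C2 -> config_bounded t C1 f -> config_bounded t C2 g ->
  leb.-integrable `[0, t]
    (EFin \o (fun s => ker s * (config_mean f s * config_mean g s))) /\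
  `|\int[leb]_(s in `[0, t]) (ker s * (config_mean f s * config_mean g s))| <= C1 * C2.
Proof.
move=> mf mg C10 C20 bf bg.
apply: (@ekernel_bounded _ _ _ _ (fun s => config_mean f s * config_mean g s)) => //.
- exact: lam_gt0.
- exact: mulr_ge0.
- by apply: measurable_funTS; apply: measurable_funM; exact: measurable_config_mean.
- apply: ae_imp2 bf bg => s hf hg st; rewrite normrM ler_pM//.
    by apply: config_mean_norm => //; exact: hf.
  by apply: config_mean_norm => //; exact: hg.
Qed.

(** Translates [jump_ge0_integral] into real integrals: the inner means are finite at almost every
    time, and the exceptional times form a null set. *)
Let jump_pos (f g : state -> R) C1 C2 :
  measurable_fun [set: state] f -> measurable_fun [set: state] g ->
  (forall z, 0 <= f z) -> (forall z, 0 <= g z) ->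
  0 <= C1 -> 0 <= C2 -> config_bounded t C1 f -> config_bounded t C2 g ->
  (\int[P]_(w in J) (f (jt w, cfg [:: i] w) * g (jt w, cfg [:: j] w))%:E =
   (p * \int[leb]_(s in `[0%R, t]) (ker s * (config_mean f s * config_mean g s)))%:E)%E.
Proof.
move=> mf mg f0 g0 C10 C20 bf bg.
have [iFG _] := jump_mean_integrable mf mg C10 C20 bf bg.
transitivity (\int[P]_(w in J) ((EFin \o f) (jt w, cfg [:: i] w) *
   (EFin \o g) (jt w, cfg [:: j] w)))%E.
  by apply: eq_integral => w _; rewrite EFinM.
rewrite (jump_ge0_integral EUY k t A3 mA2 ij); last 4 first.
- exact/measurable_EFinP.
- exact/measurable_EFinP.
- by move=> z; rewrite lee_fin.
- by move=> z; rewrite lee_fin.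
rewrite root_fine EFinM; congr (_ * _)%E.
rewrite /Rintegral fineK; last exact: integrable_fin_num.
have ne (h : state -> R) s : (forall z, 0 <= h z) ->
    (\int[mu]_x `|h (s, x)|%:E = \int[mu]_x (h (s, x))%:E)%E.
  by move=> h0; apply: eq_integral => x _; rewrite ger0_norm.
have fin (h : state -> R) C s : (forall z, 0 <= h z) ->
    (\int[mu]_x `|h (s, x)|%:E <= C%:E)%E ->
    (\int[mu]_x (h (s, x))%:E = (config_mean h s)%:E)%E.
  move=> h0; rewrite ne// => hC; rewrite /config_mean /Rintegral fineK//.
  rewrite ge0_fin_numE ?(le_lt_trans hC) ?ltry//.
  by apply: integral_ge0 => x _; rewrite lee_fin.
apply: ae_eq_integral => //.
- apply: emeasurable_funM.
    by apply/measurable_EFinP; exact: measurable_ekernel.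
  apply: measurable_funTS; apply: emeasurable_funM.
    apply: (@measurable_fun_fubini_tonelli_F _ _ _ _ _ mu (EFin \o f)) => //.
    exact/measurable_EFinP.
  apply: (@measurable_fun_fubini_tonelli_F _ _ _ _ _ mu (EFin \o g)) => //.
  exact/measurable_EFinP.
- exact: measurable_int iFG.
- apply: (ae_imp2 _ bf bg) => s hf hg st /=.
  by rewrite (fin _ _ _ f0 (hf st)) (fin _ _ _ g0 (hg st)) !EFinM.
Qed.

Lemma jump_abs_bound (f g : state -> R) C1 C2 :
  measurable_fun [set: state] f -> measurable_fun [set: state] g ->
  0 <= C1 -> 0 <= C2 -> config_bounded t C1 f -> config_bounded t C2 g ->
  (\int[P]_(w in J) `|f (jt w, cfg [:: i] w) * g (jt w, cfg [:: j] w)|%:E <=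
   (p * (C1 * C2))%:E)%E.
Proof.
move=> mf mg C10 C20 bf bg.
pose f' z := `|f z|; pose g' z := `|g z|.
have mf' : measurable_fun [set: state] f' by exact: measurableT_comp.
have mg' : measurable_fun [set: state] g' by exact: measurableT_comp.
have bn (h : state -> R) C : config_bounded t C h -> config_bounded t C (fun z => `|h z|).
  move=> bh; apply: (ae_imp2 _ bh bh) => s h1 _ /h1.
  by rewrite [X in _ -> (X <= _)%E](eq_integral (fun x => `|h (s, x)|%:E)) // => x _; rewrite normr_id.
have E1 := jump_pos mf' mg' (fun=> normr_ge0 _) (fun=> normr_ge0 _) C10 C20 (bn _ _ bf) (bn _ _ bg).
have [_ h] := jump_mean_integrable mf' mg' C10 C20 (bn _ _ bf) (bn _ _ bg).
under eq_integral do rewrite normrM.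
rewrite [leLHS]E1 lee_fin ler_wpM2l//.
exact: le_trans (ler_norm _) h.
Qed.

Lemma jump_integrable (f g : state -> R) C1 C2 :
  measurable_fun [set: state] f -> measurable_fun [set: state] g ->
  0 <= C1 -> 0 <= C2 -> config_bounded t C1 f -> config_bounded t C2 g ->
  P.-integrable J (EFin \o (fun w => f (jt w, cfg [:: i] w) * g (jt w, cfg [:: j] w))).
Proof.
move=> mf mg C10 C20 bf bg; apply/integrableP; split.
  apply/measurable_EFinP; apply: measurable_funTS.
  by apply: measurable_funM; exact: measurable_at_jump.
apply: le_lt_trans (ltry _).
exact: (jump_abs_bound mf mg C10 C20 bf bg).
Qed.

(** Tonelli covers nonnegative factors. Splitting [f] and [g] into positive and negative parts and
    expanding leaves four such cases. *)
Lemma jump_mean (f g : state -> R) C1 C2 :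
  measurable_fun [set: state] f -> measurable_fun [set: state] g ->
  0 <= C1 -> 0 <= C2 -> config_bounded t C1 f -> config_bounded t C2 g ->
  \int[P]_(w in J) (f (jt w, cfg [:: i] w) * g (jt w, cfg [:: j] w)) =
  p * \int[leb]_(s in `[0, t]) (ker s * (config_mean f s * config_mean g s)).
Proof.
move=> mf mg C10 C20 bf bg.
pose pos (h : state -> R) z := Num.max (h z) 0.
pose neg (h : state -> R) z := Num.max (- h z) 0.
have mJ : measurable J by exact: measurable_jump_event.
have mpos h : measurable_fun [set: state] h -> measurable_fun [set: state] (pos h).
  by move=> mh; apply: measurable_maxr => //; exact: measurable_cst.
have mneg h : measurable_fun [set: state] h -> measurable_fun [set: state] (neg h).
  by move=> mh; apply: measurable_maxr; [exact: measurableT_comp|exact: measurable_cst].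
have pos0 h z : 0 <= pos h z by rewrite /pos le_max lexx orbT.
have neg0 h z : 0 <= neg h z by rewrite /neg le_max lexx orbT.
have posle h z : `|pos h z| <= `|h z|.
  by rewrite ger0_norm// /pos ge_max ler_norm normr_ge0.
have negle h z : `|neg h z| <= `|h z|.
  by rewrite ger0_norm// /neg ge_max normr_ge0 -normrN ler_norm.
have bd (h h' : state -> R) C : measurable_fun [set: state] h -> measurable_fun [set: state] h' ->
    (forall z, `|h' z| <= `|h z|) -> config_bounded t C h -> config_bounded t C h'.
  move=> mh mh' hh' bh; apply: (ae_imp2 _ bh bh) => s h1 _ /h1; apply: le_trans.
  apply: ge0_le_integral => //.
  - by apply/measurable_EFinP; apply: measurableT_comp => //; exact: measurable_config_section.
  - by apply/measurable_EFinP; apply: measurableT_comp => //; exact: measurable_config_section.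
  - by move=> x _; rewrite lee_fin; exact: hh'.
have bfp := bd _ _ _ mf (mpos _ mf) (posle f) bf.
have bfn := bd _ _ _ mf (mneg _ mf) (negle f) bf.
have bgp := bd _ _ _ mg (mpos _ mg) (posle g) bg.
have bgn := bd _ _ _ mg (mneg _ mg) (negle g) bg.
pose I (u v : state -> R) := \int[P]_(w in J) (u (jt w, cfg [:: i] w) * v (jt w, cfg [:: j] w)).
pose H (u v : state -> R) := \int[leb]_(s in `[0, t]) (ker s * (config_mean u s * config_mean v s)).
have IH (u v : state -> R) : measurable_fun [set: state] u -> measurable_fun [set: state] v ->
    (forall z : state, 0 <= u z) -> (forall z : state, 0 <= v z) ->
    config_bounded t C1 u -> config_bounded t C2 v -> I u v = p * H u v.
  by move=> m1 m2 u0 v0 bu bv; rewrite /I /Rintegral (jump_pos m1 m2 u0 v0 C10 C20 bu bv).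
have iP u v m1 m2 bu bv := @jump_integrable u v C1 C2 m1 m2 C10 C20 bu bv.
have iL u v m1 m2 bu bv := proj1 (@jump_mean_integrable u v C1 C2 m1 m2 C10 C20 bu bv).
have IBl (u1 u2 v : state -> R) : measurable_fun [set: state] u1 -> measurable_fun [set: state] u2 ->
    measurable_fun [set: state] v -> config_bounded t C1 u1 -> config_bounded t C1 u2 ->
    config_bounded t C2 v -> I (fun z => u1 z - u2 z) v = I u1 v - I u2 v.
  move=> m1 m2 mv b1 b2 bv; rewrite /I -(RintegralB mJ (iP _ _ m1 mv b1 bv) (iP _ _ m2 mv b2 bv)).
  by apply: eq_Rintegral => w _; rewrite mulrBl.
have IBr (u v1 v2 : state -> R) : measurable_fun [set: state] u -> measurable_fun [set: state] v1 ->
    measurable_fun [set: state] v2 -> config_bounded t C1 u -> config_bounded t C2 v1 ->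
    config_bounded t C2 v2 -> I u (fun z => v1 z - v2 z) = I u v1 - I u v2.
  move=> m0 m1 m2 bu b1 b2; rewrite /I -(RintegralB mJ (iP _ _ m0 m1 bu b1) (iP _ _ m0 m2 bu b2)).
  by apply: eq_Rintegral => w _; rewrite mulrBr.
have fE : f = (fun z => pos f z - neg f z) by apply/funext => z; exact: maxr_sub.
have gE : g = (fun z => pos g z - neg g z) by apply/funext => z; exact: maxr_sub.
have mB (u v : state -> R) s C : measurable_fun [set: state] u -> measurable_fun [set: state] v ->
    (\int[mu]_x `|u (s, x)|%:E <= C%:E)%E -> (\int[mu]_x `|v (s, x)|%:E <= C%:E)%E ->
    config_mean (fun z => u z - v z) s = config_mean u s - config_mean v s.
  move=> m1 m2 b1 b2.
  by rewrite /config_mean (RintegralB measurableT (config_integrable m1 b1) (config_integrable m2 b2)).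
(* [config_mean] is additive at times where both parts are integrable, hence an almost everywhere
   equality of the integrands. *)
have HE : H f g = (H (pos f) (pos g) - H (pos f) (neg g)) -
                  (H (neg f) (pos g) - H (neg f) (neg g)).
  have i1 := iL _ _ (mpos _ mf) (mpos _ mg) bfp bgp.
  have i2 := iL _ _ (mpos _ mf) (mneg _ mg) bfp bgn.
  have i3 := iL _ _ (mneg _ mf) (mpos _ mg) bfn bgp.
  have i4 := iL _ _ (mneg _ mf) (mneg _ mg) bfn bgn.
  have mt : measurable (`[0, t]%classic : set (measurableTypeR R)) by exact: measurable_itv.
  have i12 := integrableB mt i1 i2.
  have i34 := integrableB mt i3 i4.
  rewrite /H -(RintegralB _ i1 i2)// -(RintegralB _ i3 i4)// -RintegralB//.
  rewrite /Rintegral; congr fine; apply: ae_eq_integral => //.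
  - exact: measurable_int (iL _ _ mf mg bf bg).
  - exact: measurable_int (integrableB mt i12 i34).
  - apply: (ae_imp2 _ (ae_imp2 (fun s a b => conj a b) bfp bfn)
                      (ae_imp2 (fun s a b => conj a b) bgp bgn)).
    move=> s [h1 h2] [h3 h4] st /=; congr EFin.
    rewrite [in LHS]fE [in LHS]gE (mB _ _ s C1)//; [|exact: mpos|exact: mneg|exact: h1|exact: h2].
    rewrite (mB _ _ s C2)//; [by ring|exact: mpos|exact: mneg|exact: h3|exact: h4].
rewrite -[LHS]/(I f g) -[X in _ = p * X]/(H f g) HE {1}fE.
have mfp := mpos _ mf; have mfn := mneg _ mf.
have mgp := mpos _ mg; have mgn := mneg _ mg.
rewrite (IBl _ _ _ mfp mfn mg bfp bfn bg).
have -> : I (pos f) g = I (pos f) (pos g) - I (pos f) (neg g).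
  by rewrite {1}gE; exact: IBr.
have -> : I (neg f) g = I (neg f) (pos g) - I (neg f) (neg g).
  by rewrite {1}gE; exact: IBr.
rewrite (IH _ _ mfp mgp (pos0 f) (pos0 g) bfp bgp) (IH _ _ mfp mgn (pos0 f) (neg0 g) bfp bgn).
rewrite (IH _ _ mfn mgp (neg0 f) (pos0 g) bfn bgp) (IH _ _ mfn mgn (neg0 f) (neg0 g) bfn bgn).
move: (H (pos f) (pos g)) (H (pos f) (neg g)) (H (neg f) (pos g)) (H (neg f) (neg g)).
by move=> h1 h2 h3 h4; rewrite !mulrBr.
Qed.

End fixed_jump.
End first_step_expectation.

(** The three regions are intervals up to endpoints and up to points outside [0, 1], which the
    uniform law ignores. *)
Lemma uniform_prob_sandwich {R : realType} (A : set R) (a b : R) :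
  measurable A -> 0 <= a -> a <= b -> b <= 1 ->
  `]a, b[%classic `<=` A -> A `&` `[0, 1]%classic `<=` `[a, b]%classic ->
  uniform_prob (@ltr01 R) A = (b - a)%:E.
Proof.
move=> mA a0 ab b1 h1 h2.
have mA1 : measurable (A `&` `[0, 1]%classic) by apply: measurableI.
rewrite /uniform_prob integral_uniform_pdf (eq_integral (fun=> 1%:E)); last first.
  by move=> x; rewrite inE /= in_itv/= /uniform_pdf => -[_ ->]; rewrite subr0 invr1.
rewrite integral_cst// mul1e; apply/eqP; rewrite eq_le; apply/andP; split.
  apply: (@le_trans _ _ (lebesgue_measure `[a, b]%classic)).
    by apply: le_measure => //; rewrite inE.
  rewrite lebesgue_measure_itv/= lte_fin; case: ifP => // _.
  by rewrite lee_fin subr_ge0.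
apply: (@le_trans _ _ (lebesgue_measure `]a, b[%classic)).
  rewrite lebesgue_measure_itv/= lte_fin; case: ifPn => //.
  by rewrite -leNgt => ba; rewrite lee_fin subr_le0.
apply: le_measure; rewrite ?inE// => x /= xab; split; first exact: h1.
by move: xab; rewrite /= !in_itv/= => /andP[/ltW ax /ltW xb]; rewrite (le_trans a0 ax) (le_trans xb b1).
Qed.

(** * Probabilities of flip, branch and death *)

Section region_probabilities.
Context {R : realType} {d r : nat} (S : system R d r).
Variable k : Zd d.

Let masses : [/\ 0 <= pr S k, 0 <= qtot S k, 0 <= dr S k &
  pr S k + qtot S k + dr S k = 1].
Proof. by split; [exact: pr_ge0|exact: qtot_ge0|exact: dr_ge0|exact: total_massE]. Qed.

Lemma uniform_prob_flip : uniform_prob (@ltr01 R) (flip_region S k) = (pr S k)%:E.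
Proof.
have [p0 q0 d0 tot] := masses.
rewrite (@uniform_prob_sandwich _ _ 0 (pr S k)) ?subr0//.
- exact: measurable_flip_region.
- by lra.
- move=> u /=; rewrite /flip_region/= in_itv/=; lra.
- move=> u [] /=; rewrite /flip_region/= !in_itv/=; lra.
Qed.

Lemma uniform_prob_branch : uniform_prob (@ltr01 R) (branch_region S k) = (qtot S k)%:E.
Proof.
have [p0 q0 d0 tot] := masses.
rewrite (@uniform_prob_sandwich _ _ (1 - qtot S k) 1)//.
- by congr EFin; lra.
- exact: measurable_branch_region.
- by lra.
- by lra.
- move=> u /=; rewrite /branch_region/= in_itv/=; lra.
- move=> u [] /=; rewrite /branch_region/= !in_itv/=; lra.
Qed.

Lemma uniform_prob_death : uniform_prob (@ltr01 R) (death_region S k) = (dr S k)%:E.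
Proof.
have [p0 q0 d0 tot] := masses.
rewrite (@uniform_prob_sandwich _ _ (pr S k) (1 - qtot S k))//.
- by congr EFin; lra.
- exact: measurable_death_region.
- by lra.
- by lra.
- move=> u /=; rewrite /death_region/= in_itv/=; lra.
- move=> u [] /=; rewrite /death_region/= !in_itv/=; lra.
Qed.

Context {disp : measure_display} {Omega : measurableType disp}.
Variables (P : probability Omega R) (E U : label -> {RV P >-> R})
  (Y : label -> Zd d -> Omega -> Zd d * Zd d).
Hypothesis EUY : branching_variables S E U Y.

Lemma root_probT (A2 : set R) : measurable A2 ->
  P (root_event S E U Y k [set: R] A2 [set: Zd d * Zd d]) = uniform_prob (@ltr01 R) A2.
Proof. by move=> mA2; rewrite (root_event_prob EUY)// preimage_setT probability_setT mule1. Qed.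

(** The factor q_k from the uniform draw cancels the normalisation of the law of [Y]; if q_k = 0,
    both sides vanish. *)
Lemma root_prob_branch (l m : Zd d) :
  P (root_event S E U Y k [set: R] (branch_region S k) [set (l, m)]) = (qr S k l m)%:E.
Proof.
rewrite (root_event_prob EUY); last exact: measurable_branch_region.
rewrite uniform_prob_branch.
have [q_gt0|q_le0] := ltP 0 (qtot S k); last first.
  have q_eq0 : qtot S k = 0 by apply/eqP; rewrite eq_le q_le0 qtot_ge0.
  by rewrite q_eq0 mul0e qr_eq0.
have -> : Ynorm S Y [::] k = Y [::] k by apply/funext => w; rewrite /Ynorm q_gt0.
by rewrite (law_Y EUY _ _ _ q_gt0) -EFinM mulrCA divff ?mulr1// gt_eqF.
Qed.

End region_probabilities.

(** * Transfer of expectations to the configuration space *)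

Section expectation_on_configurations.
Context {R : realType} {d r : nat} (S : system R d r).
Context {disp : measure_display} {Omega : measurableType disp}.
Variables (P : probability Omega R) (E U : label -> {RV P >-> R})
  (Y : label -> Zd d -> Omega -> Zd d * Zd d).
Hypothesis EUY : branching_variables S E U Y.
Notation mu := (config_law EUY).
Notation state := (measurableTypeR R * @configT R d)%type.

Lemma ge0_integral_cfg v (h : @configT R d -> \bar R) :
  measurable_fun [set: @configT R d] h -> (forall x, 0 <= h x)%E ->
  (\int[P]_w h (cfg S E U Y v w) = \int[mu]_x h x)%E.
Proof.
move=> mh h0.
have E1 := ge0_integral_pushforward (measurable_cfg EUY v) P measurableT mh (fun x _ => h0 x).
rewrite preimage_setT in E1; rewrite -[LHS]E1.
rewrite (eq_measure_integral mu) //; first exact: measurable_cfg.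
by move=> mc A mA _; exact: (config_lawE EUY v mA).
Qed.

Lemma integral_cfg v (h : @configT R d -> \bar R) :
  measurable_fun [set: @configT R d] h ->
  (\int[P]_w h (cfg S E U Y v w) = \int[mu]_x h x)%E.
Proof.
move=> mh; rewrite integralE [RHS]integralE.
have Ep := ge0_integral_cfg v (measurable_funepos mh) (funepos_ge0 h).
have En := ge0_integral_cfg v (measurable_funeneg mh) (funeneg_ge0 h).
rewrite -Ep -En; congr (_ - _)%E; apply: eq_integral => w _.
  by rewrite !funeposE.
by rewrite !funenegE.
Qed.

Variables (chi0 : Zd d -> Cr R r) (gamma : Zd d -> R -> Cr R r) (T : R).
Hypothesis gamma_Linfty : Linfty T gamma.

Notation gammaT := (gamma_cut gamma T).

Lemma measurable_gamma_cut c k : measurable_fun [set: R] (fun t => rcoord c (gammaT k t)).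
Proof.
have mT : measurable (`[0, T]%classic : set R) by exact: measurable_itv.
have m1 := measurable_rcoord_Linfty c k gamma_Linfty.
rewrite (_ : (fun t => _) = (fun t => rcoord c (gamma k t)) \_ `[0, T]%classic).
  exact/(measurable_restrictT _ mT).
apply/funext => t; rewrite patchE /gamma_cut; case: ifP => // _.
by rewrite rcoord0.
Qed.

Definition value (k : Zd d) (c : 'I_r * bool) (z : state) : R :=
  rcoord c (evalR S chi0 gammaT z.1 (config_tree S k z.2)).

(** The candidate solution written with a jointly measurable integrand, which makes it measurable in
    time. *)
Definition config_chi (k : Zd d) (s : R) : Cr R r :=
  vint mu [set: @configT R d] (fun x => evalR S chi0 gammaT s (config_tree S k x)).

Lemma measurable_value k c : measurable_fun [set: state] (value k c).
Proof. exact: (measurable_evalR S chi0 measurable_gamma_cut k c). Qed.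

Lemma rcoord_config_chi c k s : rcoord c (config_chi k s) = config_mean EUY (value k c) s.
Proof. by rewrite rcoord_vint. Qed.

(** Off the null [bad_event], [evalR] on [Omega] is a measurable function of the configuration at
    the root. *)
Lemma config_chiE k t : t <= T ->
  vint P [set: Omega] (fun w => evalR S chi0 gamma t (branching_tree S E U Y k w)) =
  config_chi k t.
Proof.
move=> tT; apply: rcoordP => c; rewrite rcoord_config_chi rcoord_vint.
rewrite /config_mean /Rintegral; congr fine.
rewrite (integral_off_null (measurable_bad_event E U) (bad_event0 EUY)
  (g := fun w => (value k c (t, cfg S E U Y [::] w))%:E)); last first.
  by move=> w good; rewrite /value/= (evalR_cfg S chi0 gamma Y k tT good).
apply: (integral_cfg [::] (h := fun x => (value k c (t, x))%:E)).
by apply/measurable_EFinP; apply: measurable_config_section; exact: measurable_value.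
Qed.

(** Carries the moment hypothesis over to configurations and to each real coordinate. *)
Lemma value_bounded C k t c : t <= T ->
  (\int[P]_w (enorm (evalR S chi0 gamma t
      (branching_tree S E U Y k w)))%:E <= C%:E)%E ->
  (\int[mu]_x `|value k c (t, x)|%:E <= C%:E)%E.
Proof.
move=> tT; apply: le_trans.
rewrite (integral_off_null (measurable_bad_event E U) (bad_event0 EUY)
  (g := fun w => (enorm (evalR S chi0 gammaT t
     (config_tree S k (cfg S E U Y [::] w))))%:E)); last first.
  by move=> w good; rewrite (evalR_cfg S chi0 gamma Y k tT good).
have ms c' : measurable_fun [set: @configT R d] (fun x => value k c' (t, x)).
  by apply: measurable_config_section; exact: measurable_value.
pose N (x : @configT R d) := enorm (evalR S chi0 gammaT t (config_tree S k x)).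
have mN : measurable_fun [set: @configT R d] N.
  have -> : N = (fun y => Num.sqrt y) \o (fun x => \sum_c' value k c' (t, x) ^+ 2).
    by apply/funext => x; rewrite /N enormE.
  apply: measurableT_comp.
    by apply: continuous_measurable_fun; exact: sqrt_continuous.
  apply: measurable_sum => c'.
  exact: (measurable_funX _ (ms c')).
rewrite [leRHS](ge0_integral_cfg [::] (h := fun x => (N x)%:E)).
- apply: ge0_le_integral => //.
  + by apply/measurable_EFinP; exact: measurableT_comp.
  + exact/measurable_EFinP.
  + by move=> x _; rewrite lee_fin; exact: rcoord_le_enorm.
- exact/measurable_EFinP.
- by move=> x; rewrite lee_fin enorm_ge0.
Qed.

End expectation_on_configurations.

Lemma Rintegral_sum {R : realType} {disp : measure_display} {X : measurableType disp}
    (m : {measure set X -> \bar R}) (D : set X) (I : Type) (s : seq I) (f : I -> X -> R) :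
  measurable D -> (forall i, m.-integrable D (EFin \o f i)) ->
  m.-integrable D (EFin \o (fun x => \sum_(i <- s) f i x)) /\
  \int[m]_(x in D) (\sum_(i <- s) f i x) = \sum_(i <- s) \int[m]_(x in D) f i x.
Proof.
move=> mD fi.
have fiE J : m.-integrable D (EFin \o (fun x => \sum_(i <- J) f i x)).
  rewrite (_ : _ \o _ = fun x => (\sum_(i <- J) (EFin \o f i) x)%E).
    by apply: integrable_sum.
  by apply/funext => x /=; rewrite sumEFin.
split => //; elim: s => [|i s ih].
  rewrite big_nil (eq_Rintegral m (g := fun=> 0)); first by rewrite Rintegral_cst// mul0r.
  by move=> x _; rewrite big_nil.
rewrite big_cons -ih -RintegralD//.
by apply: eq_Rintegral => x _; rewrite big_cons.
Qed.

Lemma integrable_rsum {R : realType} {I : countType} {disp : measure_display}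
    {X : measurableType disp} (m : {measure set X -> \bar R}) (D : set X)
    (f : I -> X -> R) :
  measurable D -> (forall i, measurable_fun D (f i)) ->
  (\esum_(i in [set: I]) \int[m]_(x in D) `|f i x|%:E < +oo)%E ->
  m.-integrable D (EFin \o (fun x => rsum (fun i => f i x))).
Proof.
move=> mD mf sf; apply/integrableP; split.
  by apply/measurable_EFinP; exact: measurable_rsum.
have mn i : measurable_fun D (fun x => `|f i x|%:E).
  by apply/measurable_EFinP; exact: measurableT_comp.
apply: le_lt_trans sf; rewrite -integral_esum//.
apply: ge0_le_integral => //.
- by apply: measurableT_comp => //; apply/measurable_EFinP; exact: measurable_rsum.
- exact: measurable_esum.
- move=> x _ /=.
  have [h|h] := ltP (\esum_(i in [set: I]) `|f i x|%:E)%E +oo%E.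
    rewrite -[leRHS]fineK; first by rewrite lee_fin; exact: rsum_norm_le.
    by rewrite ge0_fin_numE// esum_ge0.
  exact: le_trans (leey _) h.
Qed.

(** * The mild equation for the expectation *)

Section first_step_equation.
Context {R : realType} {d r : nat} (S : system R d r).
Context {disp : measure_display} {Omega : measurableType disp}.
Variables (P : probability Omega R) (E U : label -> {RV P >-> R})
  (Y : label -> Zd d -> Omega -> Zd d * Zd d).
Hypothesis EUY : branching_variables S E U Y.
Variables (chi0 : Zd d -> Cr R r) (gamma : Zd d -> R -> Cr R r) (T C M : R).
Hypothesis gamma_Linfty : Linfty T gamma.
Notation mu := (config_law EUY).
Notation leb := (@lebesgue_measure R).
Notation state := (measurableTypeR R * @configT R d)%type.
Notation cfg := (cfg S E U Y).
Notation gammaT := (gamma_cut gamma T).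
Notation value := (value S chi0 gamma T).
Notation chi := (config_chi EUY chi0 gamma T).
Hypotheses (C_ge0 : 0 <= C) (M_ge0 : 0 <= M).
Hypothesis value_le : forall k c t, t \in `[0, T] ->
  (\int[mu]_x `|value k c (t, x)|%:E <= C%:E)%E.
Hypothesis gamma_le : {ae leb, forall s : R, s \in `[0, T] ->
  forall k, enorm (gamma k s) <= M}.

Variables (k : Zd d) (t : R).
Hypothesis tT : t \in `[0, T].

Let t0 : 0 <= t. Proof. by move: tT; rewrite in_itv/= => /andP[]. Qed.
Let sub_itv s : s \in `[0, t] -> s \in `[0, T].
Proof.
move: tT; rewrite !in_itv/= => /andP[_ t_le] /andP[-> /=].
by move=> s_le; exact: le_trans t_le.
Qed.

Notation jt := (jump_time S E k t).
Notation ker := (ekernel (lam S k) t).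
Notation J := (jump_event S E U Y k t).

Let mvalue l c : measurable_fun [set: state] (value l c).
Proof. exact: measurable_value. Qed.

Let value_bd l c : config_bounded EUY t C (value l c).
Proof. by apply: aeW => s /sub_itv; exact: value_le. Qed.

Let muT : (mu [set: @configT R d] = 1)%E.
Proof. exact: probability_setT. Qed.

Lemma config_mean_fst (f : R -> R) s : config_mean EUY (fun z => f z.1) s = f s.
Proof. by rewrite /config_mean /= Rintegral_cst// [X in _ * fine X]muT mulr1. Qed.

Let mcst1 : measurable_fun [set: state] (fun=> 1 : R).
Proof. exact: measurable_cst. Qed.

Let cst1_bd : config_bounded EUY t 1 (fun=> 1).
Proof.
apply: aeW => s _; rewrite integral_cst// [X in (_ * X)%E]muT mule1.
by rewrite normr1.
Qed.

(** The forcing as a function of time and configuration, so that a death is treated by the same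
    formula as a subtree. *)
Let forcing c (z : state) := rcoord c (gammaT k z.1).

Let mforcing c : measurable_fun [set: state] (forcing c).
Proof.
apply: (@measurableT_comp _ _ _ _ _ _ (fun s : measurableTypeR R => rcoord c (gammaT k s))).
  exact: measurable_gamma_cut.
exact: measurable_fst.
Qed.

Let forcing_bd c : config_bounded EUY t M (forcing c).
Proof.
apply: (ae_imp2 _ gamma_le gamma_le) => s h _ st.
rewrite /forcing/= integral_cst// [X in (_ * X)%E]muT mule1 lee_fin.
apply: (le_trans (rcoord_le_enorm _ _)); rewrite /gamma_cut; case: ifP => _.
  exact: h (sub_itv st) k.
by rewrite enorm0.
Qed.

(** The two-child formula with the constant 1 at some other child [j]. *)
Let jump_mean1 (A2 : set R) A3 (i : 'I_3) (f : state -> R) D : measurable A2 ->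
  measurable_fun [set: state] f -> 0 <= D -> config_bounded EUY t D f ->
  P.-integrable (J A2 A3) (EFin \o (fun w => f (jt w, cfg [:: i] w))) /\
  \int[P]_(w in J A2 A3) f (jt w, cfg [:: i] w) =
  fine (P (root_event S E U Y k [set: R] A2 A3)) *
  \int[leb]_(s in `[0, t]) (ker s * config_mean EUY f s).
Proof.
move=> mA2 mf D0 bf.
pose j : 'I_3 := if i == o0 then o1 else o0.
have ij : i != j by rewrite /j; case: ifPn => [/eqP ->|].
have H1 := jump_integrable k A3 t0 mA2 ij mf mcst1 D0 ler01 bf cst1_bd.
have H2 := jump_mean k A3 t0 mA2 ij mf mcst1 D0 ler01 bf cst1_bd.
split.
  apply: eq_integrable H1 => //; first exact: measurable_jump_event.
  by move=> w _; rewrite /= mulr1.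
transitivity (\int[P]_(w in J A2 A3) (f (jt w, cfg [:: i] w) * 1)).
  by apply: eq_Rintegral => w _; rewrite mulr1.
rewrite H2; congr (_ * _); apply: eq_Rintegral => s _; congr (_ * _).
by rewrite (config_mean_fst (fun=> 1)) mulr1.
Qed.

Lemma flip_mean c :
  P.-integrable (J (flip_region S k) setT)
    (EFin \o (fun w => value k c (jt w, cfg [:: o0] w))) /\
  \int[P]_(w in J (flip_region S k) setT) value k c (jt w, cfg [:: o0] w) =
  pr S k * \int[leb]_(s in `[0, t]) (ker s * rcoord c (chi k s)).
Proof.
have mF := measurable_flip_region S k.
have [h1 h2] := jump_mean1 setT o0 mF (mvalue k c) C_ge0 (value_bd k c).
split => //; rewrite h2 (root_probT k EUY mF) uniform_prob_flip; congr (_ * _).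
by apply: eq_Rintegral => s _; rewrite rcoord_config_chi.
Qed.

Lemma death_mean c :
  P.-integrable (J (death_region S k) setT) (EFin \o (fun w => rcoord c (gammaT k (jt w)))) /\
  \int[P]_(w in J (death_region S k) setT) rcoord c (gammaT k (jt w)) =
  dr S k * \int[leb]_(s in `[0, t]) (ker s * rcoord c (gammaT k s)).
Proof.
have mF := measurable_death_region S k.
have [h1 h2] := jump_mean1 setT o0 mF (mforcing c) M_ge0 (forcing_bd c).
split => //; rewrite [LHS]h2 (root_probT k EUY mF) uniform_prob_death; congr (_ * _).
by apply: eq_Rintegral => s _; rewrite (config_mean_fst (fun s => rcoord c (gammaT k s))).
Qed.

(** The jump formula for the constant 1 gives the mass of the kernel on [[0, t]]. *)
Lemma prob_jump : P (J setT setT) = (1 - expR (- lam S k * t))%:E.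
Proof.
have [h1 h2] := jump_mean1 setT o0 measurableT mcst1 ler01 cst1_bd.
have mJ : measurable (J setT setT) by exact: measurable_jump_event.
rewrite -[LHS]fineK ?fin_num_measure//; congr EFin.
move: h2; rewrite Rintegral_cst// mul1r => ->.
rewrite (root_probT k EUY measurableT).
have -> : uniform_prob (@ltr01 R) setT = 1%E by exact: probability_setT.
rewrite mul1r (eq_Rintegral leb (g := fun s => ker s)); last first.
  by move=> s _; rewrite (config_mean_fst (fun=> 1)) mulr1.
by rewrite /Rintegral integral_ekernel ?lam_gt0// subr0.
Qed.

Let branch_value c l m w :=
  rcoord c (B S k l m
    (evalR S chi0 gammaT (jt w) (config_tree S l (cfg [:: o1] w)))
    (evalR S chi0 gammaT (jt w) (config_tree S m (cfg [:: o2] w)))).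

Let o12 : o1 != o2. Proof. by []. Qed.
Let mB := measurable_branch_region S k.

Let branch_prod l m (c1 c2 : 'I_r * bool) (w : Omega) : R :=
  value l c1 (jt w, cfg [:: o1] w) * value m c2 (jt w, cfg [:: o2] w).

Let branch_prodP l m c1 c2 :
  [/\ P.-integrable (J (branch_region S k) [set (l, m)]) (EFin \o branch_prod l m c1 c2),
      \int[P]_(w in J (branch_region S k) [set (l, m)]) branch_prod l m c1 c2 w =
        qr S k l m * \int[leb]_(s in `[0, t])
          (ker s * (rcoord c1 (chi l s) * rcoord c2 (chi m s))) &
      \int[P]_(w in J (branch_region S k) [set (l, m)]) `|branch_prod l m c1 c2 w| <=
        qr S k l m * (C * C)].
Proof.
have H1 := jump_integrable k [set (l, m)] t0 mB o12 (mvalue l c1) (mvalue m c2)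
  C_ge0 C_ge0 (value_bd l c1) (value_bd m c2).
have H2 := jump_mean k [set (l, m)] t0 mB o12 (mvalue l c1) (mvalue m c2)
  C_ge0 C_ge0 (value_bd l c1) (value_bd m c2).
have H3 := jump_abs_bound k [set (l, m)] t0 mB o12 (mvalue l c1) (mvalue m c2)
  C_ge0 C_ge0 (value_bd l c1) (value_bd m c2).
have mJ := measurable_jump_event EUY k t [set (l, m)] mB.
rewrite (root_prob_branch k EUY) in H2 H3.
split; first exact: H1.
- rewrite [LHS]H2; congr (_ * _); apply: eq_Rintegral => s _.
  by rewrite !rcoord_config_chi.
- rewrite -lee_fin; apply: le_trans H3.
  by rewrite /Rintegral fineK//; exact: integrable_fin_num (integrable_norm H1).
Qed.

Let branch_valueE c l m w : branch_value c l m w =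
  \sum_c1 \sum_c2 rcoord c (B S k l m (rbasis c1) (rbasis c2)) * branch_prod l m c1 c2 w.
Proof. by rewrite /branch_value rcoord_bilinear. Qed.

Lemma branch_integrable c l m :
  P.-integrable (J (branch_region S k) [set (l, m)]) (EFin \o branch_value c l m).
Proof.
have mJ := measurable_jump_event EUY k t [set (l, m)] mB.
have -> : branch_value c l m = fun w => \sum_c1 \sum_c2
    rcoord c (B S k l m (rbasis c1) (rbasis c2)) * branch_prod l m c1 c2 w.
  by apply/funext => w; exact: branch_valueE.
apply: (proj1 (Rintegral_sum _ mJ _)) => c1; apply: (proj1 (Rintegral_sum _ mJ _)) => c2.
have [h _ _] := branch_prodP l m c1 c2.
exact: (integrableZl mJ _ h).
Qed.

(** The jump formula applies to products of coordinates, so both sides are expanded into finite sums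
    over pairs of coordinates. *)
Lemma branch_mean c l m :
  \int[P]_(w in J (branch_region S k) [set (l, m)]) branch_value c l m w =
  \int[leb]_(s in `[0, t]) (ker s * bsummand S chi c k s (l, m)).
Proof.
have mJ := measurable_jump_event EUY k t [set (l, m)] mB.
have mt : measurable (`[0, t]%classic : set (measurableTypeR R)) by exact: measurable_itv.
pose b c1 c2 := rcoord c (B S k l m (rbasis c1) (rbasis c2)).
pose h c1 c2 s := ker s * (rcoord c1 (chi l s) * rcoord c2 (chi m s)).
have ih c1 c2 : leb.-integrable `[0, t] (EFin \o h c1 c2).
  have [h1 _] := jump_mean_integrable k t0 (mvalue l c1) (mvalue m c2)
    C_ge0 C_ge0 (value_bd l c1) (value_bd m c2).
  apply: eq_integrable h1 => //.
  by move=> s _; rewrite /h/= !rcoord_config_chi.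
have iP c1 c2 : P.-integrable (J (branch_region S k) [set (l, m)])
    (EFin \o (fun w => b c1 c2 * branch_prod l m c1 c2 w)).
  by have [h1 _ _] := branch_prodP l m c1 c2; exact: (integrableZl mJ _ h1).
have iL c1 c2 : leb.-integrable `[0, t] (EFin \o (fun s => qr S k l m * b c1 c2 * h c1 c2 s)).
  exact: (integrableZl mt _ (ih c1 c2)).
transitivity (\sum_c1 \sum_c2 (qr S k l m * b c1 c2 * \int[leb]_(s in `[0, t]) h c1 c2 s)).
  rewrite (eq_Rintegral P (g := fun w => \sum_c1 \sum_c2 b c1 c2 * branch_prod l m c1 c2 w)).
    rewrite (proj2 (Rintegral_sum _ mJ _)) => [|c1].
      apply: eq_bigr => c1 _; rewrite (proj2 (Rintegral_sum _ mJ (iP c1))).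
      apply: eq_bigr => c2 _; have [h1 h2 _] := branch_prodP l m c1 c2.
      by rewrite (RintegralZl _ mJ h1) h2 -mulrA mulrCA.
    exact: (proj1 (Rintegral_sum _ mJ (iP c1))).
  by move=> w _; exact: branch_valueE.
rewrite [RHS](eq_Rintegral leb (g := fun s => \sum_c1 \sum_c2 (qr S k l m * b c1 c2 * h c1 c2 s))).
  rewrite (proj2 (Rintegral_sum _ mt _)) => [|c1].
    apply: eq_bigr => c1 _; rewrite (proj2 (Rintegral_sum _ mt (iL c1))).
    by apply: eq_bigr => c2 _; rewrite (RintegralZl _ mt (ih c1 c2)).
  exact: (proj1 (Rintegral_sum _ mt (iL c1))).
move=> s _; rewrite /bsummand/= rcoord_bilinear !mulr_sumr; apply: eq_bigr => c1 _.
rewrite !mulr_sumr; apply: eq_bigr => c2 _; rewrite /h /b.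
by ring.
Qed.

(** Supplies the majorant for exchanging the sum over offspring pairs with the expectation. *)
Lemma branch_abs_bound c l m :
  (\int[P]_(w in J (branch_region S k) [set (l, m)]) `|branch_value c l m w|%:E <=
   (\sum_(c1 : 'I_r * bool) \sum_(c2 : 'I_r * bool) (C * C) * qr S k l m)%:E)%E.
Proof.
have mJ := measurable_jump_event EUY k t [set (l, m)] mB.
have ia c1 c2 : P.-integrable (J (branch_region S k) [set (l, m)])
    (EFin \o (fun w => `|branch_prod l m c1 c2 w|)).
  by have [h1 _ _] := branch_prodP l m c1 c2; exact: integrable_norm h1.
have is1 c1 := Rintegral_sum (index_enum _) mJ (ia c1).
have [i2 e2] := Rintegral_sum (index_enum _) mJ (fun c1 => proj1 (is1 c1)).
apply: (@le_trans _ _ (\int[P]_(w in J (branch_region S k) [set (l, m)])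
    (\sum_c1 \sum_c2 `|branch_prod l m c1 c2 w|)%:E)%E).
  apply: le_integral => //.
  - exact: integrable_norm (branch_integrable c l m).
  - move=> w _; rewrite lee_fin.
    have := rcoord_bilinear_bound c
      (evalR S chi0 gammaT (jt w) (config_tree S l (cfg [:: o1] w)))
      (evalR S chi0 gammaT (jt w) (config_tree S m (cfg [:: o2] w))) (B_le S k l m).
    move/le_trans; apply; apply: ler_sum => c1 _; apply: ler_sum => c2 _.
    by rewrite /branch_prod normrM.
rewrite -[leLHS]fineK; last exact: integrable_fin_num i2.
rewrite lee_fin [leLHS]e2; apply: ler_sum => c1 _.
rewrite (proj2 (is1 c1)); apply: ler_sum => c2 _.
by have [_ _ h3] := branch_prodP l m c1 c2; rewrite mulrC.
Qed.

Let mem_J A2 A3 w : (w \in J A2 A3) =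
  [&& 0 < jt w, U [::] w \in A2 & Ynorm S Y [::] k w \in A3].
Proof.
rewrite jump_eventE in_setI; congr andb; first by apply/idP/idP; rewrite inE.
rewrite /root_event !in_setI; congr andb.
by rewrite in_setT.
Qed.

(** Written as a sum of functions restricted to events, so that it can be integrated term by term;
    at each outcome at most one term is nonzero. *)
Let value_first_step c w : value k c (t, cfg [::] w) =
  ((fun=> rcoord c (chi0 k)) \_ (~` J setT setT)) w +
  Cf S * ((fun w => value k c (jt w, cfg [:: o0] w)) \_ (J (flip_region S k) setT)) w +
  Cb S * rsum (fun lm => (branch_value c lm.1 lm.2 \_
    (J (branch_region S k) [set (lm.1, lm.2)])) w) +
  ((fun w => rcoord c (gammaT k (jt w))) \_ (J (death_region S k) setT)) w.
Proof.
pose y := Ynorm S Y [::] k w.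
(* At a given outcome the drawn pair [y] alone can contribute to the sum. *)
rewrite (@rsum1 _ _ _ y); last first.
  move=> [l m] ne; rewrite patchE mem_J/= -/y.
  case: ifPn => // /and3P[_ _]; rewrite inE /= => yE.
  by rewrite yE eqxx in ne.
have -> : value k c (t, cfg [::] w) = rcoord c (first_step S chi0 gammaT k t
    (E [::] w) (U [::] w) y
    (fun i s l => evalR S chi0 gammaT s (config_tree S l (cfg [:: i] w)))).
  (* Up to conversion, the child trees are the trees of the configurations [cfg [:: i] w]. *)
  by congr rcoord; exact: evalR_first_step.
rewrite !patchE in_setC !mem_J !in_setT -/y -surjective_pairing.
have -> : y \in [set y] by rewrite inE.
rewrite !andbT /first_step -/(jump_time S E k t w) leNgt.
have memE (A : R -> bool) u : (u \in [set u | A u]) = A u.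
  by apply/idP/idP; rewrite inE.
rewrite /flip_region /branch_region /death_region !memE.
case: (0 < jt w); rewrite ?andbF ?andTb/=; last by rewrite !(mulr0, addr0).
case: (0 <= U [::] w <= pr S k); case: (1 - qtot S k <= U [::] w <= 1);
  rewrite /= ?rcoord0 ?rcoordZ !(mulr0, addr0, add0r)//.
Qed.

Let chi_bound l s : s \in `[0, T] -> enorm (chi l s) <= \sum_(c : 'I_r * bool) C.
Proof.
move=> sT; apply: (le_trans (enorm_le_sum _)); apply: ler_sum => c _.
rewrite rcoord_config_chi; apply: config_mean_norm; first exact: measurable_value.
exact: value_le.
Qed.

(** The bound [C * C] for each pair of real coordinates of the two subtrees; it dominates the branch
    terms under the expectation and under the time integral alike. *)
Let K : R := \sum_(c1 : 'I_r * bool) \sum_(c2 : 'I_r * bool) C * C.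

Let K_ge0 : 0 <= K.
Proof. by apply: sumr_ge0 => *; apply: sumr_ge0 => *; exact: mulr_ge0. Qed.

Let mchi l c : measurable_fun `[0, t] (fun s => rcoord c (chi l s)).
Proof.
have -> : (fun s => rcoord c (chi l s)) = config_mean EUY (value l c).
  by apply/funext => s; exact: rcoord_config_chi.
apply: measurable_funTS; apply: measurable_config_mean; exact: measurable_value.
Qed.

Let mbsummand c lm : measurable_fun `[0, t] (bsummand S chi c k ^~ lm).
Proof.
apply: measurable_funM; first exact: measurable_cst.
by apply: measurable_bilinear => c'; exact: mchi.
Qed.

Let bsummand_le c lm s : s \in `[0, t] ->
  `|bsummand S chi c k s lm| <= K * qr S k lm.1 lm.2.
Proof.
move=> /sub_itv sT; rewrite normrM ger0_norm ?qr_ge0// mulrC ler_wpM2r ?qr_ge0//.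
apply: le_trans (rcoord_bilinear_bound _ _ _ (B_le S k _ _)) _.
apply: ler_sum => c1 _; apply: ler_sum => c2 _; apply: ler_pM => //;
  rewrite rcoord_config_chi; apply: config_mean_norm; try exact: measurable_value;
  exact: value_le.
Qed.

(** Sum and integral are exchanged twice, over outcomes and over times, with the summable majorant
    [K * qr S k l m] in both cases. *)
Let branch_sum_mean c :
  P.-integrable setT (EFin \o (fun w => rsum (fun lm => (branch_value c lm.1 lm.2 \_
    (J (branch_region S k) [set (lm.1, lm.2)])) w))) /\
  \int[P]_w rsum (fun lm => (branch_value c lm.1 lm.2 \_
    (J (branch_region S k) [set (lm.1, lm.2)])) w) =
  \int[leb]_(s in `[0, t]) (ker s * rsum (bsummand S chi c k s)).
Proof.
have mJ l m := measurable_jump_event EUY k t [set (l, m)] mB.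
have mt : measurable (`[0, t]%classic : set (measurableTypeR R)) by exact: measurable_itv.
pose bv (lm : Zd d * Zd d) := branch_value c lm.1 lm.2 \_
  (J (branch_region S k) [set (lm.1, lm.2)]).
have mbv lm : measurable_fun setT (bv lm).
  apply/(measurable_restrictT _ (mJ _ _)); apply/measurable_EFinP.
  exact: measurable_int (branch_integrable c lm.1 lm.2).
have sP : (\esum_(lm in [set: Zd d * Zd d]) \int[P]_w `|bv lm w|%:E < +oo)%E.
  apply: (@le_lt_trans _ _ (K * qtot S k)%:E); last exact: ltry.
  rewrite -esum_qrZ//; apply: le_esum => lm _.
  have -> : (\int[P]_w `|bv lm w|%:E = \int[P]_(w in J (branch_region S k) [set (lm.1, lm.2)])
      `|branch_value c lm.1 lm.2 w|%:E)%E.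
    rewrite [RHS]integral_mkcond; apply: eq_integral => w _.
    by rewrite /bv !patchE; case: ifP => // _; rewrite normr0.
  apply: (le_trans (branch_abs_bound c lm.1 lm.2)); rewrite lee_fin /K mulr_suml.
  by apply: ler_sum => c1 _; rewrite mulr_suml.
split; first exact: (integrable_rsum measurableT mbv sP).
rewrite [LHS](Rintegral_rsum measurableT mbv sP).
pose hs (lm : Zd d * Zd d) (s : R) := ker s * bsummand S chi c k s lm.
have mhs lm : measurable_fun `[0, t] (hs lm).
  by apply: measurable_funM; [exact: measurable_ekernel|exact: mbsummand].
have sL : (\esum_(lm in [set: Zd d * Zd d]) \int[leb]_(s in `[0%R, t]) `|hs lm s|%:E < +oo)%E.
  apply: (@le_lt_trans _ _ (K * qtot S k)%:E); last exact: ltry.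
  rewrite -esum_qrZ//; apply: le_esum => lm _.
  have [|||i1 i2] := @ekernel_bounded R (lam S k) t (K * qr S k lm.1 lm.2)
    (fun s => `|bsummand S chi c k s lm|) (lam_gt0 S k) t0.
  - by rewrite mulr_ge0// qr_ge0.
  - exact: measurableT_comp.
  - by apply: aeW => s st; rewrite normr_id; exact: bsummand_le.
  have -> : (\int[leb]_(s in `[0%R, t]) `|hs lm s|%:E = \int[leb]_(s in `[0%R, t])
      (EFin \o (fun s => ker s * `|bsummand S chi c k s lm|)%R) s)%E.
    apply: eq_integral => s _; by rewrite /hs/= normrM (ger0_norm (ekernel_ge0 _ _ (lam_gt0 S k))).
  rewrite -[leLHS]fineK; last exact: (integrable_fin_num mt i1).
  by rewrite lee_fin; exact: le_trans (ler_norm _) i2.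
transitivity (rsum (fun lm => \int[leb]_(s in `[0, t]) hs lm s)).
  congr rsum; apply/funext => lm; rewrite /bv -Rintegral_mkcond branch_mean.
  by rewrite -surjective_pairing.
rewrite -(Rintegral_rsum mt mhs sL); apply: eq_Rintegral => s; rewrite inE => st.
have [h _] := bsummand_bound S c k (fun l => chi_bound l (sub_itv st)).
exact: rsumZ.
Qed.

Lemma config_chi_mild c :
  rcoord c (chi k t) = expR (- lam S k * t) * rcoord c (chi0 k) +
    \int[leb]_(s in `[0, t]) (ker s * rcoord c (nonlinearity S gammaT chi k s)).
Proof.
have mt : measurable (`[0, t]%classic : set (measurableTypeR R)) by exact: measurable_itv.
have mJ A2 A3 mA2 := @measurable_jump_event _ _ _ S _ _ P E U Y EUY k t A2 A3 mA2.
have restr_int (A : set Omega) f : measurable A -> P.-integrable A (EFin \o f) ->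
    P.-integrable setT (EFin \o (f \_ A)).
  by move=> mA /(integrable_mkcond _ mA); rewrite restrict_EFin.
have mJC : measurable (~` J setT setT) by apply: measurableC; exact: mJ.
have i1 := restr_int _ _ mJC (finite_measure_integrable_cst P (rcoord c (chi0 k)) mJC).
have [flip_i flip_e] := flip_mean c.
have [death_i death_e] := death_mean c.
have [branch_i branch_e] := branch_sum_mean c.
have i2 := integrableZl measurableT (Cf S) (restr_int _ _ (mJ _ _ (measurable_flip_region S k)) flip_i).
have i3 := integrableZl measurableT (Cb S) branch_i.
have i4 := restr_int _ _ (mJ _ _ (measurable_death_region S k)) death_i.
have i12 := integrableD measurableT i1 i2.
have i123 := integrableD measurableT i12 i3.
(* The mean over configurations is moved back to [Omega], where the root variables and the child
   configurations are defined together. *)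
have -> : rcoord c (chi k t) = \int[P]_w value k c (t, cfg [::] w).
  rewrite rcoord_config_chi /config_mean /Rintegral; congr fine.
  apply/esym; apply: (integral_cfg EUY [::] (h := fun x => (value k c (t, x))%:E)).
  by apply/measurable_EFinP; apply: measurable_config_section; exact: measurable_value.
rewrite [LHS](eq_Rintegral P (fun w _ => value_first_step c w)).
rewrite (RintegralD measurableT i123 i4) (RintegralD measurableT i12 i3) (RintegralD measurableT i1 i2).
rewrite (RintegralZl _ measurableT (restr_int _ _ (mJ _ _ (measurable_flip_region S k)) flip_i)).
rewrite (RintegralZl _ measurableT branch_i) branch_e.
rewrite -!Rintegral_mkcond flip_e death_e Rintegral_cst//.
have PC : (P (~` J setT setT) = (expR (- lam S k * t))%:E)%E.
  rewrite (probability_setC P (mJ _ setT measurableT)) prob_jump -EFinB.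
  by congr EFin; ring.
rewrite [X in _ * fine X + _]PC /= mulrC -!addrA; congr (_ + _).
have [|||j1 _] := @ekernel_bounded R (lam S k) t (\sum_(c : 'I_r * bool) C)
  (fun s => rcoord c (chi k s)) (lam_gt0 S k) t0.
- exact: sumr_ge0.
- exact: mchi.
- apply: aeW => s /sub_itv sT; apply: (le_trans (rcoord_le_enorm _ _)); exact: chi_bound.
have [|||j2 _] := @ekernel_bounded R (lam S k) t (K * qtot S k)
  (fun s => rsum (bsummand S chi c k s)) (lam_gt0 S k) t0.
- by rewrite mulr_ge0// qtot_ge0.
- apply: (@measurable_rsum _ (Zd d * Zd d)%type _ _ _ (fun lm s => bsummand S chi c k s lm)).
  exact: mbsummand.
- apply: aeW => s st.
  by have [_ ->] := @qr_rsum_bound _ _ _ S k K (bsummand S chi c k s) K_ge0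
    (fun lm => bsummand_le c lm st).
have [|||j3 _] := @ekernel_bounded R (lam S k) t M (fun s => rcoord c (gammaT k s))
  (lam_gt0 S k) t0.
- exact: M_ge0.
- by apply: measurable_funTS; exact: measurable_gamma_cut.
- apply: (ae_imp2 _ gamma_le gamma_le) => s h _ st.
  apply: (le_trans (rcoord_le_enorm _ _)); rewrite /gamma_cut; case: ifP => _.
    exact: h (sub_itv st) k.
  by rewrite enorm0.
have k1 := integrableZl mt (Cf S * pr S k) j1.
have k2 := integrableZl mt (Cb S) j2.
have k3 := integrableZl mt (dr S k) j3.
have k12 := integrableD mt k1 k2.
rewrite [RHS](eq_Rintegral leb (g := fun s => Cf S * pr S k * (ker s * rcoord c (chi k s)) +
  Cb S * (ker s * rsum (bsummand S chi c k s)) + dr S k * (ker s * rcoord c (gammaT k s)))); last first.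
  by move=> s _; rewrite rcoord_nonlinearity; ring.
rewrite (RintegralD mt k12 k3) (RintegralD mt k1 k2) (RintegralZl _ mt j1) (RintegralZl _ mt j2).
by rewrite (RintegralZl _ mt j3) !mulrA addrA.
Qed.

End first_step_equation.

Theorem theorem3p6 (R : realType) (d r : nat) (d_ge1 : (1 <= d)%N)
    (r_ge1 : (1 <= r)%N) (S : system R d r)
    (disp : measure_display) (Omega : measurableType disp)
    (P : probability Omega R)
    (E U : label -> {RV P >-> R}) (Y : label -> Zd d -> Omega -> Zd d * Zd d)
    (EUY : branching_variables S E U Y)
    (chi0 : Zd d -> Cr R r) (chi0_bounded : linfty chi0)
    (T : R) (T_gt0 : 0 < T)
    (gamma : Zd d -> R -> Cr R r) (gamma_Linfty : Linfty T gamma)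
    (bounded_moment : exists C : R, forall (k : Zd d) (t : R), t \in `[0, T] ->
      (\int[P]_w (enorm (evalR S chi0 gamma t
          (branching_tree S E U Y k w)))%:E <= C%:E)%E) :
  let chi (k : Zd d) (t : R) : Cr R r :=
    vint P [set: Omega]
      (fun w => evalR S chi0 gamma t (branching_tree S E U Y k w)) in
  mild_solution S T chi0 gamma chi /\
  forall chi' : Zd d -> R -> Cr R r, mild_solution S T chi0 gamma chi' ->
    forall (k : Zd d) (t : R), t \in `[0, T] -> chi' k t = chi k t.
Proof.
have [C0 hC0] := bounded_moment; have [_ [M0 hM0]] := gamma_Linfty.
pose C := Num.max 0 C0; pose M := Num.max 0 M0.
have C_ge0 : 0 <= C by rewrite le_max lexx.
have M_ge0 : 0 <= M by rewrite le_max lexx.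
have itvP t : t \in `[0, T] -> 0 <= t /\ t <= T by rewrite in_itv/= => /andP[].
have value_le k c t : t \in `[0, T] ->
    (\int[config_law EUY]_x `|value S chi0 gamma T k c (t, x)|%:E <= C%:E)%E.
  move=> tT; apply: (value_bounded EUY gamma_Linfty) (proj2 (itvP _ tT)) _.
  by apply: (le_trans (hC0 k t tT)); rewrite lee_fin le_max lexx orbT.
have gamma_le : {ae lebesgue_measure, forall s : R, s \in `[0, T] ->
    forall k, enorm (gamma k s) <= M}.
  by apply: (ae_imp2 _ hM0 hM0) => s h _ sT k; rewrite le_max h// orbT.
move=> chi; pose chi' := config_chi EUY chi0 gamma T.
have chiE k t : t \in `[0, T] -> chi k t = chi' k t.
  by move=> /itvP[_ tT]; exact: config_chiE.
have chi_sol : mild_solution S T chi0 gamma chi.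
  split.
    split.
      have mc k c : measurable_fun `[0, T] (fun t => rcoord c (chi k t)).
        apply: (@eq_measurable_fun _ _ _ _ _ (config_mean EUY (value S chi0 gamma T k c))).
          by move=> t; rewrite inE => tT; rewrite chiE// rcoord_config_chi.
        apply: measurable_funTS; apply: measurable_config_mean; exact: measurable_value.
      by move=> k j; split; [exact: (mc k (j, true))|exact: (mc k (j, false))].
    exists (\sum_(c : 'I_r * bool) C); apply: aeW => t tT k.
    apply: (le_trans (enorm_le_sum _)); apply: ler_sum => c _.
    rewrite chiE// rcoord_config_chi; apply: config_mean_norm.
      exact: measurable_value.
    exact: value_le.
  move=> k t tT; apply: rcoordP => c; have [t0 t_le] := itvP _ tT.
  rewrite chiE// (config_chi_mild gamma_Linfty C_ge0 M_ge0 value_le gamma_le k tT).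
  rewrite rcoordD rcoordZ rcoord_vint; congr (_ + _); apply: eq_Rintegral => s.
  rewrite inE/= in_itv/= => /andP[s0 st].
  have sT : s \in `[0, T] by rewrite in_itv/= s0 (le_trans st).
  have chi_s : (fun l => chi l s) = (fun l => chi' l s) by apply/funext => l; exact: chiE.
  have gamma_s : gamma_cut gamma T k s = gamma k s by rewrite /gamma_cut mem_set.
  (* The nonlinearity at time [s] reads [chi] and [gamma] at [s] alone. Freezing both there allows
     the substitution of equalities that hold on [[0, T]] but may fail outside. *)
  pose N (a : Zd d -> Cr R r) (g : Cr R r) : Cr R r := nonlinearity S (fun _ _ => g) (fun l _ => a l) k s.
  rewrite rcoordZ -[X in _ * rcoord c X = _]/(N (fun l => chi' l s) (gamma_cut gamma T k s)).
  by rewrite -[X in _ = _ * rcoord c X]/(N (fun l => chi l s) (gamma k s)) chi_s gamma_s.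
split=> // chi1 sol1 k t tT.
exact: (mild_solution_unique chi0_bounded gamma_Linfty sol1 chi_sol).
Qed.
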